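(* Fix an integer $m\ge2$, $\alpha\in(0,1)$, and $(\gamma^0,\Omega^0,\kappa^0)\in\mathbb R\times\mathbb R\times(0,\infty)$ (in particular $\kappa^0<\infty$). There exists $\varepsilon>0$ such that, if $\mathscr V$ is an $m$-fold symmetric hollow vortex with parameter values $(\gamma,\Omega,\kappa)$, $\kappa\in(0,\infty)$, and such that (i) $|\mathscr V|=\pi$; (ii) the velocity field in the lab frame, $\mathbf U-\frac{1}{2\kappa}\boldsymbol\xi+\Omega\boldsymbol\xi^\perp$, vanishes at infinity; and (iii) $\partial\mathscr V$ is parameterized by some $Z=Z(\theta)\in C^{1+\alpha}_{\mathrm{per}}([0,2\pi),\mathbb C)$ with $$\|Z-e^{i\theta}\|_{C^{1+\alpha}}+|\gamma-\gamma^0|+|\kappa-\kappa^0|+|\Omega-\Omega^0|<\varepsilon,$$ then $\mathscr V$ is necessarily the unit disk $B_1$ centered at the origin and the relative velocity field is exactly $$\mathbf U(\boldsymbol\xi)=\frac{\gamma}{2\pi}\frac{\boldsymbol\xi^\perp}{|\boldsymbol\xi|^2}-\frac1{2\kappa}\frac{\boldsymbol\xi}{|\boldsymbol\xi|^2}+\frac1{2\kappa}\boldsymbol\xi-\Omega\boldsymbol\xi^\perp.$$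
   Context: Identify $\mathbb R^2\cong\mathbb C$, and write $(x,y)^\perp=(-y,x)$, $\nabla^\perp=(-\partial_y,\partial_x)$. A (single, self-similarly imploding) hollow vortex with parameter values $(\gamma,\Omega,\kappa)\in\mathbb R\times\mathbb R\times(0,\infty)$ consists of a bounded region $\mathscr V\subset\mathbb R^2$ (the vortex core) whose boundary $\Gamma=\partial\mathscr V$ is a Jordan curve, together with a relative velocity field $\mathbf U$ and a pressure $P$ defined on the closure of the fluid domain $\mathscr D:=\mathbb R^2\setminus\overline{\mathscr V}$, satisfying classically (all functions of $\boldsymbol\xi$) $$\mathbf U\cdot\nabla\mathbf U+2\Omega\mathbf U^\perp-\Big(\frac1{4\kappa^2}+\Omega^2\Big)\boldsymbol\xi=-\nabla P,\qquad \nabla\cdot\mathbf U=\frac1\kappa,\qquad \nabla^\perp\cdot\mathbf U=-2\Omega\qquad\text{in }\mathscr D,$$ $$\int_\Gamma\mathbf t\cdot\mathbf U\,ds=\gamma-2\Omega|\mathscr V|,\qquad \mathbf n\cdot\mathbf U=0\ \text{ on }\Gamma,\qquad P\ \text{is constant on }\Gamma,$$ where $\mathbf t,\mathbf n$ are unit tangent and normal vectors, $\Gamma$ is oriented counterclockwise, and $|\mathscr V|$ is the area of $\mathscr V$. The vortex is $m$-fold symmetric if the fluid domain $\mathscr D$ and the relative velocity $\mathbf U$ are invariant under rotations by $2\pi/m$ radians about the origin (that is, $\mathbf U(R\boldsymbol\xi)=R\,\mathbf U(\boldsymbol\xi)$ with $R$ the rotation by $2\pi/m$). $C^{1+\alpha}_{\mathrm{per}}([0,2\pi),\mathbb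 C)$ denotes $2\pi$-periodic complex-valued functions of class $C^{1+\alpha}$. *)

(* Defs.v *)
From HB Require Import structures.
From mathcomp Require Import all_boot all_order all_algebra.
From mathcomp Require Import all_classical all_reals all_analysis.

Set Implicit Arguments.
Unset Strict Implicit.
Unset Printing Implicit Defensive.

Import Order.TTheory GRing.Theory Num.Theory.
Import numFieldNormedType.Exports.

Local Open Scope classical_set_scope.
Local Open Scope ring_scope.

Section Plane.
Context {R : realType}.
Implicit Types (u v xi : R * R) (t : R).

Definition dotp u v : R := u.1 * v.1 + u.2 * v.2.

(* The library norm on [R * R] is the max norm; this is the Euclidean one. *)
Definition enorm u : R := Num.sqrt (dotp u u).

Definition perp u : R * R := (- u.2, u.1).

Definition rotation t u : R * R :=
  (cos t * u.1 - sin t * u.2, sin t * u.1 + cos t * u.2).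

Definition cis t : R * R := (cos t, sin t).

Definition unit_disk : set (R * R) := [set xi | enorm xi < 1].

Definition area (A : set (R * R)) : \bar R :=
  (lebesgue_measure \x lebesgue_measure)%E A.

Definition frontier (A : set (R * R)) : set (R * R) := closure A `\` interior A.

Definition e1 : R * R := (1, 0).
Definition e2 : R * R := (0, 1).

Definition grad (P : R * R -> R) xi : R * R := ('D_e1 P xi, 'D_e2 P xi).

Definition divergence (U : R * R -> R * R) xi : R :=
  'D_e1 (fst \o U) xi + 'D_e2 (snd \o U) xi.

Definition curl (U : R * R -> R * R) xi : R :=
  'D_e1 (snd \o U) xi - 'D_e2 (fst \o U) xi.

Definition advection (U : R * R -> R * R) xi : R * R :=
  (U xi).1 *: 'D_e1 U xi + (U xi).2 *: 'D_e2 U xi.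

Definition C1_on (E : normedModType R) (D : set (R * R)) (f : R * R -> E) :=
  forall xi, D xi ->
    [/\ differentiable f xi,
        {for xi, continuous ('D_e1 f)} & {for xi, continuous ('D_e2 f)}].

End Plane.

Section Curves.
Context {R : realType}.
Implicit Types (Z : R -> R * R) (G V : set (R * R)) (alpha t : R).

Definition periodic2pi Z := forall t, Z (t + 2 * pi) = Z t.

Definition parametrizes Z G :=
  [/\ periodic2pi Z,
      {in `[0, 2 * pi[ &, injective Z}
    & Z @` [set` `[0, 2 * pi[] = G].

(* "Counterclockwise" is the usual boundary orientation: [V] lies to the left
   of its boundary curve. *)
Definition ccw_boundary_param Z V :=
  [/\ parametrizes Z (frontier V),
      forall t, derivable Z t 1,
      continuous (derive1 Z),
      forall t, derive1 Z t <> 0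
    & forall t, \forall s \near 0^'+, V (Z t + s *: perp (derive1 Z t))].

Definition unit_tangent Z t : R * R := (enorm (derive1 Z t))^-1 *: derive1 Z t.

Definition unit_normal Z t : R * R := - perp (unit_tangent Z t).

Definition arclength_integral Z (f : R -> R) : R :=
  \int[lebesgue_measure]_(t in [set` `[0, 2 * pi]]) (f t * enorm (derive1 Z t)).

Definition sup_norm Z : \bar R := ereal_sup [set (enorm (Z t))%:E | t in setT].

Definition holder_seminorm alpha Z : \bar R :=
  ereal_sup [set (enorm (Z st.1 - Z st.2) / `|st.1 - st.2| `^ alpha)%:E
            | st in [set st : R * R | st.1 != st.2]].

Definition C1alpha_norm alpha Z : \bar R :=
  (sup_norm Z + sup_norm (derive1 Z) + holder_seminorm alpha (derive1 Z))%E.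

Definition C1alpha_per alpha Z :=
  [/\ periodic2pi Z, forall t, derivable Z t 1, continuous (derive1 Z)
    & (C1alpha_norm alpha Z < +oo)%E].

End Curves.

Section HollowVortex.
Context {R : realType}.
Implicit Types (gamma Omega kappa : R) (V : set (R * R)).
Implicit Types (U : R * R -> R * R) (P : R * R -> R).

Definition fluid_domain V : set (R * R) := ~` closure V.

(* The unit tangent and normal require [frontier V] to be a C^1 Jordan curve.
   The circulation and the condition n.U = 0 do not depend on the regular
   counterclockwise parametrization, so they are asked of every one of them.
   The values of [U] and [P] outside [closure (fluid_domain V)] are junk. *)
Record hollow_vortex gamma Omega kappa V U P : Prop := HollowVortex {
  core_open : open V;
  core_connected : connected V;
  core_bounded : bounded_set V;
  core_boundary : exists Z, ccw_boundary_param Z V;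
  velocity_continuous : {within closure (fluid_domain V), continuous U};
  pressure_continuous : {within closure (fluid_domain V), continuous P};
  velocity_C1 : C1_on (fluid_domain V) U;
  pressure_C1 : C1_on (fluid_domain V) P;
  momentum : forall xi, fluid_domain V xi ->
    advection U xi + (2 * Omega) *: perp (U xi)
      - ((4 * kappa ^+ 2)^-1 + Omega ^+ 2) *: xi = - grad P xi;
  divergence_eq : forall xi, fluid_domain V xi -> divergence U xi = kappa^-1;
  curl_eq : forall xi, fluid_domain V xi -> curl U xi = - (2 * Omega);
  circulation : forall Z, ccw_boundary_param Z V ->
    arclength_integral Z (fun t => dotp (unit_tangent Z t) (U (Z t)))
      = gamma - 2 * Omega * fine (area V);
  impermeable : forall Z, ccw_boundary_param Z V ->
    forall t, dotp (unit_normal Z t) (U (Z t)) = 0;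
  pressure_constant : exists p, forall xi, frontier V xi -> P xi = p
}.

Definition mfold_symmetric (m : nat) V U :=
  rotation (2 * pi / m%:R) @` fluid_domain V = fluid_domain V /\
  forall xi, closure (fluid_domain V) xi ->
    U (rotation (2 * pi / m%:R) xi) = rotation (2 * pi / m%:R) (U xi).

Definition lab_velocity Omega kappa U xi : R * R :=
  U xi - (2 * kappa)^-1 *: xi + Omega *: perp xi.

Definition vanishes_at_infinity V U :=
  forall e : R, 0 < e -> exists M : R, forall xi,
    closure (fluid_domain V) xi -> M < enorm xi -> enorm (U xi) < e.

Definition disk_velocity gamma Omega kappa (xi : R * R) : R * R :=
  (gamma / (2 * pi) / enorm xi ^+ 2) *: perp xi
  - ((2 * kappa)^-1 / enorm xi ^+ 2) *: xi
  + (2 * kappa)^-1 *: xi - Omega *: perp xi.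

End HollowVortex.

(* Main.v *)
Require Import Defs.
From HB Require Import structures.
From mathcomp Require Import all_boot all_order all_algebra.
From mathcomp Require Import all_classical all_reals all_analysis.
From mathcomp Require Import measurable_realfun complex ring lra.
Import Order.TTheory GRing.Theory Num.Theory.
Import numFieldNormedType.Exports.
Import Normc.
Set Implicit Arguments.
Unset Strict Implicit.
Unset Printing Implicit Defensive.
Local Open Scope classical_set_scope.
Local Open Scope complex_scope.
Local Open Scope ring_scope.
Local Notation Re := complex.Re.
Local Notation Im := complex.Im.

(** Write a point of the plane as z = x + i y, let u be the velocity in the lab
    frame, f = u1 - i u2 and lambda = 1 / (2 kappa) + i Omega.  The divergence
    and curl equations say that f is holomorphic in the fluid, and the
    conjugate relative velocity is W = U1 - i U2 = f + lambda conj(z).  On the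
    boundary curve Z put s = |Z|^2 - 1 and w = Im (Z' / Z) > 0, the angular
    speed.  Impermeability says that Q = W Z' is real; constancy of the
    pressure and Bernoulli's law say that |W|^2 = B + |lambda|^2 s for a
    constant B.  So Q^2 = (B + |lambda|^2 s) |Z'|^2.

    The function G = z f + lambda is holomorphic, has a limit l at infinity and
    equals Z W - lambda s on the curve.  The integrals of G and G^2 against
    dz / z can therefore be computed at infinity or on the curve.  The area
    condition is that s w has mean zero; with it, real and imaginary parts of
    the two identities give ([G_limit], [second_moment])
      l = i mu with mu = - (mean of Q),  B = mu^2,
      (integral of s Q) = - Omega (integral of s^2 w).
    If mu = 0, Bernoulli forces s >= 0, and mean zero forces s = 0.
    Otherwise let p = - Q / (mu |Z'|) and Y = mu^2 / |lambda|^2, so that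
    s = Y (p^2 - 1).  Since |Z'|^2 >= (1 + s) w^2, a combination of the
    identities writes 0 as the integral of a function that is at least
    c (p - 1)^2 w for some c > 0, as soon as p >= 0 ([rigid_step]).  The
    positivity of c is arithmetic when Y is small; when Y is not small it comes
    from p being close to 1 and from
      |lambda - i mu|^2 / |lambda|^2 >= (Re lambda)^2 / |lambda|^2 > 0,
    which is where the finiteness of kappa is used.  Hence p = 1 and s = 0.

    The sign of p has two sources.  If Y is not small, Q never vanishes and has
    the sign of its mean ([sign_large]).  If Y is small, G1 = G - lambda Y
    satisfies Re (G1^2) <= 0 on the curve and Re (G1^2) < 0 at infinity; by the
    maximum principle Re (G1^2) < 0 in the fluid, so Im G1 never vanishes there
    and transports the sign of mu from infinity to the curve ([sign_small]).

    Once s = 0 and p = 1, z f is constant on the curve, which is the unit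
    circle, and Cauchy's formula gives f = (i mu - lambda) / z outside it
    ([f_pole]).  The circulation condition is mu = Omega - gamma / (2 pi).

    A curve C^1-close to the unit circle is star-shaped, so the fluid is swept
    by the scaled curves r Z with r > 1 ([fluidP]).  Contour integrals are only
    ever taken along such scaled curves: they do not depend on r because their
    derivative in r is the integral of an exact derivative
    ([contour_scaling]).  Cauchy's formula, the expansion at infinity, the
    maximum principle and the area formula are derived from this family. *)

(** * Integrals over a period *)

Lemma continuous_at_pair (T U V : topologicalType) (f : T -> U) (g : T -> V) (x : T) :
  {for x, continuous f} -> {for x, continuous g} ->
  {for x, continuous (fun y => (f y, g y))}.
Proof. by move=> cf cg; apply: (@cvg_pair _ _ _ _ (nbhs (f x)) (nbhs (g x))). Qed.

Section CircleIntegral.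
Context {R : realType}.
Implicit Types (k F : R -> R).
Local Notation mu := (@lebesgue_measure R).

Definition oint k : R := \int[mu]_(t in [set` `[0, 2 * pi]]) k t.

Lemma pi2_gt0 : 0 < 2 * pi :> R.
Proof. by rewrite mulr_gt0 ?pi_gt0. Qed.

Lemma oint_integrable k : continuous k ->
  mu.-integrable [set` `[0, 2 * pi]] (EFin \o k).
Proof.
move=> ck; apply: continuous_compact_integrable; first exact: segment_compact.
exact: continuous_subspaceT.
Qed.

Lemma eq_oint k1 k2 : k1 =1 k2 -> oint k1 = oint k2.
Proof. by move=> e; rewrite (_ : k1 = k2)//; apply/funext. Qed.

Lemma ointD k1 k2 : continuous k1 -> continuous k2 ->
  oint (fun t => k1 t + k2 t) = oint k1 + oint k2.
Proof. by move=> c1 c2; rewrite /oint RintegralD//; exact: oint_integrable. Qed.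

Lemma ointB k1 k2 : continuous k1 -> continuous k2 ->
  oint (fun t => k1 t - k2 t) = oint k1 - oint k2.
Proof. by move=> c1 c2; rewrite /oint RintegralB//; exact: oint_integrable. Qed.

Lemma ointZ c k : continuous k -> oint (fun t => c * k t) = c * oint k.
Proof. by move=> ck; rewrite /oint RintegralZl//; exact: oint_integrable. Qed.

Lemma oint_cst c : oint (fun=> c) = 2 * pi * c.
Proof.
have e : mu [set` `[0, 2 * pi]] = (2 * pi : R)%:E.
  by rewrite lebesgue_measure_itv/= lte_fin pi2_gt0 -EFinB subr0.
by rewrite /oint Rintegral_cst// [X in fine X]e /= mulrC.
Qed.

Lemma le_oint k1 k2 : continuous k1 -> continuous k2 ->
  (forall t, 0 <= t <= 2 * pi -> k1 t <= k2 t) -> oint k1 <= oint k2.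
Proof.
by move=> c1 c2 le12; apply: le_Rintegral => //; exact: oint_integrable.
Qed.

Lemma oint_norm_le M k : continuous k -> (forall t, 0 <= t <= 2 * pi -> `|k t| <= M) ->
  `|oint k| <= 2 * pi * M.
Proof.
move=> ck kM; apply: le_trans (le_normr_Rintegral _ _) _ => //.
  exact: oint_integrable.
rewrite -oint_cst; apply: le_oint => //; last exact: cst_continuous.
by move=> t; apply: continuous_comp; [exact: ck|exact: norm_continuous].
Qed.

(** An antiderivative near the period suffices: one built as an integral from a
    base point exists on a half-line only. *)
Lemma oint_deriv_loc F k : continuous k ->
  (forall t : R, 0 <= t <= 2 * pi -> is_derive t 1 F (k t)) ->
  oint k = F (2 * pi) - F 0.
Proof.
move=> ck dF.
have p0 := ltW pi2_gt0.
have cF t : 0 <= t <= 2 * pi -> {for t, continuous F}.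
  move=> /dF[d _]; exact/differentiable_continuous/derivable1_diffP.
have := @continuous_FTC2 R k F 0 (2 * pi) pi2_gt0.
rewrite /oint /Rintegral => ->//.
- exact: continuous_subspaceT.
- split.
  + move=> t; rewrite in_itv/= => /andP[t0 t1].
    by have [] : is_derive t 1 F (k t) by apply: dF; rewrite !ltW.
  + by apply: cvg_at_right_filter; apply: cF; rewrite lexx.
  + by apply: cvg_at_left_filter; apply: cF; rewrite lexx p0.
- move=> t; rewrite in_itv/= => /andP[t0 t1]; rewrite derive1E.
  by have [] : is_derive t 1 F (k t) by apply: dF; rewrite !ltW.
Qed.

Lemma oint_deriv F k : continuous k -> (forall t : R, is_derive t 1 F (k t)) ->
  oint k = F (2 * pi) - F 0.
Proof. by move=> ck dF; apply: oint_deriv_loc. Qed.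

Lemma oint_eq0 k : continuous k -> (forall t, 0 <= k t) -> oint k = 0 ->
  forall t, 0 <= t <= 2 * pi -> k t = 0.
Proof.
move=> ck k0 ik.
pose F (x : R) := \int[mu]_(t in [set` `[0, x]]) k t.
have dF (x : R) : 0 < x < 2 * pi -> derivable F x 1 /\ derive1 F x = k x.
  move=> /andP[x0 x2].
  apply: (@continuous_FTC1_closed R k 0 x (2 * pi)) => //; last exact: ck.
  exact: oint_integrable.
have F0 x : 0 <= x <= 2 * pi -> F x = 0.
  move=> /andP[x0 x2]; apply/eqP; rewrite eq_le; apply/andP; split; last first.
    by apply: Rintegral_ge0 => t _; exact: k0.
  rewrite -ik /oint; rewrite /F /Rintegral fine_le//.
  - apply: integrable_fin_num => //; apply: integrableS (oint_integrable ck) => //.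
    by apply: subset_itvl; rewrite bnd_simp.
  - by apply: integrable_fin_num => //; exact: oint_integrable.
  - apply: ge0_subset_integral => //=.
    + by apply/measurable_EFinP; apply: measurable_funTS; exact: continuous_measurable_fun.
    + by move=> t _; rewrite lee_fin.
    + by apply: subset_itvl; rewrite bnd_simp.
have k0' x : 0 < x < 2 * pi -> k x = 0.
  move=> x0; have [_ <-] := dF x x0.
  have : \forall z \near x, F z = cst 0 z.
    have: x \in `]0, 2 * pi[ by rewrite in_itv.
    move=> /near_in_itvoo; apply: filterS => z; rewrite in_itv/= => /andP[a b].
    by apply: F0; rewrite !ltW.
  by move=> /(@near_eq_derive _ _ _ F (cst 0) x 1); rewrite derive1E => ->; rewrite derive_cst.
move=> t /andP[]; rewrite le_eqVlt => /predU1P[<- _|t0].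
  have c0 : k x @[x --> 0^'+] --> k 0 by apply: cvg_at_right_filter; exact: ck.
  apply: (cvg_unique _ c0) => //; apply: cvg_near_cst.
  near=> z; apply: k0'; apply/andP; split; near: z; first exact: nbhs_right_gt.
  by apply: nbhs_right_lt; exact: pi2_gt0.
rewrite le_eqVlt => /predU1P[->|t1]; last by rewrite k0'// t0.
have c0 : k x @[x --> (2 * pi)^'-] --> k (2 * pi).
  by apply: cvg_at_left_filter; exact: ck.
apply: (cvg_unique _ c0) => //; apply: cvg_near_cst.
near=> z; apply: k0'; apply/andP; split; near: z; last exact: nbhs_left_lt.
by apply: nbhs_left_gt; exact: pi2_gt0.
Unshelve. all: by end_near. Qed.

Section Param.
Variables (k k' : R -> R -> R) (lo hi : R).
Hypothesis ck : forall sg t : R, lo < sg < hi ->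
  {for (sg, t), continuous (fun p : R * R => k p.1 p.2)}.

Lemma slice_cont sg : lo < sg < hi -> continuous (k sg).
Proof.
move=> sI t.
apply: (@continuous_comp _ _ _ (fun t => (sg, t)) (fun p : R * R => k p.1 p.2)).
  by apply: continuous_at_pair; [exact: cvg_cst|exact: cvg_id].
exact: ck.
Qed.

(** A local bound uniform in the angle, by compactness of a rectangle: the
    dominating constant for the two lemmas on parameter integrals. *)
Lemma rect_bound sg : lo < sg < hi -> exists2 r, 0 < r &
  (lo < sg - r /\ sg + r < hi) /\
  exists M : R, forall sg' t : R, sg - r <= sg' <= sg + r -> 0 <= t <= 2 * pi ->
    `|k sg' t| <= M.
Proof.
move=> /andP[l h].
pose r := Num.min (sg - lo) (hi - sg) / 2.
have r0 : 0 < r by rewrite divr_gt0// lt_min !subr_gt0 l h.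
have r1 : r < sg - lo.
  have : Num.min (sg - lo) (hi - sg) <= sg - lo by rewrite ge_min lexx.
  by rewrite /r; move: r0; rewrite /r; lra.
have r2 : r < hi - sg.
  have : Num.min (sg - lo) (hi - sg) <= hi - sg by rewrite ge_min lexx orbT.
  by rewrite /r; move: r0; rewrite /r; lra.
exists r => //; split; first by split; lra.
pose A : set (R * R) := [set` `[sg - r, sg + r]] `*` [set` `[0, 2 * pi]].
have cA : compact A by apply: compact_setX; exact: segment_compact.
have A0 : A !=set0.
  exists (sg, 0); split; rewrite /= in_itv/= ?lexx ?(ltW pi2_gt0)//.
  by apply/andP; split; lra.
have [|c _ cM] := @compact_EVT_max _ R (fun p : R * R => `|k p.1 p.2|) A A0 cA.
  apply: continuous_in_subspaceT => -[s t] /set_mem[/=].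
  rewrite in_itv/= => /andP[s1 s2] _.
  apply: continuous_comp; last exact: norm_continuous.
  by apply: ck; apply/andP; split; lra.
exists `|k c.1 c.2| => s t sI tI.
by apply: (cM (s, t)); rewrite inE; split; rewrite /= in_itv.
Qed.

Lemma oint_continuous_param sg : lo < sg < hi ->
  {for sg, continuous (fun s => oint (k s))}.
Proof.
move=> sI; have [r r0 [[l h] [M HM]]] := rect_bound sI.
have := @continuity_under_integral R _ _ mu k [set` `[0, 2 * pi]] _ (sg - r) (sg + r).
have I s : [set` `]sg - r, sg + r[] s -> lo < s < hi.
  by rewrite /= in_itv/= => /andP[a b]; apply/andP; split; lra.
apply.
- by [].
- by move=> s /I sI'; apply: oint_integrable; exact: slice_cont.
- apply: aeW => t _ s /set_mem/I sI'.
  apply: (@continuous_comp _ _ _ (fun s => (s, t)) (fun p : R * R => k p.1 p.2)).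
    by apply: continuous_at_pair; [exact: cvg_id|exact: cvg_cst].
  exact: ck.
- exact: (@oint_integrable (cst M) (@cst_continuous _ _ M)).
- move=> s; rewrite /= in_itv/= => /andP[a b]; apply: aeW => t; rewrite /= in_itv/= => tI.
  by apply: HM => //; apply/andP; split; lra.
- by rewrite inE /= in_itv/=; apply/andP; split; lra.
Qed.
End Param.

Lemma oint_derive_param (k k' : R -> R -> R) (lo hi : R) :
  (forall sg t : R, lo < sg < hi -> {for (sg, t), continuous (fun p : R * R => k p.1 p.2)}) ->
  (forall sg t : R, lo < sg < hi -> {for (sg, t), continuous (fun p : R * R => k' p.1 p.2)}) ->
  (forall sg t : R, lo < sg < hi -> is_derive sg 1 (k ^~ t) (k' sg t)) ->
  forall sg : R, lo < sg < hi -> is_derive sg 1 (fun s => oint (k s)) (oint (k' sg)).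
Proof.
move=> ck ck' dk sg sI; have [r r0 [[l h] [M HM]]] := rect_bound ck' sI.
have I s : [set` `]sg - r, sg + r[] s -> lo < s < hi.
  by rewrite /= in_itv/= => /andP[a b]; apply/andP; split; lra.
have d1 s t : lo < s < hi -> partial1of2 k s t = k' s t.
  by move=> sI'; rewrite partial1of2E; have [_] := dk s t sI'.
have Isg : [set` `]sg - r, sg + r[] sg by rewrite /= in_itv/=; apply/andP; split; lra.
have intk s : [set` `]sg - r, sg + r[] s -> mu.-integrable [set` `[0, 2 * pi]] (EFin \o k s).
  by move=> /I sI'; apply: oint_integrable; exact: (slice_cont ck).
have derk s t : [set` `]sg - r, sg + r[] s -> [set` `[0, 2 * pi]] t -> derivable (k ^~ t) s 1.
  by move=> /I sI' _; have [] := dk s t sI'.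
have M0 : 0 <= `|M| by [].
have intM : mu.-integrable [set` `[0, 2 * pi]] (EFin \o (cst `|M|)).
  exact: (@oint_integrable (cst `|M|) (@cst_continuous _ _ `|M|)).
have bd s t : [set` `]sg - r, sg + r[] s -> [set` `[0, 2 * pi]] t ->
    `|partial1of2 k s t| <= (cst `|M|) t.
  move=> /[dup] /I sI' + tI; rewrite d1//= in_itv/= => /andP[a b].
  apply: le_trans (ler_norm M); apply: HM; last by move: tI; rewrite /= in_itv.
  by apply/andP; split; lra.
apply: DeriveDef.
  exact: (derivable_under_integral _ Isg intk derk (fun=> M0) intM bd).
rewrite -derive1E (differentiation_under_integral _ Isg intk derk (fun=> M0) intM bd)//.
by apply: eq_Rintegral => t _; rewrite d1.
Qed.

End CircleIntegral.

(** * Complex differentiability in the plane *)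

Section ComplexCalculus.
Context {R : realType}.
Local Notation C := R[i].
Implicit Types (z w : C).

Definition toC (xi : R * R) : C := Complex xi.1 xi.2.
Definition ofC z : R * R := (Re z, Im z).

Lemma toCK : cancel toC ofC. Proof. by case. Qed.

Lemma ofCK : cancel ofC toC. Proof. by case. Qed.

Lemma ReM z w : Re (z * w) = Re z * Re w - Im z * Im w.
Proof. by case: z w => a b [c d]. Qed.

Lemma ImM z w : Im (z * w) = Re z * Im w + Im z * Re w.
Proof. by case: z w => a b [c d]. Qed.

Lemma ReD z w : Re (z + w) = Re z + Re w. Proof. by case: z w => a b []. Qed.

Lemma ImD z w : Im (z + w) = Im z + Im w. Proof. by case: z w => a b []. Qed.

Lemma ReN z : Re (- z) = - Re z. Proof. by case: z. Qed.

Lemma ImN z : Im (- z) = - Im z. Proof. by case: z. Qed.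

Lemma ReB z w : Re (z - w) = Re z - Re w. Proof. by rewrite ReD ReN. Qed.

Lemma ImB z w : Im (z - w) = Im z - Im w. Proof. by rewrite ImD ImN. Qed.

Definition ReImE := (ReM, ImM, ReB, ImB, ReD, ImD, ReN, ImN).

Lemma eqC z w : Re z = Re w -> Im z = Im w -> z = w.
Proof. by case: z w => a b [c d] /= -> ->. Qed.

Definition nsq z : R := Re z ^+ 2 + Im z ^+ 2.
Lemma nsq_gt0 z : z != 0 -> 0 < nsq z.
Proof.
case: z => a b /=; rewrite eq_complex /= negb_and /nsq /=.
by case/orP => h; [apply: ltr_wpDr|apply: ltr_wpDl]; rewrite ?sqr_ge0// exprn_even_gt0.
Qed.

Lemma ReV z : Re z^-1 = Re z / nsq z. Proof. by case: z. Qed.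

Lemma ImV z : Im z^-1 = - Im z / nsq z. Proof. by case: z => a b; rewrite mulNr. Qed.

Lemma ReConj z : Re z^* = Re z. Proof. by case: z. Qed.

Lemma ImConj z : Im z^* = - Im z. Proof. by case: z. Qed.

Lemma continuous_at_eq {T : topologicalType} (f g : T -> R) x :
  {for x, continuous f} -> f =1 g -> {for x, continuous g}.
Proof. by move=> h /funext <-. Qed.

(** Continuity is asked of the real and imaginary parts, so that the real-valued
    library applies to each of them. *)
Definition contC {T : topologicalType} (F : T -> C) (x : T) : Prop :=
  {for x, continuous (fun y => Re (F y))} /\ {for x, continuous (fun y => Im (F y))}.

Section Cont.
Context {T : topologicalType}.
Implicit Types (F G : T -> C) (x : T).
Lemma contC_cst z x : contC (fun _ : T => z) x.
Proof. by split; exact: cvg_cst. Qed.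

Lemma contCD F G x : contC F x -> contC G x -> contC (fun y => F y + G y) x.
Proof.
move=> [a b] [c d]; split.
  by apply: (@continuous_at_eq _ (fun y => Re (F y) + Re (G y))) => [|y]; [exact: cvgD|rewrite ReD].
by apply: (@continuous_at_eq _ (fun y => Im (F y) + Im (G y))) => [|y]; [exact: cvgD|rewrite ImD].
Qed.

Lemma contCN F x : contC F x -> contC (fun y => - F y) x.
Proof.
move=> [a b]; split.
  by apply: (@continuous_at_eq _ (fun y => - Re (F y))) => [|y]; [exact: cvgN|rewrite ReN].
by apply: (@continuous_at_eq _ (fun y => - Im (F y))) => [|y]; [exact: cvgN|rewrite ImN].
Qed.

Lemma contCB F G x : contC F x -> contC G x -> contC (fun y => F y - G y) x.
Proof. by move=> cF cG; apply: contCD => //; exact: contCN. Qed.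

Lemma contCM F G x : contC F x -> contC G x -> contC (fun y => F y * G y) x.
Proof.
move=> [a b] [c d]; split.
  apply: (@continuous_at_eq _ (fun y => Re (F y) * Re (G y) - Im (F y) * Im (G y))) => [|y]; last by rewrite ReM.
  by apply: cvgB; exact: cvgM.
apply: (@continuous_at_eq _ (fun y => Re (F y) * Im (G y) + Im (F y) * Re (G y))) => [|y]; last by rewrite ImM.
by apply: cvgD; exact: cvgM.
Qed.

Lemma contC_nsq F x : contC F x -> {for x, continuous (fun y => nsq (F y))}.
Proof.
move=> [a b].
apply: (@continuous_at_eq _ (fun y => Re (F y) * Re (F y) + Im (F y) * Im (F y))) => [|y] //.
by apply: cvgD; exact: cvgM.
Qed.

Lemma contCV F x : F x != 0 -> contC F x -> contC (fun y => (F y)^-1) x.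
Proof.
move=> F0 cF; have n0 := lt0r_neq0 (nsq_gt0 F0); have cn := contC_nsq cF.
case: cF => a b; split.
  apply: (@continuous_at_eq _ (fun y => Re (F y) / nsq (F y))) => [|y]; last by rewrite ReV.
  by apply: cvgM => //; exact: cvgV.
apply: (@continuous_at_eq _ (fun y => - Im (F y) / nsq (F y))) => [|y]; last by rewrite ImV.
by apply: cvgM; [exact: cvgN|exact: cvgV].
Qed.
End Cont.
Lemma contC_comp {T U : topologicalType} (c : T -> U) (F : U -> C) x :
  {for x, continuous c} -> contC F (c x) -> contC (fun y => F (c y)) x.
Proof. by move=> cc [a b]; split; [exact: (continuous_comp cc a)|exact: (continuous_comp cc b)]. Qed.

Definition derC (F : R -> C) (t : R) (d : C) : Prop :=
  is_derive t 1 (fun s => Re (F s)) (Re d) /\ is_derive t 1 (fun s => Im (F s)) (Im d).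

Lemma is_derive_eqf (f g : R -> R) (t d e : R) :
  is_derive t 1 f d -> f =1 g -> d = e -> is_derive t 1 g e.
Proof. by move=> h /funext <- <-. Qed.

Lemma derC_cst z t : derC (fun=> z) t 0.
Proof. by split; exact: is_derive_cst. Qed.

Lemma derCD F G t d e : derC F t d -> derC G t e -> derC (fun s => F s + G s) t (d + e).
Proof.
move=> [a b] [a' b']; split.
  by apply: (is_derive_eqf (is_deriveD a a')) => [s|] /=; rewrite ReD.
by apply: (is_derive_eqf (is_deriveD b b')) => [s|] /=; rewrite ImD.
Qed.

Lemma derCM F G t d e : derC F t d -> derC G t e ->
  derC (fun s => F s * G s) t (d * G t + F t * e).
Proof.
move=> [a b] [a' b']; split.
  apply: (is_derive_eqf (is_deriveB (is_deriveM a a') (is_deriveM b b'))) => [s|] /=.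
    by rewrite ReM.
  by rewrite !ReImE /GRing.scale /=; ring.
apply: (is_derive_eqf (is_deriveD (is_deriveM a b') (is_deriveM b a'))) => [s|] /=.
  by rewrite ImM.
by rewrite !ReImE /GRing.scale /=; ring.
Qed.

Lemma derC_cont F t d : derC F t d -> contC F t.
Proof.
move=> [[a _] [b _]].
by split; [move/derivable1_diffP in a|move/derivable1_diffP in b];
  exact: differentiable_continuous.
Qed.

(** Complex differentiability as a real differential that is multiplication by a
    complex number; the plane R * R, with its norm and topology, remains the
    domain. *)
Definition cdiff (F F' : R * R -> C) (xi : R * R) : Prop :=
  is_diff xi (fun p => Re (F p)) (fun h => Re (F' xi * toC h)) /\
  is_diff xi (fun p => Im (F p)) (fun h => Im (F' xi * toC h)).

Lemma is_diff_eqf (f g df dg : R * R -> R) xi : is_diff xi f df -> f =1 g -> df =1 dg -> is_diff xi g dg.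
Proof. by move=> h /funext <- /funext <-. Qed.

Lemma cdiff_cst z xi : cdiff (fun=> z) (fun=> 0) xi.
Proof.
by split; apply: (is_diff_eqf (is_diff_cst _ _)) => h; rewrite ?mul0r.
Qed.

Lemma is_diff_fst (xi : R * R) : is_diff xi (fst : R * R -> R) fst.
Proof.
have c : continuous (fst : R * R -> R) by move=> x; exact: cvg_fst.
by apply: DiffDef; [exact: linear_differentiable|rewrite diff_lin].
Qed.

Lemma is_diff_snd (xi : R * R) : is_diff xi (snd : R * R -> R) snd.
Proof.
have c : continuous (snd : R * R -> R) by move=> x; exact: cvg_snd.
by apply: DiffDef; [exact: linear_differentiable|rewrite diff_lin].
Qed.

Lemma cdiff_id xi : cdiff toC (fun=> 1) xi.
Proof.
split.
  by apply: (is_diff_eqf (is_diff_fst xi)) => h; rewrite ?mul1r.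
by apply: (is_diff_eqf (is_diff_snd xi)) => h; rewrite ?mul1r.
Qed.

Lemma cdiffD F G F' G' xi : cdiff F F' xi -> cdiff G G' xi ->
  cdiff (fun p => F p + G p) (fun p => F' p + G' p) xi.
Proof.
move=> [a b] [a' b']; split.
  by apply: (is_diff_eqf (is_diffD a a')) => h /=; rewrite ?mulrDl ReD.
by apply: (is_diff_eqf (is_diffD b b')) => h /=; rewrite ?mulrDl ImD.
Qed.

Lemma cdiffM F G F' G' xi : cdiff F F' xi -> cdiff G G' xi ->
  cdiff (fun p => F p * G p) (fun p => F' p * G p + F p * G' p) xi.
Proof.
move=> [a b] [a' b']; split.
  apply: (is_diff_eqf (is_diffB (is_diffM a a') (is_diffM b b'))) => h; rewrite !fctE /=.
    by rewrite ReM.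
  by rewrite !ReImE /GRing.scale /=; ring.
apply: (is_diff_eqf (is_diffD (is_diffM a b') (is_diffM b a'))) => h; rewrite !fctE /=.
  by rewrite ImM.
by rewrite !ReImE /GRing.scale /=; ring.
Qed.

Lemma is_diff_of_derive (g : R -> R) (y d : R) : is_derive y 1 g d -> is_diff y g (fun h => h * d).
Proof.
move=> [/derivable1_diffP dg gd]; apply: DiffDef => //.
by rewrite diff1E// derive1E gd.
Qed.

Lemma is_derive_of_diff (g dg : R -> R) (y : R) : is_diff y g dg -> is_derive y 1 g (dg 1).
Proof.
by move=> dd; apply: DeriveDef; [apply/derivable1_diffP|rewrite deriveE// diff_val].
Qed.

Lemma is_diff_der_comp (f df : R * R -> R) (g : R -> R) xi d :
  is_diff xi f df -> is_derive (f xi) 1 g d -> is_diff xi (fun p => g (f p)) (fun h => df h * d).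
Proof.
move=> a /is_diff_of_derive b.
exact: (is_diff_eqf (is_diff_comp a b)).
Qed.

Lemma cdiffV F F' xi : F xi != 0 -> cdiff F F' xi ->
  cdiff (fun p => (F p)^-1) (fun p => - F' p / (F p) ^+ 2) xi.
Proof.
move=> F0 [a b].
have n0 := lt0r_neq0 (nsq_gt0 F0).
have dn := is_diffD (is_diffM a a) (is_diffM b b).
have dV : is_derive (nsq (F xi)) 1 (fun x : R => x^-1) (- (nsq (F xi)) ^- 2).
  by apply: (is_derive_eqf (@is_deriveV _ id _ _ _ n0 (is_derive_id _ _))) => //=; rewrite /GRing.scale /= mulr1.
have dn' : is_diff xi (fun p => (nsq (F p))^-1) _ := is_diff_der_comp dn dV.
have e : (F xi) ^+ 2 != 0 by rewrite expf_neq0.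
have n2 : nsq (F xi ^+ 2) = nsq (F xi) ^+ 2 by rewrite /nsq expr2 !ReImE; ring.
split.
  apply: (is_diff_eqf (is_diffM a dn')) => h; rewrite !fctE /= ?ReV //.
  rewrite !ReImE ReV ImV n2 expr2 !ReImE /GRing.scale /=.
  by move: n0; rewrite /nsq => n0; field.
apply: (is_diff_eqf (is_diffN (is_diffM b dn'))) => h; rewrite !fctE /=.
  by rewrite ImV mulNr.
rewrite !ReImE ReV ImV n2 expr2 !ReImE /GRing.scale /=.
by move: n0; rewrite /nsq => n0; field.
Qed.

Lemma cdiff_chain F F' (c : R -> R * R) t d :
  cdiff F F' (c t) -> derC (fun s => toC (c s)) t d -> derC (fun s => F (c s)) t (F' (c t) * d).
Proof.
move=> [a b] [/is_diff_of_derive c1 /is_diff_of_derive c2].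
have cc : is_diff t c (fun h => (h * Re d, h * Im d)).
  have := is_diff_pair c1 c2.
  by rewrite (_ : (fun y => (Re (toC (c y)), Im (toC (c y)))) = c)//; apply/funext => y; case: (c y).
split.
  by have := is_derive_of_diff (is_diff_comp cc a); rewrite /= !mul1r /toC/=; case: d {c1 c2 cc}.
by have := is_derive_of_diff (is_diff_comp cc b); rewrite /= !mul1r /toC/=; case: d {c1 c2 cc}.
Qed.

Lemma cdiff_cont F F' xi : cdiff F F' xi -> contC F xi.
Proof. by move=> [[a _] [b _]]; split; exact: differentiable_continuous. Qed.

Definition cint (F : R -> C) : C := Complex (oint (fun t => Re (F t))) (oint (fun t => Im (F t))).

End ComplexCalculus.

(** * Contour integrals along scaled curves *)

Section Contour.
Context {R : realType}.
Local Notation C := R[i].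
Implicit Types (F G Z : R -> C).

Lemma normc_le (z : C) (M : R) : `|Re z| <= M -> `|Im z| <= M -> Normc.normc z <= 2 * M.
Proof.
case: z => a b /= aM bM; have M0 : 0 <= M by apply: le_trans aM.
rewrite -(@ler_pXn2r _ 2)// ?nnegrE ?sqrtr_ge0 ?mulr_ge0// sqr_sqrtr ?addr_ge0 ?sqr_ge0//.
have a2 : a ^+ 2 <= M ^+ 2 by rewrite -(@real_normK _ a) ?num_real// lerXn2r ?nnegrE.
have b2 : b ^+ 2 <= M ^+ 2 by rewrite -(@real_normK _ b) ?num_real// lerXn2r ?nnegrE.
by nra.
Qed.

Lemma normc_Re (z : C) : `|Re z| <= Normc.normc z.
Proof.
case: z => a b /=; rewrite -sqrtr_sqr ler_wsqrtr// lerDl sqr_ge0//.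
Qed.

Lemma normc_Im (z : C) : `|Im z| <= Normc.normc z.
Proof.
case: z => a b /=; rewrite -sqrtr_sqr ler_wsqrtr// lerDr sqr_ge0//.
Qed.

Lemma normc_ge0 (z : C) : 0 <= Normc.normc z.
Proof. by apply: le_trans (normc_Re z). Qed.

Lemma normc_real (r : R) : Normc.normc (r%:C : C) = `|r|.
Proof. by rewrite /= expr0n addr0 sqrtr_sqr. Qed.

Lemma normc_sq (z : C) : Normc.normc z ^+ 2 = nsq z.
Proof. by case: z => a b /=; rewrite sqr_sqrtr// addr_ge0 ?sqr_ge0. Qed.

Lemma normcD (z w : C) : Normc.normc (z + w) <= Normc.normc z + Normc.normc w.
Proof. exact: le_normcD. Qed.

Lemma normcBC (z w : C) : Normc.normc (z - w) = Normc.normc (w - z).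
Proof. by rewrite -opprB normcN. Qed.

Lemma normc_rev (z w : C) : Normc.normc z - Normc.normc w <= Normc.normc (z - w).
Proof. by rewrite lerBlDr; have := normcD (z - w) w; rewrite subrK. Qed.

Definition ccont F := forall t, contC F t.

Lemma ccont_Re F : ccont F -> continuous (fun t => Re (F t)).
Proof. by move=> h t; have [] := h t. Qed.

Lemma ccont_Im F : ccont F -> continuous (fun t => Im (F t)).
Proof. by move=> h t; have [] := h t. Qed.

Lemma eq_cint F G : F =1 G -> cint F = cint G.
Proof. by move=> /funext ->. Qed.

Lemma cintD F G : ccont F -> ccont G -> cint (fun t => F t + G t) = cint F + cint G.
Proof.
move=> cF cG; apply: eqC => /=; rewrite ?ReD ?ImD /= -ointD; try exact: ccont_Re; try exact: ccont_Im.
  by apply: eq_oint => t; rewrite ReD.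
by apply: eq_oint => t; rewrite ImD.
Qed.

Lemma cintZ (z : C) F : ccont F -> cint (fun t => z * F t) = z * cint F.
Proof.
move=> cF; have c1 := ccont_Re cF; have c2 := ccont_Im cF.
have c1' (r : R) : continuous (fun t => r * Re (F t)) by move=> t; apply: cvgM; [exact: cvg_cst|exact: c1].
have c2' (r : R) : continuous (fun t => r * Im (F t)) by move=> t; apply: cvgM; [exact: cvg_cst|exact: c2].
apply: eqC => /=; rewrite ?ReM ?ImM /= -!ointZ//.
  by rewrite -ointB//; apply: eq_oint => t; rewrite ReM.
by rewrite -ointD//; apply: eq_oint => t; rewrite ImM.
Qed.

Lemma cintB F G : ccont F -> ccont G -> cint (fun t => F t - G t) = cint F - cint G.
Proof.
move=> cF cG; rewrite -mulN1r -(cintZ _ cG) -(cintD cF); last first.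
  by move=> t; apply: contCM; [exact: contC_cst|exact: cG].
by apply: eq_cint => t; rewrite mulN1r.
Qed.

Lemma cint_norm_le (M : R) F : ccont F ->
  (forall t, 0 <= t <= 2 * pi -> Normc.normc (F t) <= M) ->
  Normc.normc (cint F) <= 2 * (2 * pi * M).
Proof.
move=> cF FM; apply: normc_le; apply: oint_norm_le; try exact: ccont_Re; try exact: ccont_Im.
  by move=> t tI; apply: le_trans (normc_Re _) _; exact: FM.
by move=> t tI; apply: le_trans (normc_Im _) _; exact: FM.
Qed.

Lemma cint_deriv F k : ccont k -> (forall t, derC F t (k t)) -> cint k = F (2 * pi) - F 0.
Proof.
move=> ck dF; apply: eqC => /=; rewrite ?ReB ?ImB.
  by apply: (@oint_deriv _ (fun t => Re (F t))); [exact: ccont_Re|move=> t; have [] := dF t].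
by apply: (@oint_deriv _ (fun t => Im (F t))); [exact: ccont_Im|move=> t; have [] := dF t].
Qed.

Lemma derive0_const (g : R -> R) (lo hi : R) :
  (forall s : R, lo < s < hi -> is_derive s 1 g 0) ->
  forall x y, lo < x < hi -> lo < y < hi -> g x = g y.
Proof.
move=> dg; suff H x y : lo < x < hi -> lo < y < hi -> x <= y -> g x = g y.
  by move=> x y xI yI; case: (leP x y) => [|/ltW] h; [exact: H|apply/esym; exact: H].
move=> /andP[x1 x2] /andP[y1 y2] xy.
have d s : s \in `]x, y[%R -> is_derive s 1 g ((fun=> 0 : R) s).
  by rewrite in_itv/= => /andP[a b]; apply: dg; apply/andP; split; lra.
have [|c _] := MVT_segment xy d.
  apply: derivable_within_continuous => s; rewrite in_itv/= => /andP[a b].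
  by have [] : is_derive s 1 g 0 by apply: dg; apply/andP; split; lra.
by rewrite mul0r => /eqP; rewrite subr_eq0 => /eqP.
Qed.

(** The curve Z scaled by sg about the centre a.  With a = 0 these curves sweep
    the fluid; with Z the unit circle they are the circles about a. *)
Definition pt (a : C) Z (sg t : R) : R * R := ofC (a + sg%:C * Z t).

Lemma toC_pt a Z sg t : toC (pt a Z sg t) = a + sg%:C * Z t.
Proof. exact: ofCK. Qed.

Lemma contC_ofC {T : topologicalType} (F : T -> C) x : contC F x ->
  {for x, continuous (fun y => ofC (F y))}.
Proof. by move=> [a b]; apply: continuous_at_pair. Qed.

Lemma contC_real {T : topologicalType} (g : T -> R) (x : T) :
  {for x, continuous g} -> contC (fun y => (g y)%:C : C) x.
Proof. by move=> cg; split => //; exact: cvg_cst. Qed.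

Lemma cont_fst (p : R * R) : {for p, continuous (fst : R * R -> R)}.
Proof. exact: cvg_fst. Qed.

Lemma cont_snd (p : R * R) : {for p, continuous (snd : R * R -> R)}.
Proof. exact: cvg_snd. Qed.

Lemma contC_pt a Z (p : R * R) : ccont Z ->
  {for p, continuous (fun p : R * R => pt a Z p.1 p.2)}.
Proof.
move=> cZ; apply: contC_ofC; apply: contCD; first exact: contC_cst.
apply: contCM; first by apply: contC_real; exact: cvg_fst.
by apply: contC_comp; [exact: cvg_snd|exact: cZ].
Qed.

Section Homotopy.
Variables (Z Z' : R -> C).
Hypothesis dZ : forall t, derC Z t (Z' t).
Hypothesis cZ' : ccont Z'.
Hypothesis Z0 : forall t, Z t != 0.
Hypothesis Zper : Z (2 * pi) = Z 0.

Let cZ : ccont Z. Proof. by move=> t; apply: derC_cont (dZ t). Qed.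

Let cL : ccont (fun t => Z' t / Z t).
Proof. by move=> t; apply: contCM; [exact: cZ'|exact: contCV]. Qed.

Lemma derC_pt_sg a sg t : derC (fun s => toC (pt a Z s t)) sg (Z t).
Proof.
have -> : (fun s => toC (pt a Z s t)) = (fun s => a + s%:C * Z t).
  by apply/funext => s; rewrite toC_pt.
have d1 : derC (fun s : R => s%:C : C) sg 1 by split; [exact: is_derive_id|exact: is_derive_cst].
have := derCD (derC_cst a sg) (derCM d1 (derC_cst (Z t) sg)).
by rewrite mulr0 addr0 add0r mul1r.
Qed.

Lemma derC_pt_t a sg t : derC (fun s => toC (pt a Z sg s)) t (sg%:C * Z' t).
Proof.
have -> : (fun s => toC (pt a Z sg s)) = (fun s => a + sg%:C * Z s).
  by apply/funext => s; rewrite toC_pt.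
have := derCD (derC_cst a t) (derCM (derC_cst sg%:C t) (dZ t)).
by rewrite mul0r !add0r.
Qed.

(** The derivative in the scale of the integral of F dZ / Z is the integral of
    F' Z' = (d/dt) F(a + sg Z) / sg, which vanishes by periodicity.  This is the
    only form of Cauchy's theorem in the file. *)
Lemma contour_scaling (D : set (R * R)) (F F' : R * R -> C) a (lo hi : R) : 0 <= lo ->
  (forall sg t, lo < sg < hi -> D (pt a Z sg t)) ->
  (forall xi, D xi -> cdiff F F' xi /\ contC F' xi) ->
  forall s1 s2, lo < s1 < hi -> lo < s2 < hi ->
  cint (fun t => F (pt a Z s1 t) * (Z' t / Z t)) = cint (fun t => F (pt a Z s2 t) * (Z' t / Z t)).
Proof.
move=> lo0 inD hF s1 s2 I1 I2.
pose k sg t := F (pt a Z sg t) * (Z' t / Z t).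
pose k' sg t := F' (pt a Z sg t) * Z t * (Z' t / Z t).
have snd_c (G : R -> C) (p : R * R) : ccont G -> contC (fun p : R * R => G p.2) p.
  by move=> cG; apply: (@contC_comp _ _ _ snd G); [exact: cont_snd|exact: cG].
have ck (sg t : R) : lo < sg < hi -> contC (fun p : R * R => k p.1 p.2) (sg, t).
  move=> I; apply: contCM; last exact: (snd_c _ _ cL).
  apply: (@contC_comp _ _ _ (fun p => pt a Z p.1 p.2) F); first exact: contC_pt.
  by apply: (@cdiff_cont _ _ F'); have [] := hF _ (inD sg t I).
have ck' (sg t : R) : lo < sg < hi -> contC (fun p : R * R => k' p.1 p.2) (sg, t).
  move=> I; apply: contCM; last exact: (snd_c _ _ cL).
  apply: contCM; last exact: (snd_c _ _ cZ).
  apply: (@contC_comp _ _ _ (fun p => pt a Z p.1 p.2) F'); first exact: contC_pt.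
  by have [] := hF _ (inD sg t I).
have dk (sg t : R) : lo < sg < hi -> derC (k ^~ t) sg (k' sg t).
  move=> I; have [dF _] := hF _ (inD sg t I).
  have := derCM (@cdiff_chain _ F F' (fun s => pt a Z s t) sg _ dF (derC_pt_sg a sg t)) (derC_cst (Z' t / Z t) sg).
  by rewrite mulr0 addr0.
have slice (h : R -> R -> C) sg : (forall t, contC (fun p : R * R => h p.1 p.2) (sg, t)) -> ccont (h sg).
  move=> ch t; apply: (@contC_comp _ _ _ (fun t => (sg, t)) (fun p : R * R => h p.1 p.2)) => //.
  by apply: continuous_at_pair; [exact: cvg_cst|exact: cvg_id].
have int0 sg : lo < sg < hi -> cint (k' sg) = 0.
  move=> I; have sg0 : sg%:C != 0 :> C.
    by rewrite eq_complex /= negb_and gt_eqF//; case/andP: I => + _; apply: le_lt_trans.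
  have ck's : ccont (k' sg) by apply: slice => t; exact: ck'.
  apply: (mulfI sg0); rewrite mulr0 -cintZ//.
  rewrite (@cint_deriv (fun t => F (pt a Z sg t))).
  - by rewrite /pt Zper subrr.
  - by move=> t; apply: contCM; [exact: contC_cst|exact: ck's].
  - move=> t; have [dF _] := hF _ (inD sg t I).
    have := @cdiff_chain _ F F' (fun s => pt a Z sg s) t _ dF (derC_pt_t a sg t).
    by rewrite /k'; congr (derC _ _ _); have := Z0 t => ?; field.
have J sg : lo < sg < hi -> derC (fun s => cint (k s)) sg 0.
  move=> I; rewrite -(int0 sg I); split.
    apply: (@oint_derive_param _ (fun s t => Re (k s t)) (fun s t => Re (k' s t)) lo hi) => //.
    + by move=> s t Is; have [] := ck s t Is.
    + by move=> s t Is; have [] := ck' s t Is.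
    + by move=> s t Is; have [] := dk s t Is.
  apply: (@oint_derive_param _ (fun s t => Im (k s t)) (fun s t => Im (k' s t)) lo hi) => //.
  + by move=> s t Is; have [] := ck s t Is.
  + by move=> s t Is; have [] := ck' s t Is.
  + by move=> s t Is; have [] := dk s t Is.
apply: eqC.
  by apply: (@derive0_const (fun s => Re (cint (k s))) lo hi) => // s /J[].
by apply: (@derive0_const (fun s => Im (cint (k s))) lo hi) => // s /J[].
Qed.

End Homotopy.
End Contour.

(** * Limits at infinity and on the boundary *)

Section Local.
Context {R : realType}.
Local Notation C := R[i].

Lemma normc_le_small (z : C) (c : R) : 0 <= c -> (forall e, 0 < e -> normc z <= e * c) -> z = 0.
Proof.
move=> c0 h; apply: eq0_normc; apply/eqP; rewrite eq_le normc_ge0 andbT leNgt; apply/negP => z0.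
have c1 : 0 < c + 1 by lra.
have := h (normc z / (2 * (c + 1))); rewrite divr_gt0 ?mulr_gt0// => /(_ isT).
rewrite mulrAC ler_pdivlMr ?mulr_gt0//.
by nra.
Qed.

Lemma contC_normc {T : topologicalType} (F : T -> C) (x : T) :
  (forall e, 0 < e -> \forall y \near x, normc (F y - F x) <= e) -> contC F x.
Proof.
move=> h; split; apply/cvgrPdist_le => e e0; near=> y.
  rewrite distrC -ReB; apply: le_trans (normc_Re _) _.
  by near: y; exact: h.
rewrite distrC -ImB; apply: le_trans (normc_Im _) _.
by near: y; exact: h.
Unshelve. all: by end_near. Qed.

Lemma contC_near {T : topologicalType} (F G : T -> C) (x : T) :
  (\forall y \near x, F y = G y) -> contC G x -> contC F x.
Proof.
move=> FG [a b]; have e := nbhs_singleton FG.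
have ea : Re (F x) = Re (G x) by rewrite e.
have eb : Im (F x) = Im (G x) by rewrite e.
split.
  suff : Re (F y) @[y --> x] --> Re (G x) by rewrite -ea.
  apply: cvg_trans a; apply: near_eq_cvg.
  by apply: filterS FG => y ->.
suff : Im (F y) @[y --> x] --> Im (G x) by rewrite -eb.
apply: cvg_trans b; apply: near_eq_cvg.
by apply: filterS FG => y ->.
Qed.

Lemma right_const (g : R -> R) (x r c : R) : 0 < r -> {for x, continuous g} ->
  (forall y, x < y < x + r -> g y = c) -> g x = c.
Proof.
move=> r0 cg h; have c0 : g y @[y --> x^'+] --> g x by apply: cvg_at_right_filter.
apply: (cvg_unique _ c0) => //; apply: cvg_near_cst.
near=> y; apply: h; apply/andP; split; near: y; first exact: nbhs_right_gt.
by apply: nbhs_right_lt; rewrite ltrDl.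
Unshelve. all: by end_near. Qed.

Lemma left_const (g : R -> R) (x r c : R) : 0 < r -> {for x, continuous g} ->
  (forall y, x - r < y < x -> g y = c) -> g x = c.
Proof.
move=> r0 cg h; have c0 : g y @[y --> x^'-] --> g x by apply: cvg_at_left_filter.
apply: (cvg_unique _ c0) => //; apply: cvg_near_cst.
near=> y; apply: h; apply/andP; split; near: y; last exact: nbhs_left_lt.
by apply: nbhs_left_gt; rewrite gtrBl.
Unshelve. all: by end_near. Qed.

Lemma maxnorm_le (w : R * R) : `|w| <= normc (toC w).
Proof.
case: w => a b; rewrite prod_normE /= ge_max.
by rewrite (normc_Re (Complex a b)) (normc_Im (Complex a b)).
Qed.

Lemma diff_expand (f df : R * R -> R) xi : is_diff xi f df -> forall e : R, 0 < e ->
  \forall w \near xi, `|f w - f xi - df (w - xi)| <= e * `|w - xi|.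
Proof.
move=> fd e e0; have dfx : differentiable f xi by [].
have /diff_locallyP[_ /eqaddoP/(_ e e0)] := dfx; rewrite diff_val => h.
rewrite (near_shift 0 xi) /= subr0; apply: filterS h => w /=.
rewrite !fctE /= addrK => h; apply: le_trans h.
by rewrite opprD addrA.
Qed.
End Local.
(** What the exterior theory uses of the curve: it is C^1, closed and of size
    comparable to 1, and each ray from the origin meets it in one point,
    expressed by [gc_inj]: the scaled curves are disjoint. *)
Record gauge_curve {R : realType} (Z Z' : R -> R[i]) : Prop := GaugeCurve {
  gc_deriv : forall t, derC Z t (Z' t);
  gc_cont : ccont Z';
  gc_per : Z (2 * pi) = Z 0;
  gc_red : forall t, exists2 t', 0 <= t' <= 2 * pi & Z t' = Z t;
  gc_lo : forall t, 1 / 2 <= normc (Z t);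
  gc_hi : forall t, normc (Z t) <= 2;
  gc_dhi : forall t, normc (Z' t) <= 2;
  gc_inj : forall s s' t t' : R, 0 < s -> 0 < s' -> s%:C * Z t = s'%:C * Z t' -> s = s'
}.

Section Exterior.
Context {R : realType}.
Local Notation C := R[i].
Variables (Z Z' : R -> C).
Hypothesis gc : gauge_curve Z Z'.
Let dZ := gc_deriv gc.
Let cZ' := gc_cont gc.
Let Zper := gc_per gc.
Let Zlo := gc_lo gc.
Let Z'hi := gc_dhi gc.

Local Notation L t := (Z' t / Z t).
Local Notation p := (pt 0 Z).

Lemma Z_neq0 t : Z t != 0.
Proof. by apply/eqP => e; have := Zlo t; rewrite e normc0; lra. Qed.

Lemma Z_ccont : ccont Z. Proof. by move=> t; apply: derC_cont (dZ t). Qed.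

Lemma L_ccont : ccont (fun t => L t).
Proof. by move=> t; apply: contCM; [exact: cZ'|apply: contCV; [exact: Z_neq0|exact: Z_ccont]]. Qed.

Lemma L_le t : normc (L t) <= 4.
Proof.
rewrite normcM normcV ler_pdivrMr; last by have := Zlo t; lra.
by have := Zlo t; have := Z'hi t; lra.
Qed.

Lemma toC_p s t : toC (p s t) = s%:C * Z t.
Proof. by rewrite toC_pt add0r. Qed.

Lemma normc_p (s t : R) : 0 <= s -> normc (toC (p s t)) = s * normc (Z t).
Proof. by move=> s0; rewrite toC_p normcM normc_real ger0_norm. Qed.

(** The integral of dZ / Z, which is 2 pi i for a curve close to the circle
    ([windingE]). *)
Definition winding := cint (fun t => L t).

(** Limit at infinity along the scaled curves, uniform in the angle. *)
Definition ulim (F : R * R -> C) (l : C) := forall e : R, 0 < e ->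
  exists S : R, forall s t, S < s -> normc (F (p s t) - l) <= e.

Lemma ulim_cst l : ulim (fun=> l) l.
Proof. by move=> e e0; exists 0 => s t _; rewrite subrr normc0 ltW. Qed.

Lemma ulimD F G l m : ulim F l -> ulim G m -> ulim (fun w => F w + G w) (l + m).
Proof.
move=> hF hG e e0; have [|S1 h1] := hF (e / 2); first by rewrite divr_gt0.
have [|S2 h2] := hG (e / 2); first by rewrite divr_gt0.
exists (Num.max S1 S2) => s t; rewrite gt_max => /andP[a b].
rewrite opprD addrACA; apply: le_trans (normcD _ _) _.
by have := h1 s t a; have := h2 s t b; lra.
Qed.

Lemma ulimM F G l m : ulim F l -> ulim G m -> ulim (fun w => F w * G w) (l * m).
Proof.
move=> hF hG e e0.
pose A := normc l + normc m + 1.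
have nl := normc_ge0 l; have nm := normc_ge0 m.
have A0 : 0 < A by rewrite /A; lra.
pose d := Num.min 1 (e / A).
have d0 : 0 < d by rewrite lt_min ltr01 divr_gt0.
have d1 : d <= 1 by rewrite ge_min lexx.
have dA : d * A <= e by rewrite -ler_pdivlMr// ge_min lexx orbT.
have [S1 h1] := hF d d0; have [S2 h2] := hG d d0.
exists (Num.max S1 S2) => s t; rewrite gt_max => /andP[a b].
have -> : F (p s t) * G (p s t) - l * m =
   (F (p s t) - l) * (G (p s t) - m) + (F (p s t) - l) * m + l * (G (p s t) - m) by ring.
have {}h1 := h1 s t a; have {}h2 := h2 s t b.
apply: le_trans (normcD _ _) _; rewrite normcM.
have := normcD ((F (p s t) - l) * (G (p s t) - m)) ((F (p s t) - l) * m); rewrite !normcM.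
move: (normc_ge0 (F (p s t) - l)) (normc_ge0 (G (p s t) - m)).
move: (normc (F (p s t) - l)) (normc (G (p s t) - m)) h1 h2 => x y xd yd x0 y0 h.
have : x * y <= d by nra.
have : x * normc m <= d * normc m by nra.
have : normc l * y <= normc l * d by nra.
by move: dA; rewrite /A; lra.
Qed.

Lemma ulim_inv (z : C) : ulim (fun w => (toC w - z)^-1) 0.
Proof.
move=> e e0; exists (2 * (normc z + e^-1)) => s t h.
have e1 : 0 < e^-1 by rewrite invr_gt0.
have nz := normc_ge0 z.
have s0 : 0 <= s by lra.
have h1 : normc z + e^-1 < normc (toC (p s t)).
  by rewrite normc_p//; have := Zlo t; nra.
have h2 : e^-1 < normc (toC (p s t) - z) by have := normc_rev (toC (p s t)) z; lra.
rewrite subr0 normcV -[leRHS]invrK lef_pV2 ?posrE ?invr_gt0//; first exact: ltW.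
by apply: lt_trans h2; rewrite invr_gt0.
Qed.

Lemma ulim_quot (z : C) : ulim (fun w => toC w / (toC w - z)) 1.
Proof.
have h := ulimD (ulim_cst 1) (ulimM (ulim_cst z) (ulim_inv z)).
move=> e e0; have [S hS] := h e e0; exists (Num.max S (2 * (normc z + 1))) => s t.
rewrite gt_max => /andP[a b]; have := hS s t a.
have s0 : 0 <= s by have := normc_ge0 z; lra.
have n0 : toC (p s t) - z != 0.
  rewrite subr_eq0; apply/eqP => /(congr1 (@normc R)); rewrite normc_p// => h1.
  by have := Zlo t; have := normc_ge0 z; nra.
have -> : toC (p s t) / (toC (p s t) - z) - 1 = 1 + z * (toC (p s t) - z)^-1 - (1 + z * 0) by field.
by [].
Qed.

Lemma ccont_F F s : (forall t, contC F (p s t)) -> ccont (fun t => F (p s t)).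
Proof.
move=> cF t; apply: (@contC_comp _ _ _ (fun t => p s t) F) => //.
apply: contC_ofC; apply: contCD; first exact: contC_cst.
by apply: contCM; [exact: contC_cst|exact: Z_ccont].
Qed.

Lemma ccont_FL (G : R -> C) : ccont G -> ccont (fun t => G t * L t).
Proof. by move=> cG t; apply: contCM => //; exact: L_ccont. Qed.

Definition holo (D : set (R * R)) (F F' : R * R -> C) :=
  forall xi, D xi -> cdiff F F' xi /\ contC F' xi.

Lemma holo_contC D F F' xi : holo D F F' -> D xi -> contC F xi.
Proof. by move=> h /h[/cdiff_cont]. Qed.

Lemma scaled_contour_eq D F F' lo hi s1 s2 : 0 <= lo -> holo D F F' ->
  (forall s t, lo < s < hi -> D (p s t)) -> lo < s1 < hi -> lo < s2 < hi ->
  cint (fun t => F (p s1 t) * L t) = cint (fun t => F (p s2 t) * L t).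
Proof. move=> l0 hF inD; exact: (contour_scaling dZ cZ' Z_neq0 Zper l0 inD hF). Qed.

(** Send the scale to infinity, where the integrand tends uniformly to l times
    the logarithmic derivative of Z. *)
Lemma contour_infty D F F' lo l : 0 <= lo -> holo D F F' ->
  (forall s t, lo < s -> D (p s t)) -> ulim F l ->
  forall s, lo < s -> cint (fun t => F (p s t) * L t) = l * winding.
Proof.
move=> l0 hF inD ul s ls.
apply/eqP; rewrite -subr_eq0; apply/eqP.
apply: (@normc_le_small _ _ (16 * pi)); first by rewrite mulr_ge0// pi_ge0.
move=> e e0; have [S hS] := ul e e0.
pose s' := Num.max S s + 1.
have S1 : S < s' by rewrite /s' ltr_pwDr// le_max lexx.
have S2 : s < s' by rewrite /s' ltr_pwDr// le_max lexx orbT.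
have I1 : lo < s < s' + 1 by apply/andP; split; lra.
have I2 : lo < s' < s' + 1 by apply/andP; split; lra.
have inD' r t : lo < r < s' + 1 -> D (p r t) by move=> /andP[? _]; exact: inD.
rewrite (scaled_contour_eq l0 hF inD' I1 I2).
have cF : ccont (fun t => F (p s' t)).
  by apply: ccont_F => t; apply: (holo_contC hF); apply: inD; lra.
rewrite /winding -cintZ; last exact: L_ccont.
rewrite -cintB; [|exact: ccont_FL|by apply: ccont_FL => t; exact: contC_cst].
apply: le_trans (@cint_norm_le _ (e * 4) _ _ _) _.
- move=> t; apply: contCB; first exact: (ccont_FL cF).
  by apply: ccont_FL => ?; exact: contC_cst.
- move=> t _; rewrite -mulrBl normcM; apply: ler_pM; rewrite ?normc_ge0//; last exact: L_le.
  exact: hS.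
by rewrite le_eqVlt; apply/orP; left; apply/eqP; ring.
Qed.

Lemma cint_cont (k : R -> R -> C) lo hi s :
  (forall s t : R, lo < s < hi -> contC (fun q : R * R => k q.1 q.2) (s, t)) ->
  lo < s < hi -> contC (fun s => cint (k s)) s.
Proof.
move=> ck I; split.
  by apply: (@oint_continuous_param _ (fun s t => Re (k s t)) lo hi) => // s' t /(ck s' t)[].
by apply: (@oint_continuous_param _ (fun s t => Im (k s t)) lo hi) => // s' t /(ck s' t)[].
Qed.

Lemma contC_Lsnd (q : R * R) : contC (fun q : R * R => L q.2) q.
Proof. by apply: (@contC_comp _ _ _ (snd : R * R -> R) (fun t => L t)); [exact: cont_snd|exact: L_ccont]. Qed.

(** The integral depends continuously on the scale down to 1 and is constant for
    larger scales.  Cutting the scale off at 1 makes continuity up to the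
    boundary an ordinary two-variable continuity. *)
Lemma contour_bdry D F F' hi : 1 < hi -> holo D F F' ->
  (forall s t, 1 < s < hi -> D (p s t)) ->
  (forall s t : R, s < hi -> contC (fun q : R * R => F (p (Num.max 1 q.1) q.2)) (s, t)) ->
  forall s, 1 < s < hi -> cint (fun t => F (p s t) * L t) = cint (fun t => F (p 1 t) * L t).
Proof.
move=> hi1 hF inD cF s I.
pose k (s t : R) := F (p (Num.max 1 s) t) * L t.
have ck (s' t : R) : 0 < s' < hi -> contC (fun q : R * R => k q.1 q.2) (s', t).
  by move=> /andP[_ sh]; apply: contCM; [exact: cF|exact: contC_Lsnd].
have I1 : 0 < (1:R) < hi by rewrite ltr01.
have [c1 c2] := cint_cont ck I1.
have k1 : cint (k 1) = cint (fun t => F (p 1 t) * L t) by apply: eq_cint => t; rewrite /k maxxx.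
have kc y : 1 < y < hi -> cint (k y) = cint (fun t => F (p s t) * L t).
  move=> Iy; rewrite (@scaled_contour_eq D F F' 1 hi s y)//.
  by apply: eq_cint => t; rewrite /k max_r//; case/andP: Iy => /ltW.
have h0 : 0 < hi - 1 by rewrite subr_gt0.
rewrite -k1; apply: eqC; apply/esym.
  by apply: (right_const h0 c1) => y Iy; rewrite kc//; move: Iy; rewrite addrCA subrr addr0.
by apply: (right_const h0 c2) => y Iy; rewrite kc//; move: Iy; rewrite addrCA subrr addr0.
Qed.
End Exterior.

(** * Cauchy's formula outside a curve *)

Section Cauchy.
Context {R : realType}.
Local Notation C := R[i].
Variables (Z Z' : R -> C).
Hypothesis gc : gauge_curve Z Z'.
Local Notation L t := (Z' t / Z t).
Local Notation p := (pt 0 Z).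
Local Notation winding := (winding Z Z').

Lemma toC_inj (x y : R * R) : toC x = toC y -> x = y.
Proof. by move=> /(congr1 (@ofC R)); rewrite !toCK. Qed.

Lemma neq_near (w z : R * R) : w != z -> \forall y \near w, y != z.
Proof.
move=> wz; have n0 : 0 < `|w - z| by rewrite normr_gt0 subr_eq0.
near=> y; apply/eqP => yz.
have : `|w - y| < `|w - z| by near: y; apply: cvgr_dist_lt.
by rewrite yz ltxx.
Unshelve. all: by end_near. Qed.

Lemma p_neq (s0 t0 s t : R) : 0 < s0 -> 0 < s -> s != s0 -> p s t != p s0 t0.
Proof.
move=> s00 s1 ns; apply/eqP => /(congr1 (@toC R)); rewrite !toC_p => /(gc_inj gc s1 s00) e.
by rewrite e eqxx in ns.
Qed.

Lemma holoM (D : set (R * R)) (F F' G G' : R * R -> C) : holo D F F' -> holo D G G' ->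
  holo D (fun w => F w * G w) (fun w => F' w * G w + F w * G' w).
Proof.
move=> hF hG xi Dxi; have [a b] := hF xi Dxi; have [a' b'] := hG xi Dxi.
split; first exact: cdiffM.
by apply: contCD; apply: contCM => //; [exact: cdiff_cont a'|exact: cdiff_cont a].
Qed.

Lemma holoD (D : set (R * R)) (F F' G G' : R * R -> C) : holo D F F' -> holo D G G' ->
  holo D (fun w => F w + G w) (fun w => F' w + G' w).
Proof.
move=> hF hG xi Dxi; have [a b] := hF xi Dxi; have [a' b'] := hG xi Dxi.
by split; [exact: cdiffD|exact: contCD].
Qed.

Lemma holo_cst (D : set (R * R)) (z : C) : holo D (fun=> z) (fun=> 0).
Proof. by move=> xi _; split; [exact: cdiff_cst|exact: contC_cst]. Qed.

Lemma holo_id (D : set (R * R)) : holo D (@toC R) (fun=> 1).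
Proof. by move=> xi _; split; [exact: cdiff_id|exact: contC_cst]. Qed.

Lemma holoS (D D' : set (R * R)) (F F' : R * R -> C) : D' `<=` D -> holo D F F' -> holo D' F F'.
Proof. by move=> s h xi /s; exact: h. Qed.

Lemma holoV (D : set (R * R)) (F F' : R * R -> C) : holo D F F' -> (forall w, D w -> F w != 0) ->
  holo D (fun w => (F w)^-1) (fun w => - F' w / F w ^+ 2).
Proof.
move=> hF F0 xi Dxi; have [a b] := hF xi Dxi; have n0 := F0 xi Dxi.
split; first exact: cdiffV.
have c := cdiff_cont a.
apply: contCM; first exact: contCN.
apply: contCV; first by rewrite expf_neq0.
by under [fun y => _]eq_fun do rewrite expr2; exact: contCM.
Qed.

Lemma holo_kernel (z : R * R) : exists F', holo [set w | w != z] (fun w => toC w / (toC w - toC z)) F'.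
Proof.
eexists; apply: holoM; first exact: holo_id.
apply: holoV; first by apply: holoD; [exact: holo_id|exact: holo_cst].
by move=> w /=; rewrite subr_eq0; apply: contra => /eqP /toC_inj ->.
Qed.

(** For a pole outside the contour, shrink the contour to the origin, where w /
    (w - z) tends to 0. *)
Lemma kernel_in (s0 t0 s : R) : 0 < s < s0 ->
  cint (fun t => toC (p s t) / (toC (p s t) - toC (p s0 t0)) * L t) = 0.
Proof.
move=> I; have [F' hF] := holo_kernel (p s0 t0).
have s00 : 0 < s0 by case/andP: I; exact: lt_trans.
apply: (@normc_le_small _ _ (16 * pi * 2 * 8 / s0)); first by rewrite divr_ge0 ?mulr_ge0 ?pi_ge0// ltW.
move=> e e0.
(* at scale s' the kernel is of size s' / s0 *)
pose s' := Num.min (s0 / 8) e.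
have s'0 : 0 < s' by rewrite lt_min e0 andbT divr_gt0.
have s'1 : s' <= s0 / 8 by rewrite ge_min lexx.
have s'2 : s' <= e by rewrite ge_min lexx orbT.
have I' : 0 < s' < s0 by rewrite s'0 /=; lra.
have inD r t : 0 < r < s0 -> [set w | w != p s0 t0] (p r t).
  by move=> /andP[r0 rs] /=; apply: p_neq => //; rewrite lt_eqF.
rewrite (scaled_contour_eq gc (lexx 0) hF inD I I').
have cF : ccont (fun t => toC (p s' t) / (toC (p s' t) - toC (p s0 t0))).
  apply: (@ccont_F _ _ _ gc (fun w => toC w / (toC w - toC (p s0 t0)))) => t.
  by apply: (holo_contC hF); exact: inD.
apply: le_trans (@cint_norm_le _ (8 * s' / s0 * 4) _ _ _) _.
- exact: (ccont_FL gc cF).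
- move=> t _; rewrite normcM; apply: ler_pM; rewrite ?normc_ge0//; last exact: (L_le gc).
  rewrite normcM normcV.
  have n1 : normc (toC (p s' t)) <= 2 * s'.
    by rewrite (normc_p Z t (ltW s'0)); have := gc_hi gc t; nra.
  have n2 : s0 / 4 <= normc (toC (p s' t) - toC (p s0 t0)).
    rewrite normcBC; apply: le_trans (normc_rev _ _).
    have := gc_lo gc t0; rewrite (normc_p Z t0 (ltW s00)) => h0.
    have h : s0 * (1 / 2) <= s0 * normc (Z t0) by apply: ler_wpM2l => //; exact: ltW.
    by move: n1 h; lra.
  have n3 : 0 < normc (toC (p s' t) - toC (p s0 t0)) by apply: lt_le_trans n2; rewrite divr_gt0.
  rewrite ler_pdivrMr//; apply: le_trans n1 _.
  have -> : 8 * s' / s0 * normc (toC (p s' t) - toC (p s0 t0)) = 8 * s' * (normc (toC (p s' t) - toC (p s0 t0)) / s0) by ring.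
  have : 1 / 4 <= normc (toC (p s' t) - toC (p s0 t0)) / s0 by rewrite ler_pdivlMr//; lra.
  by nra.
have -> : 2 * (2 * pi * (8 * s' / s0 * 4)) = (2 * 2 * pi * 8 * 4 / s0) * s' :> R by ring.
have -> : e * (16 * pi * 2 * 8 / s0) = (2 * 2 * pi * 8 * 4 / s0 * 2) * e :> R by ring.
have A0 : 0 <= 2 * 2 * pi * 8 * 4 / s0 :> R by rewrite divr_ge0 ?mulr_ge0 ?pi_ge0// ltW.
by nra.
Qed.

(** The difference quotient at z extends continuously; this removable
    singularity lets contours pass through z. *)
Lemma cdiff_quot (F F' : R * R -> C) (z : R * R) : cdiff F F' z ->
  contC (fun w => if w == z then F' z else (F w - F z) / (toC w - toC z)) z.
Proof.
move=> [/diff_expand a /diff_expand b]; apply: contC_normc => e e0; rewrite eqxx.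
have e2 : 0 < e / 2 by rewrite divr_gt0.
near=> w; case: eqVneq => [_|wz]; first by rewrite subrr normc0 ltW.
have n0 : toC w - toC z != 0 by rewrite subr_eq0; apply: contra wz => /eqP /toC_inj ->.
have n1 : 0 < normc (toC w - toC z).
  by rewrite lt_neqAle normc_ge0 andbT eq_sym; apply: contra n0 => /eqP /eq0_normc ->.
have -> : (F w - F z) / (toC w - toC z) - F' z = (F w - F z - F' z * (toC w - toC z)) / (toC w - toC z) by field.
rewrite normcM normcV ler_pdivrMr//.
have wE : toC (w - z) = toC w - toC z by case: (w) (z) => ? ? [? ?].
have wn : `|w - z| <= normc (toC w - toC z) by rewrite -wE; exact: maxnorm_le.
apply: le_trans (@normc_le _ _ (e / 2 * normc (toC w - toC z)) _ _) _.
- rewrite !ReB -wE; apply: (@le_trans _ _ (e / 2 * `|w - z|)); last by rewrite ler_pM2l// wE.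
  by near: w; exact: a.
- rewrite !ImB -wE; apply: (@le_trans _ _ (e / 2 * `|w - z|)); last by rewrite ler_pM2l// wE.
  by near: w; exact: b.
by rewrite mulrA mulrCA divff// mulr1.
Unshelve. all: by end_near. Qed.

Section Formula.
Variables (D : set (R * R)) (f f' : R * R -> C).
Hypothesis hf : holo D f f'.
Hypothesis inD : forall s t, 1 < s -> D (p s t).
Hypothesis f_infty : ulim Z f 0.
Hypothesis cf : forall q : R * R, contC (fun q : R * R => f (p (Num.max 1 q.1) q.2)) q.

(** The integral of (f - f(z)) w / (w - z) along the scaled curves is locally
    constant on both sides of the curve through z and continuous across it.  Far
    out it tends to - f(z) times the winding integral; inside, the constant term
    drops out by [kernel_in]. *)
Lemma cauchy_sg (s0 t0 s : R) : 1 < s < s0 ->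
  f (p s0 t0) * winding = - cint (fun t => f (p s t) * (toC (p s t) / (toC (p s t) - toC (p s0 t0))) * L t).
Proof.
move=> I; set z := p s0 t0.
have s00 : 1 < s0 by case/andP: I; exact: lt_trans.
have s01 : 0 < s0 by lra.
have [F' hk] := holo_kernel z.
pose g w := (f w - f z) * (toC w / (toC w - toC z)).
have [g' hg] : exists g', holo (D `&` [set w | w != z]) g g'.
  eexists; rewrite /g; apply: holoM; last by apply: holoS hk => w [].
  apply: holoD; last exact: holo_cst.
  by apply: holoS hf => w [].
(* [g] extended continuously across z *)
pose ph w := (if w == z then f' z else (f w - f z) / (toC w - toC z)) * toC w.
have phg w : w != z -> ph w = g w by move=> wz; rewrite /ph (negbTE wz) /g; ring.
have cph w : D w -> contC ph w.
  move=> Dw; have [->|wz] := eqVneq w z.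
    apply: contCM; last exact: cdiff_cont (cdiff_id _).
    by apply: cdiff_quot; have [] := hf (inD t0 s00).
  apply: (@contC_near _ _ _ g); last by apply: (holo_contC hg).
  by apply: filterS (neq_near wz) => y /= yz; rewrite phg.
pose k s t := ph (p s t) * L t.
have ck (r t : R) : 1 < r < s0 + 1 -> contC (fun q : R * R => k q.1 q.2) (r, t).
  move=> /andP[r1 _]; apply: contCM; last exact: (contC_Lsnd gc).
  apply: (@contC_comp _ _ _ (fun q => p q.1 q.2) ph); last by apply: cph; exact: inD.
  by apply: contC_pt; exact: (Z_ccont gc).
have [c1 c2] : contC (fun s => cint (k s)) s0.
  by apply: (cint_cont (lo := 1) (hi := s0 + 1) ck); rewrite s00 /= ltrDl.
have kg r : 1 < r -> r != s0 -> cint (k r) = cint (fun t => g (p r t) * L t).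
  move=> r1 rs; apply: eq_cint => t; rewrite /k phg//; apply: p_neq => //.
  by apply: lt_trans r1.
have inl r t : 1 < r < s0 -> (D `&` [set w | w != z]) (p r t).
  move=> /andP[r1 rs]; split; first exact: inD.
  by apply: p_neq; rewrite ?lt_eqF//; lra.
have inr r t : s0 < r -> (D `&` [set w | w != z]) (p r t).
  move=> rs; split; first by apply: inD; lra.
  by apply: p_neq; rewrite ?gt_eqF//; lra.
have Jl r : 1 < r < s0 -> cint (k r) = cint (fun t => g (p s t) * L t).
  move=> Ir; rewrite kg; [|by case/andP: Ir|by case/andP: Ir => _ /lt_eqF ->].
  exact: (scaled_contour_eq gc ler01 hg inl Ir I).
have Jr r : s0 < r -> cint (k r) = - f z * winding.
  move=> rs; rewrite kg; [|by lra|by rewrite gt_eqF].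
  have ug := ulimM (ulimD f_infty (ulim_cst Z (- f z))) (ulim_quot gc (toC z)).
  by rewrite (contour_infty gc (ltW s01) hg inr ug rs) add0r mulr1.
have h1 : 0 < s0 - 1 by rewrite subr_gt0.
have Js : cint (k s0) = cint (fun t => g (p s t) * L t).
  apply: eqC.
    by apply: (left_const h1 c1) => y Iy; rewrite Jl//; move: Iy; rewrite subKr.
  by apply: (left_const h1 c2) => y Iy; rewrite Jl//; move: Iy; rewrite subKr.
have Js' : cint (k s0) = - f z * winding.
  apply: eqC.
    by apply: (right_const ltr01 c1) => y /andP[ys _]; rewrite Jr.
  by apply: (right_const ltr01 c2) => y /andP[ys _]; rewrite Jr.
have cq : ccont (fun t => toC (p s t) / (toC (p s t) - toC z)).
  apply: (@ccont_F _ _ _ gc (fun w => toC w / (toC w - toC z))) => t.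
  by apply: (holo_contC hk); have [] := inl s t I.
have cfs : ccont (fun t => f (p s t)).
  by apply: (@ccont_F _ _ _ gc f) => t; apply: (holo_contC hf); have [] := inl s t I.
have e : cint (fun t => g (p s t) * L t) =
   cint (fun t => f (p s t) * (toC (p s t) / (toC (p s t) - toC z)) * L t).
  transitivity (cint (fun t => f (p s t) * (toC (p s t) / (toC (p s t) - toC z)) * L t
     - f z * (toC (p s t) / (toC (p s t) - toC z) * L t))).
    by apply: eq_cint => t; rewrite /g; ring.
  have cqL := ccont_FL gc cq.
  rewrite cintB.
  - by rewrite cintZ// kernel_in ?mulr0 ?subr0//; case/andP: I => *; apply/andP; split => //; lra.
  - by apply: (ccont_FL gc) => t; apply: contCM.
  - by move=> t; apply: contCM => //; exact: contC_cst.
by rewrite -e -Js Js'; ring.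
Qed.

Lemma cauchy_bdry (s0 t0 : R) : 1 < s0 ->
  f (p s0 t0) * winding = - cint (fun t => f (p 1 t) * (Z t / (Z t - toC (p s0 t0))) * L t).
Proof.
move=> s01; set z := p s0 t0.
have [F' hk] := holo_kernel z.
pose s := (1 + s0) / 2.
have I : 1 < s < s0 by rewrite /s; apply/andP; split; lra.
rewrite (cauchy_sg _ I); congr (- _).
have [G' hF] : exists G', holo (D `&` [set w | w != z]) (fun w => f w * (toC w / (toC w - toC z))) G'.
  by eexists; apply: holoM; [apply: holoS hf => w []|apply: holoS hk => w []].
have inl r t : 1 < r < s0 -> (D `&` [set w | w != z]) (p r t).
  move=> /andP[r1 rs]; split; first exact: inD.
  by apply: p_neq; rewrite ?lt_eqF//; lra.
rewrite (contour_bdry gc s01 hF inl _ I).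
  by apply: eq_cint => t; rewrite toC_p mul1r.
move=> r t rs; apply: contCM; first exact: cf.
pose P (q : R * R) := p (Num.max 1 q.1) q.2.
have cP : {for (r, t), continuous P}.
  apply: contC_ofC; apply: contCD; first exact: contC_cst.
  apply: contCM.
    apply: contC_real; apply: continuous_max; first exact: cvg_cst.
    exact: cont_fst.
  by apply: (@contC_comp _ _ _ (snd : R * R -> R) Z); [exact: cont_snd|exact: (Z_ccont gc)].
apply: (@contC_comp _ _ _ P (fun w => toC w / (toC w - toC z))) => //.
apply: (holo_contC hk) => /=; apply: p_neq; rewrite /=.
- by lra.
- by rewrite lt_max ltr01.
- by rewrite lt_eqF// gt_max s01 rs.
Qed.
End Formula.
End Cauchy.

(** * Polar coordinates and the expansion at infinity *)

Section Polar.
Context {R : realType}.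
Local Notation C := R[i].
Definition cisC (t : R) : C := Complex (cos t) (sin t).
Definition dcisC (t : R) : C := Complex (- sin t) (cos t).

Lemma derC_cis t : derC cisC t (dcisC t).
Proof. by split => /=; [exact: is_derive_cos|exact: is_derive_sin]. Qed.

Lemma dcisCE t : dcisC t = 'i * cisC t.
Proof. by apply: eqC => /=; ring. Qed.

Lemma contC_dcis : ccont dcisC.
Proof.
by move=> t; split => /=; [apply: cvgN; exact: continuous_sin|exact: continuous_cos].
Qed.

Lemma normc_cis t : normc (cisC t) = 1.
Proof. by rewrite /= cos2Dsin2 sqrtr1. Qed.

Lemma cis_neq0 t : cisC t != 0.
Proof. by apply/eqP => /(congr1 (@normc R)); rewrite normc_cis normc0 => /eqP; rewrite oner_eq0. Qed.

Lemma cis_per t : cisC (t + 2 * pi) = cisC t.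
Proof. by rewrite /cisC mulrC mulr_natr cosD2pi sinD2pi. Qed.

Lemma polar (z : C) : exists2 t, 0 <= t <= 2 * pi & z = (normc z)%:C * cisC t.
Proof.
have [->|z0] := eqVneq z 0.
  by exists 0; rewrite ?lexx ?(ltW (@pi2_gt0 R))// normc0 mul0r.
have n0 : 0 < normc z.
  by rewrite lt_neqAle normc_ge0 andbT eq_sym; apply: contra z0 => /eqP /eq0_normc ->.
case: z n0 {z0} => a b; set r := normc _ => r0.
have rE : r ^+ 2 = a ^+ 2 + b ^+ 2 by rewrite /r normc_sq.
have ra : -1 <= a / r <= 1.
  by rewrite -ler_norml normrM normfV (gtr0_norm r0) ler_pdivrMr// mul1r; exact: (normc_Re (Complex a b)).
have ca : cos (acos (a / r)) = a / r by apply: acosK; rewrite in_itv.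
have sa : sin (acos (a / r)) = `|b| / r.
  rewrite sin_acos//; have -> : 1 - (a / r) ^+ 2 = (b / r) ^+ 2.
    by rewrite !expr_div_n rE; field; rewrite -rE expf_neq0 ?gt_eqF.
  by rewrite sqrtr_sqr normrM normfV (gtr0_norm r0).
have [a0 api] : 0 <= acos (a / r) /\ acos (a / r) <= pi by split; [exact: acos_ge0|exact: acos_lepi].
have rn : r != 0 by rewrite gt_eqF.
have [b0|b0] := leP 0 b.
  exists (acos (a / r)); first by apply/andP; split => //; have := @pi_gt0 R; lra.
  by apply: eqC; rewrite !ReImE /= ca sa (ger0_norm b0); field.
exists (2 * pi - acos (a / r)); first by have ? := @pi_gt0 R; apply/andP; split; lra.
have e : cisC (2 * pi - acos (a / r)) = cisC (- acos (a / r)) by rewrite addrC cis_per.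
by apply: eqC; rewrite !ReImE e /= cosN sinN ca sa (ltr0_norm b0); field.
Qed.
End Polar.

Section Exterior2.
Context {R : realType}.
Local Notation C := R[i].
Variables (Z Z' : R -> C).
Hypothesis gc : gauge_curve Z Z'.
Local Notation L t := (Z' t / Z t).
Local Notation p := (pt 0 Z).
Local Notation winding := (winding Z Z').

Lemma ccont_bound (F : R -> C) : ccont F -> exists2 M : R, 0 <= M & forall t, 0 <= t <= 2 * pi -> normc (F t) <= M.
Proof.
move=> cF.
have c1 : {within `[0, 2 * pi], continuous (fun t => normc (F t))}.
  apply: continuous_subspaceT => t.
  have [a b] := cF t.
  have := contC_nsq (cF t) => h.
  apply: (@continuous_at_eq _ _ (fun t => Num.sqrt (nsq (F t)))).
    by apply: continuous_comp h _; exact: sqrt_continuous.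
  by move=> s; case: (F s).
have [c _ h] := EVT_max (ltW (@pi2_gt0 R)) c1.
exists (normc (F c)); first exact: normc_ge0.
by move=> t tI; apply: h; rewrite in_itv.
Qed.

Section Asym.
Variables (D : set (R * R)) (f f' : R * R -> C).
Hypothesis hf : holo D f f'.
Hypothesis inD : forall s t, 1 < s -> D (p s t).
Hypothesis f_infty : ulim Z f 0.
Hypothesis cf : forall q : R * R, contC (fun q : R * R => f (p (Num.max 1 q.1) q.2)) q.
Hypothesis winding0 : winding != 0.

Lemma ccont_f1 : ccont (fun t => f (p 1 t)).
Proof.
move=> t; have := @contC_comp _ _ _ (fun t : R => ((1:R), t)) _ t _ (cf (1, t)).
rewrite /= maxxx; apply; by apply: continuous_at_pair; [exact: cvg_cst|exact: cvg_id].
Qed.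

(** Cauchy's formula times z, with the kernel z / (Z - z) replaced by its limit
    -1; the error is O(1 / |z|). *)
Lemma zf_infty : ulim Z (fun w => toC w * f w) (cint (fun t => f (p 1 t) * Z' t) / winding).
Proof.
pose h t := f (p 1 t) * Z' t.
have ch : ccont h by move=> t; apply: contCM; [exact: ccont_f1|exact: (gc_cont gc)].
have [M M0 hM] := ccont_bound ch.
have k0 : 0 < normc winding by rewrite lt_neqAle normc_ge0 andbT eq_sym; apply: contra winding0 => /eqP /eq0_normc ->.
(* beyond scale 8 the point is at distance at least s / 4 from the curve *)
move=> e e0; exists (8 + 32 * pi * M / (normc winding * e)) => s t hs.
have A0 : 0 <= 32 * pi * M / (normc winding * e) by rewrite divr_ge0 ?mulr_ge0 ?pi_ge0// ltW.
have s8 : 8 < s by lra.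
have s1 : 1 < s by lra.
have s0 : 0 < s by lra.
set z := toC (p s t).
have zn : s / 2 <= normc z by rewrite (normc_p Z t (ltW s0)); have := gc_lo gc t; nra.
have dz r : s / 4 <= normc (Z r - z).
  rewrite normcBC; apply: le_trans (normc_rev _ _).
  by have := gc_hi gc r; lra.
have dz0 r : Z r - z != 0.
  by apply/eqP => e1; have := dz r; rewrite e1 normc0; lra.
have cZz : ccont (fun r => Z r / (Z r - z)).
  move=> r; have cZ := Z_ccont gc r; apply: contCM; [exact: cZ|apply: contCV; [exact: dz0|]].
  by apply: contCB; [exact: cZ|exact: contC_cst].
have E : (z * f (p s t) - cint h / winding) * winding = - cint (fun r => h r * (Z r / (Z r - z))).
  rewrite mulrBl divfK// -mulrA (cauchy_bdry gc hf inD f_infty cf t s1) mulrN -/z.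
  have cq : ccont (fun r => f (p 1 r) * (Z r / (Z r - z)) * L r).
    by apply: (ccont_FL gc) => r; apply: contCM; [exact: ccont_f1|exact: cZz].
  rewrite -(cintZ z cq).
  have czq : ccont (fun r => z * (f (p 1 r) * (Z r / (Z r - z)) * L r)).
    by move=> r; apply: contCM; [exact: contC_cst|exact: cq].
  rewrite -opprD -(cintD czq ch).
  congr (- _); apply: eq_cint => r; rewrite /h; have Z0 := Z_neq0 gc r; have := dz0 r => d0.
  by field; rewrite Z0 d0.
have nE : normc (z * f (p s t) - cint h / winding) * normc winding <= 2 * (2 * pi * (M * (8 / s))).
  rewrite -normcM E normcN; apply: cint_norm_le; first by move=> r; apply: contCM.
  move=> r rI; rewrite normcM; apply: ler_pM; rewrite ?normc_ge0//; first exact: hM.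
  rewrite normcM normcV ler_pdivrMr; last by apply: lt_le_trans (dz r); lra.
  apply: le_trans (gc_hi gc r) _.
  have -> : 8 / s * normc (Z r - z) = 8 * (normc (Z r - z) / s) by ring.
  have : 1 / 4 <= normc (Z r - z) / s by rewrite ler_pdivlMr//; have := dz r; lra.
  by lra.
have sK : 32 * pi * M <= s * (normc winding * e).
  by rewrite -ler_pdivrMr ?mulr_gt0//; lra.
rewrite -(ler_pM2r k0); apply: le_trans nE _.
have -> : 2 * (2 * pi * (M * (8 / s))) = 32 * pi * M / s by ring.
by rewrite ler_pdivrMr//; lra.
Qed.

(** Partial fractions in Cauchy's formula: c / (Z - z) = (c / z) (Z / (Z - z) -
    1), and the first term integrates to 0 by [kernel_in]. *)
Lemma f_pole (c : C) : (forall t, f (p 1 t) * Z t = c) ->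
  forall s t, 1 <= s -> f (p s t) = c / toC (p s t).
Proof.
move=> hc s t; rewrite le_eqVlt => /predU1P[<-|s1].
  have Z0 := Z_neq0 gc t.
  by rewrite -(hc t) toC_p mul1r mulfK.
have s0 : 0 < s by lra.
have z0 : toC (p s t) != 0.
  by rewrite toC_p mulf_neq0 ?(Z_neq0 gc)// eq_complex /= negb_and gt_eqF.
have I : 0 < (1:R) < s by rewrite ltr01.
have k0 := kernel_in gc t I.
apply: (mulIf winding0); rewrite (cauchy_bdry gc hf inD f_infty cf t s1).
set z := toC (p s t) in z0 k0 *.
have dz r : Z r - z != 0.
  rewrite subr_eq0 /z toC_p; apply/eqP => e.
  have : 1 = s by apply: (gc_inj gc ltr01 s0 (t := r) (t' := t)); rewrite mul1r.
  lra.
have cq : ccont (fun r => toC (p 1 r) / (toC (p 1 r) - z)).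
  move=> r; rewrite (_ : (fun r => _) = (fun r => Z r / (Z r - z))); last by apply/funext => ?; rewrite toC_p mul1r.
  have cZ := Z_ccont gc r; apply: contCM; [exact: cZ|apply: contCV; [exact: dz|]].
  by apply: contCB; [exact: cZ|exact: contC_cst].
rewrite (@eq_cint _ _ (fun r => c / z * (toC (p 1 r) / (toC (p 1 r) - z) * L r) - c / z * L r)).
  rewrite cintB; first last.
  - by move=> r; apply: contCM; [exact: contC_cst|exact: (L_ccont gc)].
  - by move=> r; apply: contCM; [exact: contC_cst|exact: (ccont_FL gc cq)].
  rewrite !cintZ; [|exact: (L_ccont gc)|exact: (ccont_FL gc cq)].
  by rewrite k0 mulr0 sub0r opprK.
move=> r; rewrite -(hc r) toC_p mul1r; have Z0 := Z_neq0 gc r; have d0 := dz r.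
by field; rewrite Z0 d0 z0.
Qed.
End Asym.
End Exterior2.

(** * The maximum principle outside a curve *)

Section MaxPrinciple.
Context {R : realType}.
Local Notation C := R[i].

Lemma pt_dist (z : R * R) (rho t : R) : `|pt (toC z) cisC rho t - z| <= `|rho|.
Proof.
apply: le_trans (maxnorm_le _) _.
have -> : toC (pt (toC z) cisC rho t - z) = rho%:C * cisC t.
  by case: z => a b; apply: eqC; rewrite !ReImE /=; ring.
by rewrite normcM normc_real normc_cis mulr1.
Qed.

Lemma open_disk (D : set (R * R)) z : open D -> D z -> exists2 r : R, 0 < r &
  forall rho t, `|rho| < r -> D (pt (toC z) cisC rho t).
Proof.
move=> oD Dz; have : nbhs z D by exact: open_nbhs_nbhs.
move=> /nbhs_ballP[r /= r0 h]; exists r => // rho t rr; apply: h.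
by rewrite -ball_normE /= distrC; apply: le_lt_trans (pt_dist _ _ _) rr.
Qed.

(** Circles about z are scaled copies of the unit circle, for which dZ / Z = i
    dt, so the mean over them is independent of the radius; let the radius tend
    to 0. *)
Lemma mean_value (D : set (R * R)) (E E' : R * R -> C) z (r : R) : holo D E E' -> 0 < r ->
  (forall rho t, `|rho| < r -> D (pt (toC z) cisC rho t)) ->
  forall rho, 0 < rho < r ->
  oint (fun t => Re (E (pt (toC z) cisC rho t))) = 2 * pi * Re (E z).
Proof.
move=> hE r0 inD rho I.
have cc : ccont (@cisC R) by move=> t; exact: derC_cont (derC_cis t).
have ratio t : dcisC t / cisC t = 'i :> C by rewrite dcisCE mulfK// cis_neq0.
have inD' s t : 0 < s < r -> D (pt (toC z) cisC s t).
  by move=> /andP[s0 sr]; apply: inD; rewrite gtr0_norm.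
have per : cisC (2 * pi) = cisC 0 :> C by rewrite -(cis_per 0) add0r.
have hom1 s1 s2 := @contour_scaling R cisC dcisC derC_cis contC_dcis cis_neq0 per D E E' (toC z) 0 r (lexx 0) inD' hE s1 s2.
pose k (s t : R) := Re (E (pt (toC z) cisC s t)).
have kE s : 0 < s < r -> oint (k s) = oint (k rho).
  move=> Is; have := congr1 (@complex.Im R) (hom1 s rho Is I); rewrite /=.
  have e x : (fun t => Im (E (pt (toC z) cisC x t) * (dcisC t / cisC t))) = k x.
    by apply/funext => t; rewrite ratio ImM /=; ring.
  by rewrite !e.
have ck (s t : R) : - r < s < r -> {for (s, t), continuous (fun q : R * R => k q.1 q.2)}.
  move=> /andP[s1 s2].
  have [] // : contC (fun q : R * R => E (pt (toC z) cisC q.1 q.2)) (s, t).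
  apply: (@contC_comp _ _ _ (fun q : R * R => pt (toC z) cisC q.1 q.2) E).
    exact: contC_pt.
  by apply: (holo_contC hE); apply: inD; rewrite ltr_norml s1 s2.
have c0 : {for (0 : R), continuous (fun s => oint (k s))}.
  by apply: (@oint_continuous_param _ k (- r) r) => //; rewrite oppr_lt0 r0.
have := right_const r0 c0 (c := oint (k rho)).
rewrite add0r => /(_ kE) <-.
rewrite -oint_cst; apply: eq_oint => t; rewrite /k /pt mul0r addr0.
by rewrite toCK.
Qed.

Variables (Z Z' : R -> C).
Hypothesis gc : gauge_curve Z Z'.
Local Notation p := (pt 0 Z).

(** If the maximum of Re E is nonnegative it is attained at a finite scale.
    Take a maximiser of largest scale: the mean value property makes Re E
    maximal on a circle about it, in particular at a point of the same ray
    further out. *)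
Lemma max_principle (D : set (R * R)) (E E' : R * R -> C) l :
  open D -> (forall s t, 1 < s -> D (p s t)) -> (forall w, D w -> exists s t, 1 < s /\ w = p s t) ->
  holo D E E' -> ulim Z E l -> Re l < 0 ->
  (forall q : R * R, contC (fun q : R * R => E (p (Num.max 1 q.1) q.2)) q) ->
  (forall t, Re (E (p 1 t)) <= 0) ->
  forall s t, 1 < s -> Re (E (p s t)) < 0.
Proof.
move=> oD inD Dp hE ul l0 cE b0 s1 t1' s11; rewrite ltNge; apply/negP => v1'.
have red s t : exists2 t', 0 <= t' <= 2 * pi & p s t' = p s t.
  by have [t' It' e] := gc_red gc t; exists t' => //; rewrite /pt e.
have [t1 t1I e1] := red s1 t1'; have v1 : 0 <= Re (E (p s1 t1)) by rewrite e1.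
have [|S0 hS0] := ul (- Re l / 2); first by rewrite divr_gt0// oppr_gt0.
have neg s t : S0 < s -> Re (E (p s t)) < 0.
  move=> hs; have := le_trans (normc_Re _) (hS0 s t hs).
  by rewrite ReB ler_norml => /andP[_]; lra.
pose S := Num.max S0 s1 + 1.
have SS0 : S0 < S by rewrite /S ltr_pwDr// le_max lexx.
have Ss1 : s1 < S by rewrite /S ltr_pwDr// le_max lexx orbT.
pose V (q : R * R) := Re (E (p (Num.max 1 q.1) q.2)).
have cV : continuous V by move=> q; have [] := cE q.
pose A : set (R * R) := [set` `[1, S]] `*` [set` `[0, 2 * pi]].
have cA : compact A by apply: compact_setX; exact: segment_compact.
have A1 : A (s1, t1) by split; rewrite /= in_itv/= ?t1I//; apply/andP; split; lra.
have A0 : A !=set0 by exists (s1, t1).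
have [c cA' cM] := @compact_EVT_max _ R V A A0 cA (continuous_subspaceT cV).
set M := V c in cM.
have V1 : V (s1, t1) = Re (E (p s1 t1)) by rewrite /V /= max_r// ltW.
have M0 : 0 <= M by apply: le_trans (cM (s1, t1) _); rewrite ?V1// inE.
(* the maximisers; [d] is one of largest scale *)
pose T : set (R * R) := A `&` V @^-1` [set M].
have cT : compact T.
  apply: compact_closedI => //; apply: closed_comp; last exact: closed_eq.
  by move=> q _; exact: cV.
have T0 : T !=set0 by exists c; split => //; exact: set_mem.
have [d dT dM] := @compact_EVT_max _ R fst T T0 cT (continuous_subspaceT (@cont_fst R)).
have {dT} [[dA1 dA2] dV] : T d by exact: set_mem.
have d1 : 1 < d.1.
  move: dA1; rewrite /= in_itv/= => /andP[]; rewrite le_eqVlt => /predU1P[d1|//] _.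
  have : M <= 0 by rewrite -dV /V -d1 maxxx; exact: b0.
  move=> Mle; have eM : M = 0 by apply/eqP; rewrite eq_le Mle M0.
  have : T (s1, t1).
    split => //=; apply/eqP; rewrite eq_le; apply/andP; split; first by apply: cM; rewrite inE.
    by rewrite V1 eM.
  by move=> /mem_set /dM /=; rewrite -d1; lra.
set z := p d.1 d.2.
have Dz : D z by exact: inD.
have Ez : Re (E z) = M by rewrite -dV /V max_r// ltW.
have below w : D w -> Re (E w) <= M.
  move=> /Dp[s [t' [s1' ->]]]; have [t It <-] := red s t'.
  have [hs|hs] := leP s S; last by apply: le_trans M0; apply: ltW; apply: neg; lra.
  have -> : Re (E (p s t)) = V (s, t) by rewrite /V /= max_r// ltW.
  by apply: cM; rewrite inE; split; rewrite /= in_itv//= hs ltW.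
have [r r0 inr] := open_disk oD Dz.
pose rho := r / 2.
have rI : 0 < rho < r by rewrite /rho; apply/andP; split; lra.
have mv := mean_value hE r0 inr rI.
have inrho t : D (pt (toC z) cisC rho t) by apply: inr; rewrite gtr0_norm; case/andP: rI.
have cRe : continuous (fun t => Re (E (pt (toC z) cisC rho t))).
  move=> t; have [] // : contC (fun t => E (pt (toC z) cisC rho t)) t.
  apply: (@contC_comp _ _ _ (fun t => pt (toC z) cisC rho t) E); last by apply: (holo_contC hE).
  apply: contC_ofC; apply: contCD; first exact: contC_cst.
  by apply: contCM; [exact: contC_cst|exact: derC_cont (derC_cis t)].
have ccst : continuous (fun _ : R => M) by exact: cst_continuous.
have cdif : continuous (fun t => M - Re (E (pt (toC z) cisC rho t))).
  by move=> t; apply: cvgB; [exact: ccst|exact: cRe].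
have zero : oint (fun t => M - Re (E (pt (toC z) cisC rho t))) = 0.
  by rewrite ointB// oint_cst mv Ez subrr.
have [th thI zth] := polar (Z d.2).
have nn t : 0 <= M - Re (E (pt (toC z) cisC rho t)) by rewrite subr_ge0 below.
have /eqP := oint_eq0 cdif nn zero thI; rewrite subr_eq0 => /eqP EM.
have nZ : 0 < normc (Z d.2) by have := gc_lo gc d.2; lra.
(* the point where the small circle meets the ray of z further out *)
pose s' := d.1 + rho / normc (Z d.2).
have rho0 : 0 < rho by case/andP: rI.
have ds' : d.1 < s' by rewrite /s' ltrDl divr_gt0.
have ps' : pt (toC z) cisC rho th = p s' d.2.
  rewrite /pt; congr ofC; rewrite /z toC_p add0r /s' rmorphD /= mulrDl; congr (_ + _).
  by rewrite {2}zth mulrA -rmorphM /= divfK// gt_eqF.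
have V' : V (s', d.2) = M by rewrite /V /= max_r -?ps'//; lra.
have s'S : s' <= S.
  rewrite leNgt; apply/negP => hs; have := neg s' d.2.
  rewrite -ps' -EM => /(_ _); have h : S0 < s' by lra.
  by move=> /(_ h); lra.
have : T (s', d.2).
  by split => //; split => //=; rewrite in_itv/= s'S andbT; lra.
by move=> /mem_set /dM /=; lra.
Qed.
End MaxPrinciple.

(** * Curves close to the unit circle *)

Section Reduction.
Context {R : realType}.
(** The conclusion is stated for all 2 pi-periodic functions at once, so that a
    single reduced parameter serves several of them. *)
Lemma reduce_mod_2pi (a t : R) : exists2 t', a <= t' < a + 2 * pi &
  forall (X : Type) (g : R -> X), (forall t, g (t + 2 * pi) = g t) -> g t' = g t.
Proof.
have p0 := @pi2_gt0 R.
pose n := Num.floor ((t - a) / (2 * pi)).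
have /andP[n1 n2] : n%:~R <= (t - a) / (2 * pi) < n%:~R + 1.
  by rewrite Num.Theory.floor_le_tmp /= -intrD1 Num.Theory.floorD1_gt.
move: n1 n2; rewrite ler_pdivlMr// ltr_pdivrMr// => n1 n2.
exists (t - n%:~R * (2 * pi)); first by apply/andP; split; lra.
move=> X g gper.
have gn (k : nat) u : g (u + k%:R * (2 * pi)) = g u.
  by elim: k => [|k IH]; rewrite ?mul0r ?addr0// -natr1 mulrDl mul1r addrA gper.
case: n {n1 n2} => k.
  by rewrite -(gn k) /= subrK.
by rewrite NegzE mulrNz mulNr opprK; exact: gn.
Qed.

Lemma cos_eq1 (x : R) : 0 <= x < 2 * pi -> cos x = 1 -> x = 0.
Proof.
move=> /andP[x0 x2] c1; have [xp|xp] := leP x pi.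
  have e : acos (cos x) = x by apply: cosK; rewrite in_itv/= x0.
  by rewrite -e c1 acos1.
have c2 : cos (2 * pi - x) = 1.
  have : cisC (2 * pi - x) = cisC (- x) by rewrite addrC cis_per.
  by move=> [-> _]; rewrite cosN.
have e : acos (cos (2 * pi - x)) = 2 * pi - x.
  by apply: cosK; rewrite in_itv/=; apply/andP; split; lra.
by move: e; rewrite c2 acos1; lra.
Qed.

Lemma cis_inj (x y : R) : 0 <= y - x < 2 * pi -> cisC x = cisC y -> x = y.
Proof.
move=> I [c s]; have : y - x = 0; last by lra.
by apply: cos_eq1 => //; rewrite cosB c s -!expr2 cos2Dsin2.
Qed.

Lemma cisD (x y : R) : cisC (x + y) = cisC x * cisC y.
Proof. by apply: eqC; rewrite !ReImE /= ?cosD ?sinD; ring. Qed.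

Lemma lipschitz_le (g dg : R -> R) (M : R) : (forall t : R, is_derive t 1 g (dg t)) ->
  (forall t, `|dg t| <= M) -> forall x y, `|g x - g y| <= M * `|x - y|.
Proof.
move=> d dM x y; wlog xy : x y / y <= x.
  by move=> h; case: (leP y x) => [|/ltW] a; [exact: h|rewrite distrC (distrC x); exact: h].
have cg : {within `[y, x], continuous g}.
  apply: derivable_within_continuous => s _; by have [] := d s.
have [c _ ->] := MVT_segment xy (fun t _ => d t) cg.
by rewrite normrM ler_wpM2r.
Qed.

Lemma derive_lower (g dg : R -> R) (m : R) : (forall t : R, is_derive t 1 g (dg t)) ->
  (forall t, m <= dg t) -> forall x y, y <= x -> m * (x - y) <= g x - g y.
Proof.
move=> d dM x y xy.
have cg : {within `[y, x], continuous g}.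
  apply: derivable_within_continuous => s _; by have [] := d s.
have [c _ ->] := MVT_segment xy (fun t _ => d t) cg.
by rewrite ler_wpM2r// subr_ge0.
Qed.
End Reduction.

Record near_circle {R : realType} (eta : R) (Z Z' : R -> R[i]) : Prop := NearCircle {
  nc_eta : 0 <= eta <= 1 / 100;
  nc_deriv : forall t, derC Z t (Z' t);
  nc_cont : ccont Z';
  nc_per : forall t, Z (t + 2 * pi) = Z t;
  nc_near : forall t, normc (Z t - cisC t) <= eta;
  nc_near' : forall t, normc (Z' t - dcisC t) <= eta
}.

Section NearCircle.
Context {R : realType}.
Local Notation C := R[i].
Variables (eta : R) (Z Z' : R -> C).
Hypothesis nc : near_circle eta Z Z'.
Fact eta0 : 0 <= eta. Proof. by case/andP: (nc_eta nc). Qed.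

Fact eta1 : eta <= 1 / 100. Proof. by case/andP: (nc_eta nc). Qed.
Local Notation L t := (Z' t / Z t).

Lemma nc_lo t : 1 - eta <= normc (Z t).
Proof.
have := normc_rev (cisC t) (cisC t - Z t); rewrite opprB addrCA subrr addr0 normc_cis.
by have h := nc_near nc t; rewrite normcBC in h; lra.
Qed.

Lemma nc_hi t : normc (Z t) <= 1 + eta.
Proof.
have := normcD (Z t - cisC t) (cisC t); rewrite subrK normc_cis.
by have := nc_near nc t; lra.
Qed.

Lemma nc_neq0 t : Z t != 0.
Proof. by apply/eqP => e; have := nc_lo t; rewrite e normc0; have := eta1; lra. Qed.

Lemma nc_L t : normc (L t - 'i) <= 3 * eta.
Proof.
have Z0 := nc_neq0 t.
have -> : L t - 'i = ((Z' t - dcisC t) + 'i * (cisC t - Z t)) / Z t by rewrite dcisCE; field.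
rewrite normcM normcV ler_pdivrMr; last by have := nc_lo t; have := eta1; lra.
apply: le_trans (normcD _ _) _; rewrite normcM.
have -> : normc ('i : C) = 1 by rewrite /= expr0n expr1n add0r sqrtr1.
rewrite (normcBC (cisC t)).
by have := nc_near nc t; have := nc_near' nc t; have := nc_lo t; have := eta0; have := eta1; nra.
Qed.

(** Imaginary and real parts of Z' / Z: the derivatives of the angle and of the
    logarithm of the modulus. *)
Definition wt t := Im (L t).
Definition bt t := Re (L t).
Lemma wt_near t : `|wt t - 1| <= 3 * eta.
Proof. by apply: le_trans (nc_L t); apply: le_trans (normc_Im _); rewrite ImB. Qed.

Lemma bt_near t : `|bt t| <= 3 * eta.
Proof. by apply: le_trans (nc_L t); apply: le_trans (normc_Re _); rewrite ReB /= subr0. Qed.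

Lemma wt_lo t : 1 / 2 <= wt t.
Proof. by have := wt_near t; rewrite ler_norml => /andP[]; have := eta1; lra. Qed.

Lemma nc_ccont : ccont Z. Proof. by move=> t; apply: derC_cont (nc_deriv nc t). Qed.

Lemma L_cc : ccont (fun t => L t).
Proof.
move=> t; apply: contCM; first exact: (nc_cont nc).
by apply: contCV; [exact: nc_neq0|exact: nc_ccont].
Qed.

Lemma wt_cont : continuous wt. Proof. exact: ccont_Im L_cc. Qed.

Lemma bt_cont : continuous bt. Proof. exact: ccont_Re L_cc. Qed.

Let er t := Z t * cisC (- t).
Let e_near t : normc (er t - 1) <= eta.
Proof.
have -> : er t - 1 = (Z t - cisC t) * cisC (- t).
  by rewrite /er mulrBl -cisD subrr /cisC cos0 sin0.
by rewrite normcM normc_cis mulr1; exact: (nc_near nc).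
Qed.

Let Re_e t : 1 / 2 <= Re (er t).
Proof.
have := le_trans (normc_Re _) (e_near t); rewrite ReB ler_norml => /andP[]; rewrite /=.
by have := eta1; lra.
Qed.

(** A continuous argument of Z: the angle of Z is t up to the argument of Z
    e^(-it), which stays in the right half-plane where the arctangent computes
    it. *)
Definition theta t := t + atan (Im (er t) / Re (er t)).

Lemma theta_near t : t - pi / 2 < theta t < t + pi / 2.
Proof. by rewrite /theta; have := atan_gtNpi2 (Im (er t) / Re (er t)); have := atan_ltpi2 (Im (er t) / Re (er t)) => ? ?; apply/andP; split; lra. Qed.

Lemma atan_polar (z : C) : 0 < Re z -> z = (normc z)%:C * cisC (atan (Im z / Re z)).
Proof.
case: z => a b /= a0; have an : a != 0 by rewrite gt_eqF.
have ca := atan_gtNpi2 (b / a); have cb := atan_ltpi2 (b / a).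
have c0 : 0 < cos (atan (b / a)) by apply: cos_gt0_pihalf; rewrite ca cb.
have -> : Num.sqrt (a ^+ 2 + b ^+ 2) = a / cos (atan (b / a)).
  rewrite cos_atan invrK.
  have -> : a ^+ 2 + b ^+ 2 = a ^+ 2 * (1 + (b / a) ^+ 2) by field.
  by rewrite sqrtrM ?sqr_ge0// sqrtr_sqr gtr0_norm.
have tn : sin (atan (b / a)) = b / a * cos (atan (b / a)).
  by rewrite -{2}(atanK (b / a)) /tan divfK// gt_eqF.
by apply: eqC; rewrite !ReImE /= ?tn; field; rewrite ?an gt_eqF.
Qed.

Lemma theta_polar t : Z t = (normc (Z t))%:C * cisC (theta t).
Proof.
have h : er t = (normc (Z t))%:C * cisC (atan (Im (er t) / Re (er t))).
  have -> : normc (Z t) = normc (er t) by rewrite /er normcM normc_cis mulr1.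
  by apply: atan_polar; have := Re_e t; lra.
have -> : Z t = er t * cisC t by rewrite /er -mulrA -cisD addNr /cisC cos0 sin0 mulr1.
rewrite {1}h /theta addrC cisD mulrA; congr (_%:C * _ * _).
by rewrite /er normcM normcM !normc_cis !mulr1.
Qed.

Lemma theta_per t : theta (t + 2 * pi) = theta t + 2 * pi.
Proof.
have -> : theta (t + 2 * pi) = t + 2 * pi + atan (Im (er t) / Re (er t)).
  rewrite /theta /er (nc_per nc) (_ : cisC (- (t + 2 * pi)) = cisC (- t))//.
  by rewrite opprD -(cis_per (- t - 2 * pi)) subrK.
by rewrite /theta; ring.
Qed.

Lemma theta_derive (t : R) : is_derive t 1 theta (wt t).
Proof.
have dcn : derC (fun s : R => cisC (- s)) t (- dcisC (- t)).
  split => /=.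
    have := @is_derive1_comp _ (@cos R) -%R t _ _ (is_derive_cos _) (is_deriveNid _ _).
    by move=> /is_derive_eqf; apply => //=; rewrite mulrN1.
  have := @is_derive1_comp _ (@sin R) -%R t _ _ (is_derive_sin _) (is_deriveNid _ _).
  by move=> /is_derive_eqf; apply => //=; rewrite mulrN1.
have de := derCM (nc_deriv nc t) dcn.
set e' := _ + _ in de; case: de => de1 de2.
have r0 : Re (er t) != 0 by have := Re_e t; lra.
have dq := is_deriveM de2 (is_deriveV r0 de1).
have := is_deriveD (is_derive_id t 1) (is_derive1_comp (is_derive1_atan _) dq).
move=> /is_derive_eqf; apply => //.
rewrite /GRing.scale /= !fctE.
have e'E : e' = (L t - 'i) * er t.
  by rewrite /e' /er dcisCE; have := nc_neq0 t => ?; field.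
rewrite -/(er t) e'E /wt.
have n0 : Re (er t) ^+ 2 + Im (er t) ^+ 2 != 0.
  by rewrite gt_eqF// ltr_pwDl ?sqr_ge0// exprn_even_gt0.
move: (er t) (L t) r0 n0 => E l r0 n0.
by rewrite !ReImE /=; field; rewrite r0 n0.
Qed.

Lemma oint_wt : oint wt = 2 * pi.
Proof. by rewrite (oint_deriv wt_cont theta_derive) -{1}(add0r (2 * pi)) theta_per addrAC subrr add0r. Qed.

Lemma nsqZ_gt0 t : 0 < nsq (Z t). Proof. by apply: nsq_gt0; exact: nc_neq0. Qed.

Lemma nsq_derive (t : R) : is_derive t 1 (fun s => nsq (Z s)) (2 * nsq (Z t) * bt t).
Proof.
have [d1 d2] := nc_deriv nc t.
have := is_deriveD (is_deriveM d1 d1) (is_deriveM d2 d2).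
move=> /is_derive_eqf; apply => //.
rewrite /GRing.scale /= /bt ReM ReV ImV.
have := nsqZ_gt0 t; rewrite /nsq; move: (Z t) (Z' t) => [a b] [c d] /= n0.
by field; rewrite gt_eqF.
Qed.

(** The integrand is the derivative of the periodic function G(|Z|^2). *)
Lemma oint_exact (g G : R -> R) : (forall x : R, 0 < x -> is_derive x 1 G (g x)) ->
  continuous (fun t => g (nsq (Z t)) * (2 * nsq (Z t) * bt t)) ->
  oint (fun t => g (nsq (Z t)) * (2 * nsq (Z t) * bt t)) = 0.
Proof.
move=> dG c.
have d t := @is_derive1_comp _ G (fun s => nsq (Z s)) t _ _ (dG _ (nsqZ_gt0 t)) (nsq_derive t).
have := @oint_deriv _ (fun t => G (nsq (Z t))) _ c d => ->.
by rewrite -{1}(add0r (2 * pi)) (nc_per nc) subrr.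
Qed.

Lemma nsqZ_cont : continuous (fun t => nsq (Z t)).
Proof. by move=> t; apply: contC_nsq; exact: nc_ccont. Qed.

Lemma oint_bt : oint bt = 0.
Proof.
have be : bt =1 (fun t => (2 * nsq (Z t))^-1 * (2 * nsq (Z t) * bt t)).
  by move=> t; have := nsqZ_gt0 t => n0; field; rewrite gt_eqF.
rewrite (eq_oint be); apply: (@oint_exact (fun x => (2 * x)^-1) (fun x => 2^-1 * ln x)).
  move=> x x0; have := is_deriveZ 2^-1 (is_derive1_ln x0).
  by move=> /is_derive_eqf; apply => //; rewrite /GRing.scale /=; field; rewrite gt_eqF.
by move=> t; rewrite -(funext be); exact: bt_cont.
Qed.

Lemma windingE : winding Z Z' = (2 * pi)%:C * 'i.
Proof.
by apply: eqC; rewrite !ReImE /= ?mul0r ?mulr0 ?mulr1 ?subr0 ?addr0; [exact: oint_bt|exact: oint_wt].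
Qed.

Lemma winding_neq0 : winding Z Z' != 0.
Proof.
rewrite windingE mulf_neq0//; first by rewrite eq_complex /= negb_and gt_eqF ?pi2_gt0.
by rewrite eq_complex /= negb_and oner_eq0 orbT.
Qed.

Lemma theta_inj_mod t t' : cisC (theta t) = cisC (theta t') -> Z t = Z t'.
Proof.
have [t1 I1 h] := reduce_mod_2pi t t'.
rewrite -(h _ Z (nc_per nc)) -(h _ (fun t => cisC (theta t))) => [ec|u]; last by rewrite theta_per cis_per.
congr Z.
have p0 := @pi2_gt0 R.
have [I2 I3] : t <= t1 /\ t1 < t + 2 * pi by case/andP: I1.
have low x y := @derive_lower _ theta wt (1 / 2) theta_derive wt_lo x y.
have th1 := low t1 t I2; have th2 := low (t + 2 * pi) t1 (ltW I3).
rewrite theta_per in th2.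
have : theta t = theta t1 by apply: cis_inj => //; apply/andP; split; lra.
by lra.
Qed.

Lemma normc_gt0 (z : C) : z != 0 -> 0 < normc z.
Proof. by move=> z0; rewrite lt_neqAle normc_ge0 andbT eq_sym; apply: contra z0 => /eqP /eq0_normc ->. Qed.

Lemma polar_inj (r r' : R) (x y : R) : 0 < r -> 0 < r' -> r%:C * cisC x = r'%:C * cisC y -> r = r' /\ cisC x = cisC y.
Proof.
move=> r0 r0' e; have rr : r = r'.
  by have := congr1 (@normc R) e; rewrite !normcM !normc_cis !normc_real !mulr1 !gtr0_norm.
split => //; move: e; rewrite rr => /mulfI; apply.
by rewrite eq_complex /= negb_and gt_eqF.
Qed.

(** The angle theta is strictly increasing and gains 2 pi per period, so two
    points of the curve on the same ray coincide. *)
Lemma nc_gauge : gauge_curve Z Z'.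
Proof.
have h0 := eta0; have h1 := eta1.
split.
- exact: (nc_deriv nc).
- exact: (nc_cont nc).
- by rewrite -{1}(add0r (2 * pi)) (nc_per nc).
- move=> t; have [t' /andP[a b] h] := reduce_mod_2pi 0 t; exists t'; last exact: (h _ Z (nc_per nc)).
  by rewrite a /=; lra.
- by move=> t; have := nc_lo t; lra.
- by move=> t; have := nc_hi t; lra.
- move=> t; have := normcD (Z' t - dcisC t) (dcisC t); rewrite subrK.
  have -> : normc (dcisC t) = 1 by rewrite /= sqrrN addrC cos2Dsin2 sqrtr1.
  by have := nc_near' nc t; lra.
- move=> s s' t t' s0 s0'; rewrite (theta_polar t) (theta_polar t') !mulrA -!rmorphM /= => e.
  have n1 := normc_gt0 (nc_neq0 t); have n2 := normc_gt0 (nc_neq0 t').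
  have [e1 e2] := polar_inj (mulr_gt0 s0 n1) (mulr_gt0 s0' n2) e.
  by move: e1; rewrite (theta_inj_mod e2); apply: mulIf; rewrite gt_eqF.
Qed.

Lemma theta_surj (a : R) : exists t, theta t = a.
Proof.
have ct : continuous theta.
  by move=> t; apply: differentiable_continuous; apply/derivable1_diffP; have [] := theta_derive t.
have p0 := @pi_gt0 R.
have le1 : a - pi / 2 <= a + pi / 2 by lra.
have := @IVT _ theta (a - pi / 2) (a + pi / 2) a le1 (continuous_subspaceT ct).
have := theta_near (a - pi / 2); have := theta_near (a + pi / 2) => /andP[h1 h2] /andP[h3 h4].
case.
  by rewrite ge_min le_max; apply/andP; split; apply/orP; [left|right]; lra.
by move=> c _ e; exists c.
Qed.

Lemma nc_surj (z : C) : z != 0 -> exists s t, 0 < s /\ z = s%:C * Z t.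
Proof.
move=> z0; have [a _ e] := polar z; have [t ht] := theta_surj a.
have n1 := normc_gt0 (nc_neq0 t).
exists (normc z / normc (Z t)), t; split; first by rewrite divr_gt0// normc_gt0.
by rewrite {2}(theta_polar t) mulrA -rmorphM /= ht divfK ?gt_eqF.
Qed.
End NearCircle.

(** * The region enclosed by such a curve *)

Section Topology.
Context {R : realType}.
Local Notation C := R[i].
Implicit Types V : set (R * R).

Lemma closureUfrontier V : closure V = V `|` frontier V.
Proof.
apply/seteqP; split => x.
  by move=> cx; have [Vx|nVx] := pselect (V x); [left|right; split => // /interior_subset].
by case=> [|[]//]; exact: subset_closure.
Qed.

(** A connected path that avoids the frontier cannot leave the open set. *)
Lemma segment_in V (c : R -> R * R) (a b : R) : open V -> continuous c -> a <= b ->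
  (forall x, a <= x <= b -> ~ frontier V (c x)) ->
  (exists2 x, a <= x <= b & V (c x)) -> forall x, a <= x <= b -> V (c x).
Proof.
move=> oV cc ab nf [x0 x0I Vx0] x xI.
have := @segment_connected R a b => /(_ ([set` `[a, b]] `&` c @^-1` V)) H.
have : [set` `[a, b]] x by rewrite /= in_itv.
rewrite -H; first by case.
- by exists x0; split => //; rewrite /= in_itv.
- exists (c @^-1` V) => //; apply: open_comp => // y _; exact: cc.
- exists (c @^-1` (closure V)); first by apply: closed_comp; [move=> y _; exact: cc|exact: closed_closure].
  apply/seteqP; split => y [yI cy]; split => //; first exact: subset_closure.
  by move: cy; rewrite /= closureUfrontier => -[//|fy]; exfalso; apply: (nf y).
Qed.

Variables (eta : R) (Z Z' : R -> C).
Hypothesis nc : near_circle eta Z Z'.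
Local Notation p := (pt 0 Z).
Let gc := nc_gauge nc.

Lemma p_surj (w : R * R) : w = 0 \/ exists s t, 0 < s /\ w = p s t.
Proof.
have [w0|w0] := eqVneq (toC w) 0; [left|right].
  by move: w0; case: w => a b [-> ->].
have [s [t [s0 e]]] := nc_surj nc w0; exists s, t; split => //.
by rewrite /pt add0r -e toCK.
Qed.

Lemma pt_scale0 t : p 0 t = 0.
Proof. by rewrite /pt mul0r add0r. Qed.

Lemma p_inj s s' t t' : 0 < s -> 0 < s' -> p s t = p s' t' -> s = s'.
Proof. by move=> s0 s0' /(congr1 (@toC R)); rewrite !toC_p; exact: (gc_inj gc). Qed.

Lemma p_neq0 s t : 0 < s -> p s t <> 0.
Proof.
move=> s0 /(congr1 (@toC R)); rewrite toC_p => /eqP; rewrite mulf_eq0 (negbTE (nc_neq0 nc t)) orbF.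
by rewrite eq_complex /= gt_eqF.
Qed.

Lemma ray_cont t : continuous (fun s => p s t).
Proof.
move=> s; apply: contC_ofC; apply: contCD; first exact: contC_cst.
by apply: contCM; [apply: contC_real; exact: cvg_id|exact: contC_cst].
Qed.

Section Core.
Variable V : set (R * R).
Hypothesis oV : open V.
Hypothesis bV : bounded_set V.
Hypothesis fV : forall w, frontier V w <-> exists t, w = p 1 t.

Lemma V_not_frontier w : V w -> ~ frontier V w.
Proof. by move=> Vw [_]; apply; exact: (open_nbhs_nbhs (conj oV Vw)). Qed.

Lemma p_not_frontier s t : 0 <= s -> s != 1 -> ~ frontier V (p s t).
Proof.
rewrite le_eqVlt => /predU1P[<-|s0] s1 /fV[t' e].
  by apply: (@p_neq0 1 t' ltr01); rewrite -e pt_scale0.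
by have := p_inj s0 ltr01 e => /eqP; rewrite (negbTE s1).
Qed.

(** Otherwise the whole outer ray would lie in V, against boundedness. *)
Lemma V_outside s t : 1 < s -> ~ V (p s t).
Proof.
move=> s1 Vp; have [M hM] : exists M : R, forall w, V w -> `|w| <= M.
  by have [M [_ h]] := bV; exists (M + 1) => w Vw; apply: (h (M + 1)) => //; rewrite ltrDl.
have M0 : 0 <= M by apply: le_trans (hM _ Vp).
(* at scale b the point is out of reach of the bound M *)
pose b := s + 4 * M + 1.
have sb : s <= b by rewrite /b; lra.
have : V (p b t).
  apply: (@segment_in V (fun s => p s t) s b) => //; first exact: ray_cont.
  - move=> x /andP[x1 x2]; apply: p_not_frontier; first lra.
    by rewrite gt_eqF//; lra.
  - by exists s => //; rewrite lexx sb.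
  - by rewrite sb lexx.
move=> /hM h.
have b0 : 0 <= b by rewrite /b; lra.
have : normc (toC (p b t)) <= 2 * `|p b t|.
  apply: normc_le; move: (p b t) => [x y] /=; rewrite prod_normE /= le_max lexx ?orbT//.
rewrite (normc_p Z t b0); have := gc_lo gc t; rewrite /b in h *; nra.
Qed.

Hypothesis V0 : V !=set0.

(** A point of V has scale below 1, and its segment to the origin avoids the
    frontier. *)
Lemma V_zero : V 0.
Proof.
have [w Vw] := V0; have [<-//|[s [t [s0 e]]]] := p_surj w.
rewrite e in Vw.
have s1 : s < 1.
  rewrite ltNge le_eqVlt; apply/negP => /predU1P[s1|s1]; last exact: (V_outside s1 Vw).
  by apply: (V_not_frontier Vw); apply/fV; exists t; rewrite s1.
rewrite -(pt_scale0 t).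
apply: (@segment_in V (fun s => p s t) 0 s) => //; rewrite ?lexx ?ltW//; first exact: ray_cont.
- move=> x /andP[x0 xs]; apply: p_not_frontier => //.
  by rewrite lt_eqF//; lra.
- by exists s => //; rewrite lexx ltW.
Qed.

Lemma V_inside s t : 0 <= s < 1 -> V (p s t).
Proof.
move=> /andP[s0 s1].
apply: (@segment_in V (fun s => p s t) 0 s) => //; rewrite ?lexx ?s0//; first exact: ray_cont.
- move=> x /andP[x0 xs]; apply: p_not_frontier => //.
  by rewrite lt_eqF//; lra.
- by exists 0; rewrite ?lexx ?s0// pt_scale0; exact: V_zero.
Qed.

Lemma fluidP w : fluid_domain V w <-> exists s t, 1 < s /\ w = p s t.
Proof.
split; last first.
  move=> [s [t [s1 ->]]]; rewrite /fluid_domain /= closureUfrontier => -[|]; first exact: V_outside.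
  by apply: p_not_frontier; [lra|rewrite gt_eqF].
rewrite /fluid_domain /= closureUfrontier => nV.
have [w0|[s [t [s0 e]]]] := p_surj w; first by exfalso; apply: nV; left; rewrite w0; exact: V_zero.
exists s, t; split => //; rewrite ltNge; apply/negP; rewrite le_eqVlt => /predU1P[s1|s1]; apply: nV.
  by right; apply/fV; exists t; rewrite e s1.
by left; rewrite e; apply: V_inside; rewrite ltW.
Qed.

Lemma fluid_open : open (fluid_domain V).
Proof. by apply: closed_openC; exact: closed_closure. Qed.

Lemma closure_fluidP w : closure (fluid_domain V) w <-> exists s t, 1 <= s /\ w = p s t.
Proof.
split.
  move=> cw; have nV : ~ V w.
    move=> Vw; have [u []] := cw V (open_nbhs_nbhs (conj oV Vw)).
    by move=> nu Vu; apply: nu; exact: subset_closure.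
  have [w0|[s [t [s0 e]]]] := p_surj w; first by exfalso; apply: nV; rewrite w0; exact: V_zero.
  exists s, t; split => //; rewrite leNgt; apply/negP => s1.
  by apply: nV; rewrite e; apply: V_inside; rewrite ltW.
move=> [s [t [s1 ->]]] B nB.
have : \forall x \near s^'+, B (p x t).
  by have /cvg_at_right_filter := @ray_cont t s; apply.
move=> h; near s^'+ => x; exists (p x t); split; last by near: x.
apply/fluidP; exists x, t; split => //; apply: le_lt_trans s1 _.
by near: x; exact: nbhs_right_gt.
Unshelve. all: by end_near. Qed.

Lemma coreP w : V w <-> exists s t, 0 <= s < 1 /\ w = p s t.
Proof.
split; last by move=> [s [t [sI ->]]]; exact: V_inside.
move=> Vw; have [->|[s [t [s0 e]]]] := p_surj w.
  by exists 0, 0; rewrite pt_scale0 lexx ltr01.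
exists s, t; split => //; rewrite ltW//= ltNge; apply/negP; rewrite le_eqVlt => /predU1P[s1|s1].
  by apply: (V_not_frontier Vw); apply/fV; exists t; rewrite e s1.
by apply: (@V_outside s t) => //; rewrite -e.
Qed.

(** Continuity on the closure of the fluid becomes ordinary continuity in the
    pair (scale, parameter), with the scale cut off at 1. *)
Lemma within_scaled (T : topologicalType) (F : R * R -> T) :
  {within closure (fluid_domain V), continuous F} ->
  continuous (fun q : R * R => F (p (Num.max 1 q.1) q.2)).
Proof.
move=> /subspace_continuousP cF q.
pose P (q : R * R) := p (Num.max 1 q.1) q.2.
have inP q' : closure (fluid_domain V) (P q').
  by apply/closure_fluidP; exists (Num.max 1 q'.1), q'.2; rewrite le_max lexx.
have cP : {for q, continuous P}.
  apply: contC_ofC; apply: contCD; first exact: contC_cst.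
  apply: contCM.
    apply: contC_real; apply: continuous_max; first exact: cvg_cst.
    exact: cont_fst.
  by apply: (@contC_comp _ _ _ (snd : R * R -> R) Z); [exact: cont_snd|exact: (nc_ccont nc)].
have hP : P x @[x --> q] --> within (closure (fluid_domain V)) (nbhs (P q)).
  move=> B nB; have hB : nbhs q (P @^-1` [set y | closure (fluid_domain V) y -> B y]) by exact: cP.
  suff : nbhs q (P @^-1` B) by [].
  by apply: filterS hB => q' h'; exact: (h' (inP q')).
exact: (cvg_comp P F hP (cF (P q) (inP q))).
Qed.
End Core.
End Topology.

(** * The enclosed area *)

Section Plane.
Context {R : realType}.
Local Notation mu := (@lebesgue_measure R).
Definition plane_measurableType : measurableType _ := (measurableTypeR R * measurableTypeR R)%type.
(** Measurability for the product sigma-algebra, the one on which the area is a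
    measure. *)
Definition measurable_plane (A : set (R * R)) : Prop := @measurable _ plane_measurableType A.

(** An open set is a countable union of boxes with rational centres and radii. *)
Lemma open_measurable_plane (U : set (R * R)) : open U -> measurable_plane U.
Proof.
move=> oU.
pose box (q : rat * rat * rat) : set (R * R) :=
  ball (ratr q.1.1 : R) (ratr q.2) `*` ball (ratr q.1.2 : R) (ratr q.2).
have UE : U = \bigcup_(q in [set q | box q `<=` U]) box q.
  apply/seteqP; split; last by move=> x [q /= h /h].
  move=> [x y] Uxy; have : nbhs (x, y) U by exact: open_nbhs_nbhs.
  move=> /nbhs_ballP[r /= r0 hr].
  have [c] := rat_in_itvoo (divr_gt0 r0 (@ltr0n R 2)).
  rewrite in_itv/= => /andP[c0 cr].
  have [a] : exists a : rat, ratr a \in `]x - ratr c, x + ratr c[.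
    have h : x - ratr c < x + ratr c by lra.
    by have [a ha] := rat_in_itvoo h; exists a.
  rewrite in_itv/= => /andP[a1 a2].
  have [b] : exists b : rat, ratr b \in `]y - ratr c, y + ratr c[.
    have h : y - ratr c < y + ratr c by lra.
    by have [b hb] := rat_in_itvoo h; exists b.
  rewrite in_itv/= => /andP[b1 b2].
  exists (a, b, c) => /=.
    move=> [u v] [] /=; rewrite /ball /= => hu hv; apply: hr.
    move: hu hv; rewrite !ltr_norml => /andP[? ?] /andP[? ?].
    by split; rewrite /ball /= ltr_norml; apply/andP; split => /=; lra.
  by split; rewrite /ball /= ltr_norml; apply/andP; split; lra.
rewrite UE bigcup_mkcond; apply: countable_bigcupT_measurable => // q.
case: ifPn => // _; rewrite /box; apply: measurableX; exact: measurable_ball.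
Qed.

(** Tonelli in both orders, and invariance of the Lebesgue measure under
    negation. *)
Lemma area_rot (A : set (R * R)) : measurable_plane A ->
  area [set w | A (- w.2, w.1)] = area A.
Proof.
move=> mA; rewrite /area /product_measure1.
have := @indic_fubini_tonelli _ _ (measurableTypeR R) (measurableTypeR R) R mu mu A mA.
rewrite indic_fubini_tonelli_FE// indic_fubini_tonelli_GE// => ->.
apply: eq_integral => x _ /=.
rewrite -(@lebesgue_measureN R (ysection A x)); last exact: measurable_ysection.
by congr (mu _); apply/seteqP; split => y /=; rewrite /xsection /ysection /= !inE.
Qed.

Lemma measurable_rot (A : set (R * R)) : measurable_plane A -> measurable_plane [set w | A (- w.2, w.1)].
Proof.
move=> mA; have h : measurable_fun [set: plane_measurableType] (fun w : plane_measurableType => (- w.2, w.1) : plane_measurableType).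
  apply: measurable_fun_pair; last exact: measurable_fst.
  by apply: measurableT_comp => //; exact: measurable_snd.
by have := h measurableT A mA; rewrite setTI.
Qed.

(** A triangle with a vertex at the origin, described by the abscissa and the
    slope; thin sectors of a star-shaped region are squeezed between two of
    these. *)
Definition tri (c u1 u2 : R) : set (R * R) :=
  [set w | 0 < w.1 < c /\ u1 * w.1 <= w.2 < u2 * w.1].

Definition cone (u1 u2 : R) : set (R * R) :=
  [set w | 0 < w.1 /\ u1 * w.1 <= w.2 < u2 * w.1].

Lemma open_lin (a b c : R) : open [set w : R * R | a * w.1 + b * w.2 < c].
Proof.
have : open ((fun w : R * R => a * w.1 + b * w.2) @^-1` [set x | x < c]).
  apply: open_comp; last exact: open_lt.
  move=> w _; apply: cvgD.
    by apply: cvgM; [exact: cvg_cst|exact: cvg_fst].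
  by apply: cvgM; [exact: cvg_cst|exact: cvg_snd].
by [].
Qed.

Lemma measurable_cone u1 u2 : measurable_plane (cone u1 u2).
Proof.
have -> : cone u1 u2 = [set w | -1 * w.1 + 0 * w.2 < 0] `&`
   ((~` [set w | - u1 * w.1 + 1 * w.2 < 0]) `&` [set w | - u2 * w.1 + 1 * w.2 < 0]).
  apply/seteqP; split => -[x y] /=; rewrite /cone /=.
    by move=> [h /andP[h1 h2]]; split; [lra|split; [apply/negP; rewrite -leNgt; lra|lra]].
  by move=> [h [/negP h1 h2]]; rewrite -leNgt in h1; split; [lra|apply/andP; split; lra].
apply: measurableI; first exact: (open_measurable_plane (@open_lin (-1) 0 0)).
apply: measurableI; last exact: (open_measurable_plane (@open_lin (- u2) 1 0)).
by apply: measurableC; exact: (open_measurable_plane (@open_lin (- u1) 1 0)).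
Qed.

Lemma measurable_tri c u1 u2 : measurable_plane (tri c u1 u2).
Proof.
have -> : tri c u1 u2 = [set w | 1 * w.1 + 0 * w.2 < c] `&` cone u1 u2.
  apply/seteqP; split => -[x y] /=; rewrite /cone /tri /=.
    by move=> [/andP[h1 h2] h]; split; [lra|split].
  by move=> [h [h1 h2]]; split => //; apply/andP; split; lra.
apply: measurableI; last exact: measurable_cone.
exact: (open_measurable_plane (@open_lin 1 0 c)).
Qed.

Lemma area_tri c u1 u2 : 0 <= c -> u1 <= u2 ->
  area (tri c u1 u2) = (c ^+ 2 / 2 * (u2 - u1))%:E.
Proof.
rewrite le_eqVlt => /predU1P[<- _|c0 u12].
  have -> : tri 0 u1 u2 = set0.
    by apply/seteqP; split => -[x y] //= [/andP[? ?] _]; lra.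
  by rewrite expr0n /= mul0r mul0r /area measure0.
rewrite /area /product_measure1.
transitivity (\int[mu]_(x in ([set` `]0%R, c[] : set R)) (((u2 - u1) * x)%:E))%E.
  rewrite [RHS]integral_mkcond; apply: eq_integral => x _ /=; rewrite patchE.
  have -> : xsection (tri c u1 u2) x = if x \in [set` `]0, c[] then [set` `[u1 * x, u2 * x[] else set0.
    apply/seteqP; split => y; rewrite /xsection /= inE /=.
      move=> [h1 h2]; rewrite mem_set; last by rewrite /= in_itv.
      by rewrite /= in_itv.
    case: ifPn => //; rewrite inE /= in_itv/= => h1; rewrite in_itv/= => h2.
    by split.
  case: ifPn; last by rewrite measure0.
  rewrite inE /= in_itv/= => /andP[x0 xc].
  rewrite lebesgue_measure_itv/= lte_fin ltr_pM2r//; case: ltP => h.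
    by rewrite -EFinB; congr EFin; ring.
  have -> : u2 = u1 by apply/eqP; rewrite eq_le h.
  by rewrite subrr mul0r.
rewrite integral_itv_obnd_cbnd; last first.
  by apply/measurable_EFinP; apply: measurable_funM => //; exact: measurable_cst.
rewrite integral_itv_bndo_bndc; last first.
  by apply/measurable_EFinP; apply: measurable_funM => //; exact: measurable_cst.
pose F (x : R) := (u2 - u1) / 2 * (x * x).
have dF (x : R) : is_derive x 1 F ((u2 - u1) * x).
  have := is_deriveZ ((u2 - u1) / 2) (is_deriveM (is_derive_id x 1) (is_derive_id x 1)).
  move=> h; apply: (is_derive_eq h); rewrite /GRing.scale /=; by field.
have cF (x : R) : {for x, continuous F}.
  by have [d _] := dF x; exact/differentiable_continuous/derivable1_diffP.
rewrite (@continuous_FTC2 R (fun x => (u2 - u1) * x) F 0 c c0).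
- by rewrite -EFinB /F; congr EFin; field.
- apply: continuous_subspaceT => x; apply: cvgM; [exact: cvg_cst|exact: cvg_id].
- split; first by move=> x _; have [] := dF x.
  + by apply: cvg_at_right_filter; exact: cF.
  + by apply: cvg_at_left_filter; exact: cF.
- by move=> x _; rewrite derive1E; have [] := dF x.
Qed.
End Plane.

(** The properties of the curve and its interior used for sectors; unlike
    closeness to the standard circle, they are stable under rotation by a right
    angle. *)
Record star_curve {R : realType} (Z Z' : R -> R[i]) (V : set (R * R)) : Prop := StarCurve {
  sc_deriv : forall t, derC Z t (Z' t);
  sc_dhi : forall t, normc (Z' t) <= 2;
  sc_lo : forall t, 9 / 10 <= normc (Z t);
  sc_hi : forall t, normc (Z t) <= 11 / 10;
  sc_w : forall t, 1 / 2 <= Im (Z' t / Z t) <= 2;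
  sc_inj : forall s s' t t' : R, 0 < s -> 0 < s' -> s%:C * Z t = s'%:C * Z t' -> s = s';
  sc_open : open V;
  sc_V : forall w, V w <-> exists s t, 0 <= s < 1 /\ w = pt 0 Z s t
}.

Section Sector.
Context {R : realType}.
Local Notation C := R[i].

Definition sector (Z : R -> C) (a b : R) : set (R * R) :=
  [set w | exists s t, [/\ 0 < s < 1, a <= t < b & w = pt 0 Z s t]].

Section Right.
Variables (Z Z' : R -> C) (V : set (R * R)).
Hypothesis sc : star_curve Z Z' V.
Variables t1 t2 : R.
Hypothesis t12 : t1 < t2.
Hypothesis t2h : t2 <= t1 + 1 / 16.
Hypothesis X1h : 1 / 2 <= Re (Z t1).
Let h := t2 - t1.
Let X t := Re (Z t).
Let u t := Im (Z t) / Re (Z t).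
Let du t := nsq (Z t) * Im (Z' t / Z t) / X t ^+ 2.

Let h0 : 0 < h. Proof. by rewrite /h subr_gt0. Qed.

Let h1 : h <= 1 / 16. Proof. by move: t2h; rewrite /h; lra. Qed.

Let Xlip t : t1 <= t <= t2 -> `|X t - X t1| <= 2 * h.
Proof.
move=> /andP[a b].
have := @lipschitz_le _ X (fun t => Re (Z' t)) 2 (fun t => (sc_deriv sc t).1) (fun t => le_trans (normc_Re _) (sc_dhi sc t)) t t1.
move=> /le_trans; apply; rewrite ger0_norm ?subr_ge0// ler_pM2l// /h; lra.
Qed.

Let Xlo t : t1 <= t <= t2 -> 3 / 8 <= X t.
Proof. by move=> /Xlip; rewrite ler_norml => /andP[a _]; have := X1h; have := h1; rewrite /X in a *; lra. Qed.

Let Xhi t : X t <= 11 / 10.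
Proof. by apply: le_trans (sc_hi sc t); apply: le_trans (normc_Re _); exact: ler_norm. Qed.

Let dU t : t1 <= t <= t2 -> is_derive t 1 u (du t).
Proof.
move=> tI; have x0 := Xlo tI; have [d1 d2] := sc_deriv sc t.
have x1 : Re (Z t) != 0 by rewrite gt_eqF//; rewrite /X in x0; lra.
have := is_deriveM d2 (is_deriveV x1 d1).
move=> /is_derive_eqf; apply => //.
rewrite /du /X /GRing.scale /= !ReImE ReV ImV.
have z0 : Z t != 0 by apply/eqP => e; have := sc_lo sc t; rewrite e normc0; lra.
have := nsq_gt0 z0; rewrite /nsq; move: (Z t) (Z' t) x1 => [a b] [c d] /= a0 n0.
by field; rewrite a0 gt_eqF.
Qed.

Let du_bd t : t1 <= t <= t2 -> 0 < du t <= 20.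
Proof.
move=> tI; have x0 := Xlo tI; have /andP[w0 w1] := sc_w sc t.
have n0 : 0 < nsq (Z t) by rewrite -normc_sq; have := sc_lo sc t; nra.
have n1 : nsq (Z t) <= 121 / 100.
  by rewrite -normc_sq; have := sc_lo sc t; have := sc_hi sc t; nra.
have x2 : 0 < X t ^+ 2 by rewrite exprn_gt0//; lra.
rewrite /du; apply/andP; split.
  by rewrite divr_gt0// mulr_gt0//; lra.
rewrite ler_pdivrMr//.
have : nsq (Z t) * Im (Z' t / Z t) <= 121 / 50 by nra.
have : 9 / 64 <= X t ^+ 2 by nra.
by lra.
Qed.

Let u_mvt a b : t1 <= a -> a <= b -> b <= t2 -> exists2 c, a <= c <= b & u b - u a = du c * (b - a).
Proof.
move=> a1 ab b2.
have cg : {within `[a, b], continuous u}.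
  apply: derivable_within_continuous => s; rewrite in_itv/= => /andP[s1 s2].
  by have [] : is_derive s 1 u (du s) by apply: dU; apply/andP; split; lra.
have dg s : s \in `]a, b[%R -> is_derive s 1 u (du s).
  by rewrite in_itv/= => /andP[s1 s2]; apply: dU; apply/andP; split; lra.
have [c] := MVT_segment ab dg cg.
by rewrite in_itv/= => cI ->; exists c.
Qed.

Let u_inc a b : t1 <= a -> a < b -> b <= t2 -> u a < u b.
Proof.
move=> a1 ab b2; have [c /andP[c1 c2]] := u_mvt a1 (ltW ab) b2.
have /andP[d0 _] : 0 < du c <= 20 by apply: du_bd; apply/andP; split; lra.
have : 0 < du c * (b - a) by rewrite mulr_gt0// subr_gt0.
by lra.
Qed.

Let uE t : t1 <= t <= t2 -> Im (Z t) = u t * X t.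
Proof. by move=> /Xlo x0; rewrite /u divfK// gt_eqF//; rewrite /X in x0; lra. Qed.

Let p_coord s t : pt 0 Z s t = (s * Re (Z t), s * Im (Z t)).
Proof. by rewrite /pt /ofC !ReImE /=; congr (_, _); ring. Qed.

Let in_cone w : cone (u t1) (u t2) w -> exists s t, [/\ 0 < s, t1 <= t < t2, s = w.1 / X t & w = pt 0 Z s t].
Proof.
move=> [w0 /andP[a b]].
have v1 : u t1 <= w.2 / w.1 by rewrite ler_pdivlMr.
have v2 : w.2 / w.1 < u t2 by rewrite ltr_pdivrMr.
have cg : {within `[t1, t2], continuous u}.
  apply: derivable_within_continuous => s; rewrite in_itv/= => sI.
  by have [] : is_derive s 1 u (du s) by exact: dU.
have u12 : u t1 < u t2 by apply: u_inc.
have := @IVT _ u t1 t2 (w.2 / w.1) (ltW t12) cg.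
rewrite (min_idPl (ltW u12)) (max_idPr (ltW u12)) v1 (ltW v2) => /(_ isT)[t].
rewrite in_itv/= => tI ut.
have x0 := Xlo tI.
exists (w.1 / X t), t; split => //.
- by rewrite divr_gt0//; lra.
- case/andP: tI => -> /=; rewrite le_eqVlt => /predU1P[e|//].
  by move: v2; rewrite -ut e ltxx.
- rewrite p_coord uE// ut; case: w w0 {a b v1 v2 ut} => x y /= w0.
  have xn : Re (Z t) != 0 by rewrite gt_eqF//; rewrite /X in x0; lra.
  by rewrite /X; congr (_, _); field; rewrite xn// gt_eqF.
Qed.

Let u_range t : t1 <= t < t2 -> u t1 <= u t < u t2.
Proof.
move=> /andP[a b]; rewrite u_inc// andbT.
by move: a; rewrite le_eqVlt => /predU1P[->//|a]; apply/ltW/u_inc => //; exact: ltW.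
Qed.

Let sector_cone s t : 0 < s -> t1 <= t < t2 -> cone (u t1) (u t2) (pt 0 Z s t).
Proof.
move=> s0 tI; have tI' : t1 <= t <= t2 by case/andP: tI => -> /ltW ->.
have x0 : 0 < X t by have := Xlo tI'; lra.
have /andP[a b] := u_range tI.
rewrite p_coord /cone /=; have -> : Re (Z t) = X t by [].
rewrite uE// (mulrCA s); have sx : 0 < s * X t by rewrite mulr_gt0.
by split => //; rewrite ler_pM2r// ltr_pM2r// a b.
Qed.

Lemma sector_right_E : sector Z t1 t2 = cone (u t1) (u t2) `&` V.
Proof.
apply/seteqP; split => w.
  move=> [s [t [/andP[s0 s1] tI ->]]]; split; first exact: sector_cone.
  by apply/(sc_V sc); exists s, t; rewrite ltW.
move=> [cw Vw]; have [s [t [s0 tI sE wE]]] := in_cone cw.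
exists s, t; split => //; rewrite s0 /=.
have [s' [t' [/andP[s0' s1'] wE']]] := (sc_V sc w).1 Vw.
have s'0 : 0 < s'.
  rewrite lt_neqAle s0' andbT eq_sym; apply/eqP => e; move: cw => [].
  by rewrite wE' e p_coord /= mul0r ltxx.
have : pt 0 Z s t = pt 0 Z s' t' by rewrite -wE.
by move=> /(congr1 (@toC R)); rewrite !toC_p => /(sc_inj sc s0 s'0) ->.
Qed.

Let tri_lo : tri (X t1 - 2 * h) (u t1) (u t2) `<=` sector Z t1 t2.
Proof.
move=> w [/andP[w0 w1] wu]; have cw : cone (u t1) (u t2) w by [].
have [s [t [s0 tI sE wE]]] := in_cone cw; exists s, t; split => //; rewrite s0 sE /=.
have tI' : t1 <= t <= t2 by case/andP: tI => -> /ltW ->.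
have x0 : 0 < X t by have := Xlo tI'; lra.
rewrite ltr_pdivrMr// mul1r; have := Xlip tI'; rewrite ler_norml => /andP[+ _]; lra.
Qed.

Let tri_hi : sector Z t1 t2 `<=` tri (X t1 + 2 * h) (u t1) (u t2).
Proof.
move=> w [s [t [/andP[s0 s1] tI ->]]].
have [a b] := sector_cone s0 tI; split => //; rewrite a p_coord /=.
have tI' : t1 <= t <= t2 by case/andP: tI => -> /ltW ->.
have x0 : 0 < X t by have := Xlo tI'; lra.
have : s * X t < X t by nra.
by rewrite /X in x0 *; have := Xlip tI'; rewrite /X ler_norml => /andP[_ +]; lra.
Qed.

(** In the right half-plane the slope is an increasing function of t along the
    curve.  The sector lies between the triangles of abscissas X(t1) - 2h and
    X(t1) + 2h, whose areas differ by O(h^2), and the increment of Phi differs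
    from X(t1)^2 / 2 times that of the slope by O(h^2). *)
Lemma sector_right (Phi : R -> R) :
  (forall t : R, t1 <= t <= t2 -> is_derive t 1 Phi (nsq (Z t) * Im (Z' t / Z t) / 2)) ->
  measurable_plane (sector Z t1 t2) /\ exists r, area (sector Z t1 t2) = r%:E /\
    `|r - (Phi t2 - Phi t1)| <= 100 * (t2 - t1) ^+ 2.
Proof.
move=> dPhi.
have mS : measurable_plane (sector Z t1 t2).
  rewrite sector_right_E; apply: measurableI; first exact: measurable_cone.
  exact: (open_measurable_plane (sc_open sc)).
split => //.
have hh0 := h0; have hh1 := h1; have X1' : 1 / 2 <= X t1 := X1h; have Xh := Xhi t1.
have Du0 : u t1 < u t2 by apply: u_inc.
have [c cI Du] := u_mvt (lexx t1) (ltW t12) (lexx t2).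
have /andP[dc0 dc1] := du_bd cI.
have Du1 : u t2 - u t1 <= 20 * h by rewrite Du -/h ler_pM2r.
have lo0 : 0 <= X t1 - 2 * h by lra.
have hi0 : 0 <= X t1 + 2 * h by lra.
have alo := area_tri lo0 (ltW Du0); have ahi := area_tri hi0 (ltW Du0).
have le1 : (area (tri (X t1 - 2 * h) (u t1) (u t2)) <= area (sector Z t1 t2))%E.
  by apply: le_measure; rewrite ?inE //; exact: measurable_tri.
have le2 : (area (sector Z t1 t2) <= area (tri (X t1 + 2 * h) (u t1) (u t2)))%E.
  by apply: le_measure; rewrite ?inE //; exact: measurable_tri.
rewrite alo in le1; rewrite ahi in le2.
have [r rE] : exists r, area (sector Z t1 t2) = r%:E.
  by move: le1 le2; case: (area _) => [r _ _|//|//]; exists r.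
exists r; split => //; move: le1 le2; rewrite rE !lee_fin => le1 le2.
(* the error made by freezing the abscissa at its initial value *)
pose Psi t := Phi t - X t1 ^+ 2 / 2 * u t.
pose dPsi t := nsq (Z t) * Im (Z' t / Z t) / 2 - X t1 ^+ 2 / 2 * du t.
have dPs t : t1 <= t <= t2 -> is_derive t 1 Psi (dPsi t).
  move=> tI; have := is_deriveB (dPhi t tI) (is_deriveZ (X t1 ^+ 2 / 2) (dU tI)).
  by move=> /is_derive_eqf; apply.
have cP : {within `[t1, t2], continuous Psi}.
  apply: derivable_within_continuous => s; rewrite in_itv/= => sI.
  by have [] : is_derive s 1 Psi (dPsi s) by exact: dPs.
have dP s : s \in `]t1, t2[%R -> is_derive s 1 Psi (dPsi s).
  by rewrite in_itv/= => /andP[s1 s2]; apply: dPs; apply/andP; split; lra.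
have [d dI DPsi] := MVT_segment (ltW t12) dP cP.
have {dI} dI : t1 <= d <= t2 by move: dI; rewrite in_itv.
have dPsi_bd : `|dPsi d| <= 44 * h.
  have x0 := Xlo dI; have /andP[e0 e1] := du_bd dI.
  have -> : dPsi d = du d / 2 * (X d ^+ 2 - X t1 ^+ 2).
    by rewrite /dPsi /du; field; rewrite gt_eqF//; lra.
  rewrite normrM (ger0_norm (ltW (divr_gt0 e0 (@ltr0n R 2)))) subr_sqr normrM.
  have := Xlip dI; have x1 := Xhi d.
  rewrite (@ger0_norm _ (X d + X t1)); last by lra.
  move=> k; have : `|X d - X t1| * (X d + X t1) <= 2 * h * (11 / 5).
    by apply: ler_pM => //; lra.
  have : 0 <= `|X d - X t1| * (X d + X t1) by rewrite mulr_ge0//; lra.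
  by move: (`|X d - X t1| * _) => q q0 q1; nra.
have DP : `|Psi t2 - Psi t1| <= 44 * h * h.
  by rewrite DPsi normrM -/h (ger0_norm (ltW h0)) ler_pM2r.
have e : r - (Phi t2 - Phi t1) = (r - X t1 ^+ 2 / 2 * (u t2 - u t1)) - (Psi t2 - Psi t1).
  by rewrite /Psi; ring.
have r1 : `|r - X t1 ^+ 2 / 2 * (u t2 - u t1)| <= 50 * h * h.
  have D0 : 0 < u t2 - u t1 by rewrite subr_gt0.
  move: (u t2 - u t1) D0 Du1 le1 le2 => D D0 D1 le1 le2.
  have b1 : (X t1 + 2 * h) ^+ 2 / 2 - X t1 ^+ 2 / 2 <= 5 / 2 * h by nra.
  have b2 : X t1 ^+ 2 / 2 - (X t1 - 2 * h) ^+ 2 / 2 <= 5 / 2 * h by nra.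
  rewrite ler_norml; apply/andP; split; nra.
rewrite e; apply: le_trans (ler_normB _ _) _; rewrite -/h; nra.
Qed.
End Right.
End Sector.

Section Rotation.
Context {R : realType}.
Local Notation C := R[i].
Implicit Types (Z : R -> C) (V : set (R * R)).

Definition rotV V : set (R * R) := [set w | V (w.2, - w.1)].

Lemma pt_rot Z s t : pt 0 (fun t => 'i * Z t) s t = (- (pt 0 Z s t).2, (pt 0 Z s t).1).
Proof. by rewrite /pt /ofC !ReImE /=; congr (_, _); ring. Qed.

Lemma normc_i : normc ('i : C) = 1.
Proof. by rewrite /= expr0n expr1n add0r sqrtr1. Qed.

Lemma i_neq0 : 'i != 0 :> C.
Proof. by rewrite eq_complex /= negb_and oner_eq0 orbT. Qed.

Lemma star_rot Z Z' V : star_curve Z Z' V ->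
  star_curve (fun t => 'i * Z t) (fun t => 'i * Z' t) (rotV V).
Proof.
move=> sc; split.
- move=> t; have := derCM (derC_cst 'i t) (sc_deriv sc t).
  by rewrite mul0r add0r.
- by move=> t; rewrite normcM normc_i mul1r; exact: (sc_dhi sc).
- by move=> t; rewrite normcM normc_i mul1r; exact: (sc_lo sc).
- by move=> t; rewrite normcM normc_i mul1r; exact: (sc_hi sc).
- by move=> t; rewrite -mulf_div divff ?i_neq0// [1 * (Z' t / Z t)]mul1r; exact: (sc_w sc).
- move=> s s' t t' s0 s0'; rewrite !(mulrCA _ 'i) => /(mulfI i_neq0); exact: (sc_inj sc).
- apply: open_comp; last exact: (sc_open sc).
  move=> w _; apply: continuous_at_pair; first exact: cont_snd.
  by apply: cvgN; exact: cont_fst.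
- move=> w; rewrite /rotV /=; split.
    move=> /(sc_V sc)[s [t [sI e]]]; exists s, t; split => //.
    by rewrite pt_rot -e /= opprK; case: (w).
  move=> [s [t [sI ->]]]; apply/(sc_V sc); exists s, t; split => //.
  by rewrite pt_rot; case: (pt 0 Z s t) => a b /=; rewrite opprK.
Qed.

Lemma sector_rot Z a b : sector Z a b = [set w | sector (fun t => 'i * Z t) a b (- w.2, w.1)].
Proof.
apply/seteqP; split => w /=.
  by move=> [s [t [sI tI ->]]]; exists s, t; split => //; rewrite pt_rot.
move=> [s [t [sI tI e]]]; exists s, t; split => //.
move: e; rewrite pt_rot; case: (pt 0 Z s t) => a' b'; case: w => x y /= [e1 e2].
by rewrite e2 (oppr_inj e1).
Qed.

Definition sector_area Z Z' (t1 t2 : R) := forall Phi : R -> R,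
  (forall t : R, t1 <= t <= t2 -> is_derive t 1 Phi (nsq (Z t) * Im (Z' t / Z t) / 2)) ->
  measurable_plane (sector Z t1 t2) /\ exists r, area (sector Z t1 t2) = r%:E /\
    `|r - (Phi t2 - Phi t1)| <= 100 * (t2 - t1) ^+ 2.

Lemma sector_area_rot Z Z' t1 t2 :
  sector_area (fun t => 'i * Z t) (fun t => 'i * Z' t) t1 t2 -> sector_area Z Z' t1 t2.
Proof.
move=> H Phi dPhi; have [|mS [r [rE rb]]] := H Phi.
  move=> t tI; have := dPhi t tI.
  rewrite -mulf_div divff ?i_neq0// mul1r.
  have -> : nsq ('i * Z t) = nsq (Z t) by rewrite /nsq !ReImE /=; ring.
  by [].
rewrite sector_rot; split; first exact: measurable_rot.
by exists r; rewrite area_rot.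
Qed.

(** One of the four right-angle rotations brings the starting point into the
    half-plane where [sector_right] applies. *)
Lemma sector_area_any Z Z' V t1 t2 : star_curve Z Z' V -> t1 < t2 -> t2 <= t1 + 1 / 16 ->
  sector_area Z Z' t1 t2.
Proof.
move=> sc t12 t2h.
have sc1 := star_rot sc; have sc2 := star_rot sc1; have sc3 := star_rot sc2.
have [h|h] := leP (1 / 2) (Re (Z t1)); first exact: (sector_right sc t12 t2h h).
have [h'|h'] := leP (1 / 2) (- Im (Z t1)).
  apply: sector_area_rot; apply: (sector_right sc1 t12 t2h).
  by rewrite !ReImE /=; lra.
have [h2|h2] := leP (1 / 2) (- Re (Z t1)).
  do 2! apply: sector_area_rot; apply: (sector_right sc2 t12 t2h).
  by rewrite !ReImE /=; lra.
do 3! apply: sector_area_rot; apply: (sector_right sc3 t12 t2h).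
have -> : Re ('i * ('i * ('i * Z t1))) = Im (Z t1) by rewrite !ReImE /=; ring.
have := sc_lo sc t1; have := normc_sq (Z t1); rewrite /nsq.
move: (Re (Z t1)) (Im (Z t1)) (normc (Z t1)) h h' h2 => a b n ha hb hc e n0.
have a4 : a ^+ 2 <= 1 / 4 by nra.
have b4 : 1 / 4 < b ^+ 2 by nra.
by rewrite leNgt; apply/negP => h; nra.
Qed.
End Rotation.

Lemma areaU {R : realType} (A B : set (R * R)) : measurable_plane A -> measurable_plane B -> A `&` B = set0 ->
  area (A `|` B) = (area A + area B)%E.
Proof. by move=> mA mB d; apply: measureU. Qed.

Section TotalArea.
Context {R : realType}.
Local Notation C := R[i].
Variables (eta : R) (Z Z' : R -> C).
Hypothesis nc : near_circle eta Z Z'.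
Variable V : set (R * R).
Hypothesis oV : open V.
Hypothesis VE : forall w, V w <-> exists s t, 0 <= s < 1 /\ w = pt 0 Z s t.
Let gc := nc_gauge nc.

Lemma nc_star : star_curve Z Z' V.
Proof.
have h0 := eta0 nc; have h1 := eta1 nc.
split => //.
- exact: (nc_deriv nc).
- exact: (gc_dhi gc).
- by move=> t; have := nc_lo nc t; lra.
- by move=> t; have := nc_hi nc t; lra.
- by move=> t; have := wt_near nc t; rewrite /wt ler_norml => /andP[a b]; apply/andP; split; lra.
- exact: (gc_inj gc).
Qed.

Lemma nc_inj_t (s s' t t' : R) : 0 < s -> 0 < s' -> 0 <= t < 2 * pi -> 0 <= t' < 2 * pi ->
  s%:C * Z t = s'%:C * Z t' -> t = t'.
Proof.
move=> s0 s0'; wlog tt : s s' t t' s0 s0' / t <= t'.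
  by move=> H I I' e; case: (leP t t') => [|/ltW] h; [exact: (H s s')|apply/esym; exact: (H s' s)].
move=> /andP[a1 a2] /andP[b1 b2].
rewrite {1}(theta_polar nc t) {1}(theta_polar nc t') !mulrA -!rmorphM /= => e.
have n1 := normc_gt0 (nc_neq0 nc t); have n2 := normc_gt0 (nc_neq0 nc t').
have [_ e2] := polar_inj (mulr_gt0 s0 n1) (mulr_gt0 s0' n2) e.
have low x y := @derive_lower _ (theta Z) (wt Z Z') (1 / 2) (theta_derive nc) (wt_lo nc) x y.
have th1 := low t' t tt.
have tt' : t' <= t + 2 * pi by lra.
have th2 := low (t + 2 * pi) t' tt'; rewrite (theta_per nc) in th2.
have : theta Z t = theta Z t' by apply: cis_inj => //; apply/andP; split; lra.
by lra.
Qed.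

Let k t := nsq (Z t) * wt Z Z' t / 2.
Let ck : continuous k.
Proof.
move=> t; apply: cvgM; last exact: cvg_cst.
by apply: cvgM; [exact: (nsqZ_cont nc)|exact: (wt_cont nc)].
Qed.

(** The base point -1 makes this antiderivative differentiable at 0 as well. *)
Let Phi (x : R) := \int[lebesgue_measure]_(t in [set` `[-1, x]]) k t.
Let dPhi (x : R) : -1 < x -> is_derive x 1 Phi (k x).
Proof.
move=> x1.
have [||d e] := @continuous_FTC1_closed R k (-1) x (x + 1) _ _ x1 (@ck x).
- by rewrite ltrDl.
- apply: continuous_compact_integrable; first exact: segment_compact.
  by apply: continuous_subspaceT; exact: ck.
by apply: DeriveDef; [exact: d|rewrite -derive1E; exact: e].
Qed.

(** Consecutive thin sectors: the quadratic errors add up to a multiple of the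
    step. *)
Lemma sector_sum (h : R) : 0 < h -> h <= 1 / 16 -> forall n : nat, n%:R * h <= 2 * pi ->
  measurable_plane (sector Z 0 (n%:R * h)) /\ exists r, area (sector Z 0 (n%:R * h)) = r%:E /\
    `|r - (Phi (n%:R * h) - Phi 0)| <= n%:R * (100 * h ^+ 2).
Proof.
move=> h0 h1; elim => [_|n IH nh].
  have -> : sector Z 0 (0%:R * h) = set0.
    by apply/seteqP; split => w //= -[s [t [_ + _]]]; rewrite mul0r; lra.
  split; first exact: measurable0.
  by exists 0; rewrite /area measure0 !mul0r !subrr normr0.
have nh0 : 0 <= n%:R * h by rewrite mulr_ge0// ltW.
have nhS : n.+1%:R * h = n%:R * h + h by rewrite -natr1 mulrDl mul1r.
have [|m1 [r1 [e1 b1]]] := IH; first by rewrite nhS in nh; lra.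
have [|||m2 [r2 [e2 b2]]] := @sector_area_any _ _ _ V (n%:R * h) (n.+1%:R * h) nc_star _ _ Phi.
- by rewrite nhS ltrDl.
- by rewrite nhS lerD2l.
- by move=> t /andP[t0 _]; apply: dPhi; lra.
have U : sector Z 0 (n.+1%:R * h) = sector Z 0 (n%:R * h) `|` sector Z (n%:R * h) (n.+1%:R * h).
  apply/seteqP; split => w.
    move=> [s [t [sI /andP[t0 t1] e]]]; have [tn|tn] := ltP t (n%:R * h).
      by left; exists s, t; rewrite t0.
    by right; exists s, t; rewrite tn.
  move=> [[s [t [sI /andP[t0 t1] e]]]|[s [t [sI /andP[t0 t1] e]]]]; exists s, t; split => //; apply/andP; split; lra.
have dis : sector Z 0 (n%:R * h) `&` sector Z (n%:R * h) (n.+1%:R * h) = set0.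
  rewrite -subset0 => w [[s [t [/andP[s0 s1] /andP[t0 t1] e]]] [s' [t' [/andP[s0' s1'] /andP[t0' t1'] e']]]].
  have : t = t'.
    apply: (@nc_inj_t s s') => //; try by apply/andP; split; lra.
    by rewrite -!(toC_p Z) -e -e'.
  by lra.
rewrite U; split; first exact: measurableU.
exists (r1 + r2); split.
  by rewrite (areaU m1 m2 dis) e1 e2.
have -> : r1 + r2 - (Phi (n.+1%:R * h) - Phi 0) =
  (r1 - (Phi (n%:R * h) - Phi 0)) + (r2 - (Phi (n.+1%:R * h) - Phi (n%:R * h))) by ring.
apply: le_trans (ler_normD _ _) _.
move: b2; rewrite nhS addrAC subrr add0r => b2.
by rewrite -[leRHS]/(n.+1%:R * _) -natr1 mulrDl mul1r; apply: lerD.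
Qed.

(** Green-type formula for the area: cut the region into n sectors and let n
    tend to infinity. *)
Lemma area_contour : area V = (oint (fun t => nsq (Z t) * wt Z Z' t / 2))%:E.
Proof.
have p0 := @pi2_gt0 R.
have -> : oint (fun t => nsq (Z t) * wt Z Z' t / 2) = Phi (2 * pi) - Phi 0.
  by apply: oint_deriv_loc => // t /andP[t0 _]; apply: dPhi; lra.
have VU : V = [set 0] `|` sector Z 0 (2 * pi).
  apply/seteqP; split => w.
    move=> /VE[s [t [/andP[s0 s1] ->]]]; move: s0; rewrite le_eqVlt => /predU1P[<-|s0].
      by left; rewrite /pt mul0r add0r.
    right; have [t' tI H] := reduce_mod_2pi 0 t; exists s, t'; rewrite s0 s1 /=; split => //.
      by rewrite -[X in _ < X](add0r (2 * pi)).
    by rewrite /pt (H _ Z (nc_per nc)).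
  move=> [->|[s [t [/andP[s0 s1] _ ->]]]]; apply/VE.
    by exists 0, 0; rewrite lexx ltr01; split => //; rewrite /pt mul0r add0r.
  by exists s, t; rewrite s1 ltW.
have secN N : (2 * pi * 16 <= N%:R :> R) -> measurable_plane (sector Z 0 (2 * pi)) /\ exists r,
   area (sector Z 0 (2 * pi)) = r%:E /\ `|r - (Phi (2 * pi) - Phi 0)| <= 400 * pi ^+ 2 / N%:R.
  move=> hN; have N0 : 0 < N%:R :> R by lra.
  have h0 : 0 < 2 * pi / N%:R :> R by rewrite divr_gt0.
  have Nh : N%:R * (2 * pi / N%:R) = 2 * pi :> R by rewrite mulrC divfK// gt_eqF.
  have [||m [r [e b]]] := sector_sum h0 _ (n := N).
  - by rewrite ler_pdivrMr//; lra.
  - by rewrite Nh.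
  rewrite Nh in m e b; split => //; exists r; split => //; apply: le_trans b _.
  by rewrite le_eqVlt; apply/orP; left; apply/eqP; field; rewrite gt_eqF.
pose N0 := Num.bound (2 * pi * 16 : R).
have hN0 : 2 * pi * 16 <= N0%:R :> R.
  by apply/ltW/Num.Theory.archi_boundP; lra.
have [mS [r [rE _]]] := secN N0 hN0.
have rPhi : r = Phi (2 * pi) - Phi 0.
  apply/eqP; rewrite -subr_eq0 -normr_le0 leNgt; apply/negP => d0.
  set d := `|_| in d0.
  pose N := Num.bound (Num.max (2 * pi * 16) (400 * pi ^+ 2 / d) : R).
  have hN : Num.max (2 * pi * 16) (400 * pi ^+ 2 / d) < N%:R.
    by apply: Num.Theory.archi_boundP; rewrite le_max; apply/orP; left; lra.
  move: hN; rewrite gt_max => /andP[hN1 hN2].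
  have [_ [r' [r'E b]]] := secN N (ltW hN1).
  have rr : r' = r by move: r'E; rewrite rE => -[].
  move: b; rewrite rr -/d; apply/negP; rewrite -ltNge.
  have Np : 0 < N%:R :> R by lra.
  by rewrite ltr_pdivrMr//; move: hN2; rewrite ltr_pdivrMr// [N%:R * d]mulrC.
have m0 : measurable_plane [set (0 : R * R)].
  have -> : [set (0 : R * R)] = [set (0:R)] `*` [set (0:R)].
    by apply/seteqP; split => [w ->|[x y] [/= -> ->]].
  by apply: measurableX; exact: measurable_set1.
have a0 : area [set (0 : R * R)] = 0%E.
  have -> : [set (0 : R * R)] = [set (0:R)] `*` [set (0:R)].
    by apply/seteqP; split => [w ->|[x y] [/= -> ->]].
  have e1 : (@lebesgue_measure R) [set (0 : R)] = 0%E by exact: lebesgue_measure_set1.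
  have ms : measurable ([set (0 : R)] : set (measurableTypeR R)) by exact: measurable_set1.
  apply: etrans (@product_measure1E _ _ _ _ R (@lebesgue_measure R) (@lebesgue_measure R) _ _ ms ms) _.
  exact: (etrans (congr1 (fun z => z * z)%E e1) (mul0e 0)).
have dis : [set (0 : R * R)] `&` sector Z 0 (2 * pi) = set0.
  rewrite -subset0 => w [-> [s [t [/andP[s0 _] _ e]]]].
  by apply: (p_neq0 nc (t := t) s0); rewrite -e.
rewrite VU.
by rewrite (areaU m0 mS dis) a0 rE add0e rPhi.
Qed.
End TotalArea.

(** * The final inequality *)

Section Alg.
Variable R : realFieldType.
Implicit Types (p s k Y b d delta w : R).

(** Substituting s = Y (p^2 - 1) makes (p - 1)^2 a common factor; the cofactor J
    is at least 1/8 because s <= 1/64 and Y <= 1/64 bound Y p^2, and k^2 <= Y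
    bounds k (p + 1). *)
Lemma integrand_bound_small p s k Y : 0 <= p -> 0 <= Y <= 1 / 64 -> s = Y * (p ^+ 2 - 1) -> s <= 1 / 64 -> k ^+ 2 <= Y ->
  (1 / 8) * (p - 1) ^+ 2 <= (p - 1) ^+ 2 * (p + 1 / 2) - k * (p ^+ 2 - 1) ^+ 2
    + p ^+ 3 * (s / 2 - s ^+ 2 / 2) - s / 2.
Proof.
move=> p0 /andP[Y0 Y1] sE s1 kY.
pose J := p + 1 / 2 + Y / 2 * (p + 1) * (p ^+ 2 + p + 1) - Y ^+ 2 / 2 * (p + 1) ^+ 2 * p ^+ 3 - k * (p + 1) ^+ 2.
have e : (p - 1) ^+ 2 * (p + 1 / 2) - k * (p ^+ 2 - 1) ^+ 2 + p ^+ 3 * (s / 2 - s ^+ 2 / 2) - s / 2 = (p - 1) ^+ 2 * J.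
  by rewrite sE /J; ring.
rewrite e mulrC ler_wpM2l ?sqr_ge0//.
have Yp : Y * p ^+ 2 <= 1 / 32 by lra.
have Yp0 : 0 <= Y * p ^+ 2 by rewrite mulr_ge0 ?sqr_ge0.
have A1 : Y * (p + 1) ^+ 2 <= 3 / 32.
  have h : (p + 1) ^+ 2 <= 2 * p ^+ 2 + 2 by have := sqr_ge0 (p - 1); lra.
  have := ler_wpM2l Y0 h; lra.
have A0 : 0 <= Y * (p + 1) ^+ 2 by rewrite mulr_ge0 ?sqr_ge0.
have kp : k * (p + 1) <= 1 / 3.
  rewrite leNgt; apply/negP => h.
  have : 1 / 9 < (k * (p + 1)) ^+ 2 by nra.
  have : (k * (p + 1)) ^+ 2 <= Y * (p + 1) ^+ 2 by rewrite exprMn ler_wpM2r ?sqr_ge0.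
  by lra.
have k1 : k * (p + 1) ^+ 2 <= (p + 1) / 3.
  by rewrite expr2 mulrA mulrC; nra.
have k2 : Y ^+ 2 / 2 * (p + 1) ^+ 2 * p ^+ 3 <= p / 100.
  have -> : Y ^+ 2 / 2 * (p + 1) ^+ 2 * p ^+ 3 = p * ((Y * (p + 1) ^+ 2) * (Y * p ^+ 2) / 2) by ring.
  have : (Y * (p + 1) ^+ 2) * (Y * p ^+ 2) <= (3 / 32) * (1 / 32) by apply: ler_pM.
  by move: (_ * _ * (_ * _)) => x hx; nra.
have k3 : 0 <= Y / 2 * (p + 1) * (p ^+ 2 + p + 1).
  by rewrite !mulr_ge0 ?divr_ge0//; nra.
by rewrite /J; lra.
Qed.

(** The same factorisation; at p = 1 and b = 0 the cofactor is 2 (1 + Y - 2 k)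
    >= 2 d, and the condition on b absorbs the variation of J over |p^2 - 1| <=
    b. *)
Lemma integrand_bound_close p s k Y Ym b d : 0 <= p -> 0 < Y <= Ym -> s = Y * (p ^+ 2 - 1) -> k ^+ 2 <= Y ->
  0 < b <= 1 / 2 -> `|p ^+ 2 - 1| <= b -> d <= 1 + Y - 2 * k -> b * (4 + 7 * Ym + 18 * Ym ^+ 2) <= d ->
  d * (p - 1) ^+ 2 <= (p - 1) ^+ 2 * (p + (2 - b) / 2) - k * (p ^+ 2 - 1) ^+ 2
    + (p ^+ 3 - (1 - b) * p) * (s / 2 - s ^+ 2 / 2) - b * s / 2.
Proof.
move=> p0 /andP[Y0 Y1] sE kY /andP[b0 b1] pb D bd.
pose J := p + (2 - b) / 2 + Y / 2 * (p + 1) * (p ^+ 2 + p + b)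
  - Y ^+ 2 / 2 * (p + 1) ^+ 2 * p * (p ^+ 2 - (1 - b)) - k * (p + 1) ^+ 2.
have e : (p - 1) ^+ 2 * (p + (2 - b) / 2) - k * (p ^+ 2 - 1) ^+ 2
    + (p ^+ 3 - (1 - b) * p) * (s / 2 - s ^+ 2 / 2) - b * s / 2 = (p - 1) ^+ 2 * J.
  by rewrite sE /J; field.
rewrite e mulrC ler_wpM2l ?sqr_ge0//.
move: pb; rewrite ler_norml => /andP[pb1 pb2].
have p1 : 1 - b <= p by nra.
have p2 : p <= 1 + b by nra.
have q1 : 4 - 5 * b <= (p + 1) ^+ 2 by nra.
have q2 : (p + 1) ^+ 2 <= 4 + 5 * b by nra.
have k5 : - k * (p + 1) ^+ 2 >= - (4 * k) - 5 * b * ((1 + Y) / 2).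
  have hk : k ^+ 2 <= ((1 + Y) / 2) ^+ 2 by have := sqr_ge0 (1 - Y); lra.
  have Y3 : 0 <= (1 + Y) / 2 by lra.
  have : `|k| <= (1 + Y) / 2.
    by rewrite -(@ler_pXn2r _ 2)// ?nnegrE ?normr_ge0// real_normK// num_real.
  rewrite ler_norml => /andP[h2 h1].
  have [k0|k0] := leP 0 k.
    have := ler_wpM2l k0 q2; have := ler_wpM2l (ltW b0) h1; lra.
  have nk0 : 0 <= - k by lra.
  have h3 : - k <= (1 + Y) / 2 by lra.
  have := ler_wpM2l nk0 q1; have := ler_wpM2l (ltW b0) h3; lra.
have t1 : Y / 2 * (p + 1) * (p ^+ 2 + p + b) >= Y * (2 - 9 / 2 * b).
  have : 4 - 9 * b <= (p + 1) * (p ^+ 2 + p + b).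
    have : p * (p + 1) <= p ^+ 2 + p + b by nra.
    have : (1 - b) * (4 - 5 * b) <= p * (p + 1) ^+ 2 by apply: ler_pM => //; lra.
    by nra.
  by nra.
have t2 : Y ^+ 2 / 2 * (p + 1) ^+ 2 * p * (p ^+ 2 - (1 - b)) <= Y ^+ 2 * (18 * b).
  have r1 : 0 <= p ^+ 2 - (1 - b) <= 2 * b by apply/andP; split; lra.
  have r2 : (p + 1) ^+ 2 * p <= 13 / 2 * (3 / 2) by apply: ler_pM; rewrite ?sqr_ge0//; lra.
  have r3 : ((p + 1) ^+ 2 * p) * (p ^+ 2 - (1 - b)) <= (13 / 2 * (3 / 2)) * (2 * b).
    by case/andP: r1 => *; apply: ler_pM => //; rewrite mulr_ge0 ?sqr_ge0.
  have -> : Y ^+ 2 / 2 * (p + 1) ^+ 2 * p * (p ^+ 2 - (1 - b)) = Y ^+ 2 * (((p + 1) ^+ 2 * p) * (p ^+ 2 - (1 - b)) / 2) by ring.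
  by rewrite ler_wpM2l ?sqr_ge0//; lra.
have Y2 : Y ^+ 2 <= Ym ^+ 2 by nra.
have B : b * (4 + 7 * Y + 18 * Y ^+ 2) <= d by apply: le_trans bd; rewrite ler_pM2l//; lra.
by rewrite /J; lra.
Qed.
End Alg.

Section Rigidity.
Context {R : realType}.
Variables (s w Q n : R -> R) (mu lr Om : R).
Let Lam := lr ^+ 2 + Om ^+ 2.
Hypotheses (cs : continuous s) (cw : continuous w) (cQ : continuous Q).
Hypotheses (w0 : forall t, 0 < w t) (n0 : forall t, 0 < n t).
Hypothesis iw : oint w = 2 * pi.
Hypothesis isw : oint (fun t => s t * w t) = 0.
Hypothesis iQ : oint Q = - (2 * pi * mu).
Hypothesis isQ : oint (fun t => s t * Q t) = - (Om * oint (fun t => s t ^+ 2 * w t)).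
Hypothesis bern : forall t, Q t ^+ 2 = (mu ^+ 2 + Lam * s t) * n t ^+ 2.
Hypothesis speed : forall t, (1 + s t) * w t ^+ 2 <= n t ^+ 2.
Hypothesis ssmall : forall t, `|s t| <= 1 / 64.
Hypothesis lr0 : lr != 0.

Let Lam0 : 0 < Lam.
Proof. by rewrite /Lam ltr_pwDl ?sqr_ge0// exprn_even_gt0. Qed.

Let cM (f g : R -> R) : continuous f -> continuous g -> continuous (fun t => f t * g t).
Proof. by move=> cf cg t; apply: cvgM; [exact: cf|exact: cg]. Qed.

Let cZ (c : R) (g : R -> R) : continuous g -> continuous (fun t => c * g t).
Proof. by move=> cg t; apply: cvgM; [exact: cvg_cst|exact: cg]. Qed.

Let cB (f g : R -> R) : continuous f -> continuous g -> continuous (fun t => f t - g t).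
Proof. by move=> cf cg t; apply: cvgB; [exact: cf|exact: cg]. Qed.

Let cD (f g : R -> R) : continuous f -> continuous g -> continuous (fun t => f t + g t).
Proof. by move=> cf cg t; apply: cvgD; [exact: cf|exact: cg]. Qed.

(** Bernoulli forces s >= 0, and s has weighted mean zero. *)
Lemma rigid_mu0 : mu = 0 -> forall t, 0 <= t <= 2 * pi -> s t = 0 /\ Q t = - mu * n t.
Proof.
move=> m0 t tI.
have s0 r : 0 <= s r.
  have := sqr_ge0 (Q r); rewrite bern m0 expr0n /= add0r.
  by rewrite pmulr_lge0 ?exprn_gt0// pmulr_rge0.
have sw0 r : 0 <= s r * w r by rewrite mulr_ge0// ltW.
have /eqP := oint_eq0 (cM cs cw) sw0 isw tI.
rewrite mulf_eq0 (gt_eqF (w0 t)) orbF => /eqP st; split => //.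
have /eqP := bern t; rewrite st m0 expr0n /= mulr0 addr0 mul0r sqrf_eq0 => /eqP ->.
by rewrite oppr0 mul0r.
Qed.

Let p t := - Q t / (mu * n t).
Let k := Om * mu / Lam.

(** The integral of T vanishes by the moment identities, for every beta.
    Replacing |Z'| by its lower bound (1 + s/2 - s^2/2) w costs a nonnegative
    term because p^3 - beta p >= 0; what remains dominates c0 (p - 1)^2 w. *)
Lemma rigid_step (beta c0 : R) : mu != 0 -> 0 < c0 ->
  (forall t, 0 <= p t ^+ 3 - beta * p t) ->
  (forall t, c0 * (p t - 1) ^+ 2 <= (p t - 1) ^+ 2 * (p t + (1 + beta) / 2) - k * (p t ^+ 2 - 1) ^+ 2
    + (p t ^+ 3 - beta * p t) * (s t / 2 - s t ^+ 2 / 2) - (1 - beta) * s t / 2) ->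
  forall t, 0 <= t <= 2 * pi -> s t = 0 /\ Q t = - mu * n t.
Proof.
move=> m0 c00 hb hJ.
have nn t : n t != 0 by rewrite gt_eqF.
have Ln : Lam != 0 by rewrite gt_eqF.
have p2 t : p t ^+ 2 = 1 + Lam / mu ^+ 2 * s t.
  rewrite /p expr_div_n sqrrN bern exprMn; field; by rewrite nn m0.
have pn t : p t * n t = - (mu^-1 * Q t) by rewrite /p; field; rewrite nn m0.
pose F1 t := Lam / mu ^+ 2 * - mu^-1 * (s t * Q t).
pose F2 t := k * (Lam / mu ^+ 2) ^+ 2 * (s t ^+ 2 * w t).
pose F3a t := - mu^-1 * Q t.
pose F3b t := F3a t - w t.
pose F3 t := (1 - beta) * F3b t.
pose F4 t := ((3 - beta) / 2 * (Lam / mu ^+ 2) + (1 - beta) / 2) * (s t * w t).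
pose F12 t := F1 t - F2 t.
pose F123 t := F12 t + F3 t.
pose T t := F123 t - F4 t.
have TE t : T t = (p t ^+ 2 - 1) * (p t * n t) - k * (p t ^+ 2 - 1) ^+ 2 * w t
   + (1 - beta) * (p t * n t - w t) - (3 - beta) / 2 * (p t ^+ 2 - 1) * w t - (1 - beta) / 2 * s t * w t.
  by rewrite pn p2 /T /F123 /F12 /F1 /F2 /F3 /F3b /F3a /F4; ring.
have cs2w : continuous (fun t => s t ^+ 2 * w t).
  have -> : (fun t => s t ^+ 2 * w t) = (fun t => (s t * s t) * w t) by apply/funext => t; rewrite expr2.
  by apply: (cM (cM cs cs) cw).
have csQ := cM cs cQ; have csw := cM cs cw.
have c1 : continuous F1 by apply: cZ.
have c2 : continuous F2 by apply: cZ.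
have c3a : continuous F3a by apply: cZ.
have c3b : continuous F3b by apply: cB.
have c3 : continuous F3 by apply: cZ.
have c4 : continuous F4 by apply: cZ.
have c12 : continuous F12 by apply: cB.
have c123 : continuous F123 by apply: cD.
have cT : continuous T by apply: cB.
have iT : oint T = 0.
  rewrite (ointB c123 c4) (ointD c12 c3) (ointB c1 c2) (ointZ _ csQ) (ointZ _ cs2w) (ointZ _ csw).
  rewrite (ointZ _ c3b) (ointB c3a cw) (ointZ _ cQ) iw isw iQ isQ /k.
  by field; rewrite Ln m0.
have key t : c0 * (p t - 1) ^+ 2 * w t <= T t.
  have /andP[s1 s2] : - (1 / 64) <= s t <= 1 / 64 by rewrite -ler_norml.
  have nw : (1 + s t / 2 - s t ^+ 2 / 2) * w t <= n t.
    have a0 : 0 <= 1 + s t / 2 - s t ^+ 2 / 2 by nra.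
    rewrite -(@ler_pXn2r _ 2)// ?nnegrE ?mulr_ge0 ?(ltW (w0 t)) ?(ltW (n0 t))//.
    apply: le_trans (speed t); rewrite exprMn ler_pM2r ?exprn_gt0//.
    have -> : (1 + s t / 2 - s t ^+ 2 / 2) ^+ 2 = 1 + s t - s t ^+ 2 * (3 / 4 + s t / 2 - s t ^+ 2 / 4) by field.
    have : 0 <= s t ^+ 2 * (3 / 4 + s t / 2 - s t ^+ 2 / 4) by rewrite mulr_ge0 ?sqr_ge0//; nra.
    by lra.
  have -> : T t = w t * ((p t - 1) ^+ 2 * (p t + (1 + beta) / 2) - k * (p t ^+ 2 - 1) ^+ 2
    + (p t ^+ 3 - beta * p t) * (s t / 2 - s t ^+ 2 / 2) - (1 - beta) * s t / 2)
    + (p t ^+ 3 - beta * p t) * (n t - (1 + s t / 2 - s t ^+ 2 / 2) * w t).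
    by rewrite TE; field.
  have h1 : 0 <= (p t ^+ 3 - beta * p t) * (n t - (1 + s t / 2 - s t ^+ 2 / 2) * w t).
    by rewrite mulr_ge0// subr_ge0.
  have h2 := ler_wpM2l (ltW (w0 t)) (hJ t).
  by rewrite mulrC; apply: le_trans h2 _; rewrite lerDl.
have T0 t : 0 <= T t.
  by apply: le_trans (key t); rewrite mulr_ge0 ?(ltW (w0 t))// mulr_ge0 ?sqr_ge0// ltW.
move=> t tI; have Tt := oint_eq0 cT T0 iT tI.
have p1 : p t = 1.
  have : c0 * (p t - 1) ^+ 2 * w t <= 0 by rewrite -Tt.
  rewrite pmulr_lle0// pmulr_rle0// => h.
  by apply/eqP; rewrite -subr_eq0 -sqrf_eq0 eq_le h sqr_ge0.
split.
  have := p2 t; rewrite p1 expr1n => /eqP; rewrite eq_sym -subr_eq0 addrAC subrr add0r mulf_eq0.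
  have -> : (Lam / mu ^+ 2 == 0) = false.
    by apply: gt_eqF; rewrite divr_gt0// exprn_even_gt0.
  by move=> /eqP.
have := divfK (mulf_neq0 m0 (nn t)) (- Q t).
by rewrite -[_ / _]/(p t) p1 mul1r mulNr => ->; rewrite opprK.
Qed.

(** Here p >= 0 alone makes p^3 >= 0, so beta = 0 can be used. *)
Lemma rigid_small : mu != 0 -> mu ^+ 2 <= Lam / 64 -> (forall t, mu * Q t <= 0) ->
  forall t, 0 <= t <= 2 * pi -> s t = 0 /\ Q t = - mu * n t.
Proof.
move=> m0 mL sgn.
have Ln : Lam != 0 by rewrite gt_eqF.
have pp t : 0 <= p t.
  have -> : p t = - (mu * Q t) / (mu ^+ 2 * n t).
    by rewrite /p; field; rewrite m0 gt_eqF.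
  by rewrite divr_ge0 ?oppr_ge0// mulr_ge0 ?sqr_ge0// ltW.
have p2 t : s t = mu ^+ 2 / Lam * (p t ^+ 2 - 1).
  rewrite /p expr_div_n sqrrN bern exprMn; field; by rewrite m0 Ln gt_eqF.
apply: (@rigid_step 0 (1 / 8)) => //.
  by move=> t; rewrite mul0r subr0 exprn_ge0.
move=> t; have -> : p t ^+ 3 - 0 * p t = p t ^+ 3 by rewrite mul0r subr0.
have -> : (1 - 0) * s t / 2 = s t / 2 by rewrite subr0 mul1r.
have -> : p t + (1 + 0) / 2 = p t + 1 / 2 by rewrite addr0.
apply: (@integrand_bound_small _ _ _ _ (mu ^+ 2 / Lam)) => //.
- by rewrite divr_ge0 ?sqr_ge0 ?(ltW Lam0)//= ler_pdivrMr//; lra.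
- by have := ssmall t; rewrite ler_norml => /andP[].
- rewrite /k expr_div_n exprMn ler_pdivrMr ?exprn_gt0//.
  have -> : mu ^+ 2 / Lam * Lam ^+ 2 = mu ^+ 2 * Lam by field.
  by rewrite mulrC ler_wpM2l ?sqr_ge0// /Lam; have := sqr_ge0 lr; lra.
Qed.

(** Here p^2 >= 1 - b, so beta = 1 - b can be used; the coefficient 1 + Y - 2 k
    equals |lambda - i mu|^2 / |lambda|^2. *)
Lemma rigid_close (b d Ym : R) : mu != 0 -> mu ^+ 2 / Lam <= Ym -> (forall t, mu * Q t <= 0) ->
  0 < b <= 1 / 2 -> 0 < d -> (forall t, `|s t| <= b * (mu ^+ 2 / Lam)) ->
  d <= lr ^+ 2 / Lam -> b * (4 + 7 * Ym + 18 * Ym ^+ 2) <= d ->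
  forall t, 0 <= t <= 2 * pi -> s t = 0 /\ Q t = - mu * n t.
Proof.
move=> m0 mY sgn b0 d0 sb dL bd.
have Ln : Lam != 0 by rewrite gt_eqF.
have Y0 : 0 < mu ^+ 2 / Lam by rewrite divr_gt0// exprn_even_gt0.
have pp t : 0 <= p t.
  have -> : p t = - (mu * Q t) / (mu ^+ 2 * n t).
    by rewrite /p; field; rewrite m0 gt_eqF.
  by rewrite divr_ge0 ?oppr_ge0// mulr_ge0 ?sqr_ge0// ltW.
have p2 t : s t = mu ^+ 2 / Lam * (p t ^+ 2 - 1).
  rewrite /p expr_div_n sqrrN bern exprMn; field; by rewrite m0 Ln gt_eqF.
have pb t : `|p t ^+ 2 - 1| <= b.
  by have := sb t; rewrite p2 normrM gtr0_norm// mulrC ler_pM2r.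
have /andP[b1 b2] := b0.
apply: (@rigid_step (1 - b) d) => //.
  move=> t; have -> : p t ^+ 3 - (1 - b) * p t = p t * (p t ^+ 2 - (1 - b)) by ring.
  by rewrite mulr_ge0//; have := pb t; rewrite ler_norml => /andP[]; lra.
move=> t; have -> : (1 + (1 - b)) / 2 = (2 - b) / 2 by field.
have -> : (1 - (1 - b)) * s t / 2 = b * s t / 2 by ring.
apply: (@integrand_bound_close _ _ _ _ (mu ^+ 2 / Lam) Ym) => //.
- by rewrite Y0 mY.
- rewrite /k expr_div_n exprMn ler_pdivrMr ?exprn_gt0//.
  have -> : mu ^+ 2 / Lam * Lam ^+ 2 = mu ^+ 2 * Lam by field.
  by rewrite mulrC ler_wpM2l ?sqr_ge0// /Lam; have := sqr_ge0 lr; lra.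
- apply: le_trans dL _.
  have -> : 1 + mu ^+ 2 / Lam - 2 * k = (lr ^+ 2 + (Om - mu) ^+ 2) / Lam.
    by rewrite /k; move: Ln; rewrite /Lam => Ln; field.
  by rewrite ler_pM2r ?invr_gt0// lerDl sqr_ge0.
Qed.
End Rigidity.

(** * Boundary identities of the flow *)

Section Moments.
Context {R : realType}.
Local Notation C := R[i].

Lemma oint_lin5 (a1 a2 a3 a4 a5 : R) (k1 k2 k3 k4 k5 : R -> R) :
  continuous k1 -> continuous k2 -> continuous k3 -> continuous k4 -> continuous k5 ->
  oint (fun t => a1 * k1 t + a2 * k2 t + a3 * k3 t + a4 * k4 t + a5 * k5 t)
  = a1 * oint k1 + a2 * oint k2 + a3 * oint k3 + a4 * oint k4 + a5 * oint k5.
Proof.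
move=> c1 c2 c3 c4 c5.
have cZ (c : R) (g : R -> R) : continuous g -> continuous (fun t => c * g t).
  by move=> cg t; apply: cvgM; [exact: cvg_cst|exact: cg].
have cD (f g : R -> R) : continuous f -> continuous g -> continuous (fun t => f t + g t).
  by move=> cf cg t; apply: cvgD; [exact: cf|exact: cg].
pose h1 t := a1 * k1 t; pose h2 t := a2 * k2 t; pose h3 t := a3 * k3 t.
pose h4 t := a4 * k4 t; pose h5 t := a5 * k5 t.
have d1 : continuous h1 by apply: cZ.
have d2 : continuous h2 by apply: cZ.
have d3 : continuous h3 by apply: cZ.
have d4 : continuous h4 by apply: cZ.
have d5 : continuous h5 by apply: cZ.
pose g2 t := h1 t + h2 t; pose g3 t := g2 t + h3 t; pose g4 t := g3 t + h4 t.
have e2 : continuous g2 by apply: cD.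
have e3 : continuous g3 by apply: cD.
have e4 : continuous g4 by apply: cD.
rewrite (ointD e4 d5) (ointD e3 d4) (ointD e2 d3) (ointD d1 d2).
by rewrite (ointZ _ c1) (ointZ _ c2) (ointZ _ c3) (ointZ _ c4) (ointZ _ c5).
Qed.

Variables (eta : R) (Z Z' : R -> C).
Hypothesis nc : near_circle eta Z Z'.
Local Notation b := (bt Z Z').
Local Notation s t := (nsq (Z t) - 1).

Let cM (f g : R -> R) : continuous f -> continuous g -> continuous (fun t => f t * g t).
Proof. by move=> cf cg t; apply: cvgM; [exact: cf|exact: cg]. Qed.

Lemma s_cont : continuous (fun t => s t).
Proof. by move=> t; apply: cvgB; [exact: (nsqZ_cont nc)|exact: cvg_cst]. Qed.

Lemma s2_cont : continuous (fun t => s t ^+ 2).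
Proof.
have -> : (fun t => s t ^+ 2) = (fun t => s t * s t) by apply/funext => t; rewrite expr2.
exact: (cM s_cont s_cont).
Qed.

(** The integrand is the derivative of a function of |Z|^2. *)
Lemma oint_sbt : oint (fun t => s t * b t) = 0.
Proof.
have be : (fun t => s t * b t) =1 (fun t => ((nsq (Z t) - 1) / (2 * nsq (Z t))) * (2 * nsq (Z t) * b t)).
  by move=> t; have := nsqZ_gt0 nc t => n0; field; rewrite gt_eqF.
rewrite (eq_oint be).
apply: (oint_exact nc (g := fun x => (x - 1) / (2 * x)) (G := fun x => 2^-1 * (x - ln x))).
  move=> x x0; have := is_deriveZ 2^-1 (is_deriveB (is_derive_id x 1) (is_derive1_ln x0)).
  by move=> /is_derive_eqf; apply => //; rewrite /GRing.scale /=; field; rewrite gt_eqF.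
by move=> t; rewrite -(funext be); apply: (cM s_cont (bt_cont nc)).
Qed.

Lemma oint_s2bt : oint (fun t => s t ^+ 2 * b t) = 0.
Proof.
have be : (fun t => s t ^+ 2 * b t) =1
    (fun t => ((nsq (Z t) - 1) ^+ 2 / (2 * nsq (Z t))) * (2 * nsq (Z t) * b t)).
  by move=> t; have := nsqZ_gt0 nc t => n0; field; rewrite gt_eqF.
rewrite (eq_oint be).
apply: (oint_exact nc (g := fun x => (x - 1) ^+ 2 / (2 * x))
  (G := fun x => 2^-1 * (2^-1 * (x * x) - 2 * x + ln x))).
  move=> x x0.
  have d1 := is_deriveZ 2^-1 (is_deriveM (is_derive_id x 1) (is_derive_id x 1)).
  have d2 := is_deriveZ 2 (is_derive_id x (1 : R)).
  have := is_deriveZ 2^-1 (is_deriveD (is_deriveB d1 d2) (is_derive1_ln x0)).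
  by move=> /is_derive_eqf; apply => //; rewrite /GRing.scale /=; field; rewrite gt_eqF.
by move=> t; rewrite -(funext be); apply: (cM s2_cont (bt_cont nc)).
Qed.

End Moments.

(** * Elementary inequalities for the sign of the tangential velocity *)

Section SignAlgebra.
Variable R : realFieldType.
Implicit Types (x y b w q nz d e mu lr Om Y : R).

(** The product of x + i y with b + i w, which is close to i, is real; so x + i
    y is nearly imaginary. *)
Lemma slope_small x y b w q nz : x * w + y * b = 0 -> x ^+ 2 + y ^+ 2 = nz * q ->
  `|b| <= 3 / 100 -> 97 / 100 <= w -> 63 / 64 <= nz -> 0 <= q ->
  x ^+ 2 <= y ^+ 2 / 1000 /\ 9 / 10 * q <= y ^+ 2.
Proof.
move=> xw xy hb hw hz q0.
have b2 : b ^+ 2 <= 9 / 10000.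
  have : `|b| ^+ 2 <= (3 / 100) ^+ 2 by rewrite ler_pXn2r ?nnegrE//; lra.
  by rewrite real_normK ?num_real//; lra.
have w2 : 94 / 100 <= w ^+ 2 by nra.
have e : x ^+ 2 * w ^+ 2 = y ^+ 2 * b ^+ 2.
  have -> : x ^+ 2 * w ^+ 2 = (x * w) ^+ 2 by rewrite exprMn.
  have -> : x * w = - (y * b) by lra.
  by rewrite sqrrN exprMn.
have x0 := sqr_ge0 x; have y0 := sqr_ge0 y.
have h1 := ler_wpM2l x0 w2; have h2 := ler_wpM2l y0 b2.
have h3 := ler_wpM2r q0 hz.
by split; lra.
Qed.

Lemma re_square_le0 x y d e q : x ^+ 2 <= y ^+ 2 / 1000 -> 9 / 10 * q <= y ^+ 2 -> 0 <= q ->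
  d ^+ 2 + e ^+ 2 <= q / 32 -> (x - d) ^+ 2 - (y - e) ^+ 2 <= 0.
Proof.
move=> h1 h2 q0 h3.
have e1 : (x - d) ^+ 2 <= 2 * x ^+ 2 + 2 * d ^+ 2 by have := sqr_ge0 (x + d); lra.
have e2 : y ^+ 2 / 2 - e ^+ 2 <= (y - e) ^+ 2 by have := sqr_ge0 (y - 2 * e); lra.
have := sqr_ge0 d; have := sqr_ge0 e; lra.
Qed.

(** The sign of y is opposite to that of Q, and the subtracted e is too small to
    change it. *)
Lemma neg_product x y b w mu Q q e : x * w + y * b = 0 -> x * b - y * w = Q -> 0 < w ->
  9 / 10 * q <= y ^+ 2 -> e ^+ 2 <= q / 32 -> 0 <= mu * (y - e) -> mu * Q <= 0.
Proof.
move=> xw xb w0 yq eq h; rewrite leNgt; apply/negP => mQ.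
have Qw : Q * w = - (y * (b ^+ 2 + w ^+ 2)).
  have -> : Q * w = x * w * b - y * w ^+ 2 by rewrite -xb; ring.
  have -> : x * w = - (y * b) by lra.
  by ring.
have N0 : 0 < b ^+ 2 + w ^+ 2 by have := sqr_ge0 b; have := exprn_gt0 2 w0; lra.
have my : mu * y < 0.
  have : 0 < mu * Q * w by rewrite mulr_gt0.
  have -> : mu * Q * w = - (mu * y * (b ^+ 2 + w ^+ 2)) by rewrite -mulrA Qw; ring.
  by rewrite oppr_gt0 pmulr_llt0.
have me : mu * e <= mu * y by lra.
have m2 : (mu * y) ^+ 2 <= (mu * e) ^+ 2 by nra.
have m20 := sqr_ge0 mu.
have := ler_wpM2l m20 yq; have := ler_wpM2l m20 eq; have my2 : 0 < (mu * y) ^+ 2 by nra.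
by move: m2 my2; rewrite !exprMn; lra.
Qed.

Lemma limit_neg mu lr Om Y : mu != 0 -> mu ^+ 2 = (lr ^+ 2 + Om ^+ 2) * Y -> 0 <= Y <= 1 / 64 ->
  (lr * Y) ^+ 2 - (mu - Om * Y) ^+ 2 < 0 /\ (Om * Y) ^+ 2 <= mu ^+ 2 / 64.
Proof.
move=> m0 mE /andP[Y0 Y1].
have m2 : 0 < mu ^+ 2 by rewrite exprn_even_gt0.
have e : (lr * Y) ^+ 2 + (Om * Y) ^+ 2 = mu ^+ 2 * Y by rewrite mE; ring.
have := ler_wpM2l (ltW m2) Y1.
have := sqr_ge0 (lr * Y); have := sqr_ge0 (Om * Y).
have : mu ^+ 2 / 2 - (Om * Y) ^+ 2 <= (mu - Om * Y) ^+ 2 by have := sqr_ge0 (mu - 2 * (Om * Y)); lra.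
by move=> *; split; lra.
Qed.
End SignAlgebra.

(** * Rigidity of the flow *)

Section Flow.
Context {R : realType}.
Local Notation C := R[i].
Variables (eta : R) (Z Z' : R -> C).
Hypothesis nc : near_circle eta Z Z'.
Let gc := nc_gauge nc.
Local Notation L t := (Z' t / Z t).
Local Notation p := (pt 0 Z).
Local Notation w := (wt Z Z').
Local Notation b := (bt Z Z').
Local Notation s t := (nsq (Z t) - 1).
Variables (D : set (R * R)) (f f' : R * R -> C).
Hypothesis oD : open D.
Hypothesis inD : forall s t, 1 < s -> D (p s t).
Hypothesis Dp : forall x, D x -> exists s t, 1 < s /\ x = p s t.
Hypothesis hf : holo D f f'.
Hypothesis f_infty : ulim Z f 0.
Hypothesis cf : forall q : R * R, contC (fun q : R * R => f (p (Num.max 1 q.1) q.2)) q.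
Variables (lr Om Bc : R).
Hypothesis lr0 : 0 < lr.
Local Notation lam := (Complex lr Om).
Local Notation Lam := (lr ^+ 2 + Om ^+ 2).
Local Notation W t := (f (p 1 t) + lam * ((Z t)^*)%C).
Hypothesis tangent : forall t, Im (W t * Z' t) = 0.
Hypothesis bern : forall t, nsq (W t) = Bc + Lam * s t.
Hypothesis isw : oint (fun t => s t * w t) = 0.
Local Notation Q t := (Re (W t * Z' t)).
Local Notation mu := (- (oint (fun t => Q t)) / (2 * pi)).

Lemma toC_p1 t : toC (p 1 t) = Z t.
Proof. by rewrite toC_pt add0r mul1r. Qed.

Let cf1 : ccont (fun t => f (p 1 t)).
Proof. exact: ccont_f1 cf. Qed.

Let cZb : ccont (fun t => ((Z t)^*)%C).
Proof.
move=> t; have [c1 c2] := nc_ccont nc t; split.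
  by apply: continuous_at_eq c1 _ => y; rewrite ReConj.
by apply: (@continuous_at_eq _ _ (fun y => - Im (Z y))); [apply: cvgN; exact: c2|move=> y; rewrite ImConj].
Qed.

Lemma Q_cont : continuous (fun t => Q t).
Proof.
apply: ccont_Re => t; apply: contCM; last exact: (nc_cont nc).
apply: contCD; first exact: cf1.
apply: contCM; [exact: contC_cst|exact: cZb].
Qed.

Lemma tangential_real t : W t * Z' t = (Q t)%:C.
Proof. by apply: eqC => //; exact: tangent. Qed.

Lemma deriv_logderiv t : Z' t = L t * Z t.
Proof. by rewrite divfK// (nc_neq0 nc). Qed.

Lemma nsqM (x y : C) : nsq (x * y) = nsq x * nsq y.
Proof. by case: x => a c; case: y => d e; rewrite /nsq /=; ring. Qed.

Lemma Q_sq t : Q t ^+ 2 = nsq (W t) * nsq (Z' t).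
Proof. by rewrite -nsqM tangential_real /nsq /= expr0n addr0. Qed.


Lemma nsqZ' t : nsq (Z' t) = (b t ^+ 2 + w t ^+ 2) * nsq (Z t).
Proof. by rewrite deriv_logderiv nsqM. Qed.

Lemma winding_2pi : winding Z Z' = (2 * pi)%:C * 'i. Proof. exact: windingE nc. Qed.

Local Notation G x := (toC x * f x + lam).

(** G = z f + lambda is the function whose contour integrals against dz / z give
    all the identities; on the curve it only involves the relative velocity and
    s. *)
Lemma G_bdry t : G (p 1 t) = Z t * W t - lam * (s t)%:C.
Proof.
rewrite toC_p1; move: (f _) (Z t) => u z; case: u => u1 u2; case: z => z1 z2.
by apply: eqC; rewrite /nsq /=; ring.
Qed.

Lemma GL_bdry t : G (p 1 t) * L t = (Q t)%:C - lam * ((s t)%:C * L t).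
Proof.
rewrite G_bdry -tangential_real mulrBl -[lam * _ * _]mulrA; congr (_ - _).
by rewrite mulrC mulrA mulfVK ?(nc_neq0 nc)// mulrC.
Qed.

(** As Q = W Z' is real, W^2 Z' = |W|^2 conj(Z'), which turns the quadratic term
    into Bernoulli data. *)
Lemma ZWW t : Z t * W t ^+ 2 * Z' t = ((nsq (Z t) * nsq (W t))%:C * ((L t)^*)%C).
Proof.
have z0 := nc_neq0 nc t.
have n0 : nsq (Z t) != 0 by rewrite gt_eqF// nsq_gt0.
have [e|Z'0] := eqVneq (Z' t) 0.
  by rewrite e mulr0 mul0r; apply: eqC; rewrite /=; ring.
suff : Z t * W t ^+ 2 * Z' t * Z' t = ((nsq (Z t) * nsq (W t))%:C * ((L t)^*)%C) * Z' t.
  by move=> /(mulIf Z'0).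
have -> : Z t * W t ^+ 2 * Z' t * Z' t = (Q t ^+ 2)%:C * Z t.
  have -> : Z t * W t ^+ 2 * Z' t * Z' t = (W t * Z' t) ^+ 2 * Z t by ring.
  by rewrite tangential_real; apply: eqC; rewrite !ReImE /=; ring.
rewrite Q_sq; have := deriv_logderiv t; move: (L t) => l ->; rewrite nsqM.
move: (nsq (W t)) (Z t) => q z; case: l => l1 l2; case: z => z1 z2.
by apply: eqC; rewrite /nsq /=; ring.
Qed.

Lemma GGL_bdry t : G (p 1 t) ^+ 2 * L t =
  ((1 + s t) * (Bc + Lam * s t))%:C * ((L t)^*)%C - 2 * lam * (s t * Q t)%:C
  + lam ^+ 2 * ((s t ^+ 2)%:C * L t).
Proof.
have -> : 1 + s t = nsq (Z t) by rewrite addrC subrK.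
rewrite -bern -ZWW G_bdry.
have -> : (s t * Q t)%:C = (s t)%:C * (W t * Z' t) by rewrite tangential_real; apply: eqC; rewrite !ReImE /=; ring.
have -> : (s t ^+ 2)%:C = (s t)%:C ^+ 2 :> C by apply: eqC; rewrite /= ?expr2 /=; ring.
have := deriv_logderiv t; move: (s t)%:C (W t) (L t) => ss ww l ->; ring.
Qed.


Let cM (g h : R -> R) : continuous g -> continuous h -> continuous (fun t => g t * h t).
Proof. by move=> cg ch t; apply: cvgM; [exact: cg|exact: ch]. Qed.

Let csb : continuous (fun t => s t * b t) := cM (s_cont nc) (bt_cont nc).
Let csw : continuous (fun t => s t * w t) := cM (s_cont nc) (wt_cont nc).
Let cs2b : continuous (fun t => s t ^+ 2 * b t) := cM (s2_cont nc) (bt_cont nc).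
Let cs2w : continuous (fun t => s t ^+ 2 * w t) := cM (s2_cont nc) (wt_cont nc).
Let csQ : continuous (fun t => s t * Q t) := cM (s_cont nc) Q_cont.

Lemma pi2_neq0 : 2 * pi != 0 :> R.
Proof. by rewrite gt_eqF// pi2_gt0. Qed.

(** The integral of G dz / z, whose lambda s term vanishes: its real part is
    exact and its imaginary part is the area condition. *)
Lemma G_limit : cint (fun t => f (p 1 t) * Z' t) / winding Z Z' + lam = 'i * mu%:C.
Proof.
apply: (mulIf (winding_neq0 nc)); rewrite mulrDl divfK ?(winding_neq0 nc)//.
have cfZ : ccont (fun t => f (p 1 t) * Z' t).
  by move=> t; apply: contCM; [exact: cf1|exact: (nc_cont nc)].
have clL : ccont (fun t => lam * L t).
  by move=> t; apply: contCM; [exact: contC_cst|exact: (L_cc nc)].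
rewrite -[lam * _](cintZ lam (L_cc nc)) -(cintD cfZ clL).
have e t : f (p 1 t) * Z' t + lam * L t = (Q t)%:C - lam * ((s t)%:C * L t).
  by rewrite -GL_bdry toC_p1; have z0 := nc_neq0 nc t; field.
rewrite (eq_cint e) winding_2pi; apply: eqC.
  rewrite /= (@eq_oint _ _ (fun t => 1 * Q t + (- lr) * (s t * b t) + Om * (s t * w t)
      + 0 * (s t * b t) + 0 * (s t * b t))); last first.
    by move=> t; rewrite /wt /bt !ReImE /=; ring.
  rewrite (oint_lin5 _ _ _ _ _ Q_cont csb csw csb csb) isw (oint_sbt nc).
  by move: (oint (fun t => Q t)) (2 * pi) pi2_neq0 => q P P0; field.
rewrite /= (@eq_oint _ _ (fun t => (- lr) * (s t * w t) + (- Om) * (s t * b t) + 0 * (s t * b t)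
      + 0 * (s t * b t) + 0 * (s t * b t))); last first.
  by move=> t; rewrite /wt /bt !ReImE /=; ring.
rewrite (oint_lin5 _ _ _ _ _ csw csb csb csb csb) isw (oint_sbt nc).
by ring.
Qed.

Lemma G_holo : exists G', holo D (fun x => G x) G'.
Proof.
eexists; apply: holoD; last exact: holo_cst.
by apply: holoM; [exact: holo_id|exact: hf].
Qed.

Lemma G_cc (q : R * R) (c : C) : contC (fun q : R * R => G (p (Num.max 1 q.1) q.2) + c) q.
Proof.
apply: contCD; last exact: contC_cst.
apply: contCD; last exact: contC_cst.
apply: contCM; last exact: cf.
have -> : (fun q : R * R => toC (p (Num.max 1 q.1) q.2)) =
  (fun q : R * R => (Num.max 1 q.1)%:C * Z q.2).
  by apply/funext => r; rewrite toC_pt add0r.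
apply: contCM.
  apply: contC_real; apply: (@continuous_comp _ _ _ (fst : R * R -> R) (fun x => Num.max 1 x)).
    exact: cont_fst.
  by apply: continuous_max; [exact: cvg_cst|exact: cvg_id].
by apply: (@contC_comp _ _ _ (snd : R * R -> R) Z); [exact: cont_snd|exact: (nc_ccont nc)].
Qed.

Lemma G_infty : ulim Z (fun x => G x) ('i * mu%:C).
Proof.
rewrite -G_limit; apply: ulimD; last exact: ulim_cst.
exact: (zf_infty gc hf inD f_infty cf (winding_neq0 nc)).
Qed.

Lemma GG_contour : cint (fun t => G (p 1 t) ^+ 2 * L t) = ('i * mu%:C) ^+ 2 * winding Z Z'.
Proof.
have [G' hG] := G_holo; have hGG := holoM hG hG.
have u := ulimM G_infty G_infty.
have I1 : ((1 : R) < 3 / 2) && (3 / 2 < (2 : R)) by apply/andP; split; lra.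
have I2 : 1 < 3 / 2 :> R by lra.
have := contour_infty gc (@ler01 R) hGG inD u I2.
rewrite expr2 => <-.
have := @contour_bdry _ _ _ gc _ _ _ 2 _ hGG _ _ (3 / 2) I1.
have l2 : 1 < 2 :> R by lra.
have i2 r y : 1 < r < (2 : R) -> D (p r y) by move=> /andP[r1 _]; exact: inD.
have cc r y : r < (2 : R) -> contC (fun q : R * R => G (p (Num.max 1 q.1) q.2) * G (p (Num.max 1 q.1) q.2)) (r, y).
  move=> _; have := G_cc (r, y) 0.
  have -> : (fun q : R * R => G (p (Num.max 1 q.1) q.2) + 0) = (fun q : R * R => G (p (Num.max 1 q.1) q.2)).
    by apply/funext => q; rewrite addr0.
  by move=> h; apply: contCM.
move=> /(_ l2 i2 cc) ->.
by apply: eq_cint => t; rewrite expr2.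
Qed.

(** Compare the values of the integral of G^2 dz / z at infinity and on the
    curve: the real part determines the integral of s Q because Re lambda is
    nonzero, and then the imaginary part determines Bc. *)
Lemma second_moment : Bc = mu ^+ 2 /\
  oint (fun t => s t * Q t) = - (Om * oint (fun t => s t ^+ 2 * w t)).
Proof.
have := GG_contour; rewrite (eq_cint GGL_bdry) winding_2pi.
set S := oint (fun t => s t ^+ 2 * w t); set T := oint (fun t => s t * Q t).
set m := mu.
have e2 : (2 : C) = (2 : R)%:C by apply: eqC; rewrite /= ?addr0.
have sb := oint_sbt nc; have s2b := oint_s2bt nc.
move=> e; have := congr1 (@complex.Im R) e; have := congr1 (@complex.Re R) e.
rewrite /= (@eq_oint _ _ (fun t => Bc * b t + (Bc + Lam) * (s t * b t)
   + (Lam + lr ^+ 2 - Om ^+ 2) * (s t ^+ 2 * b t) + (- 2 * lr) * (s t * Q t)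
   + (- 2 * lr * Om) * (s t ^+ 2 * w t))); last first.
  by move=> t; rewrite e2 /wt /bt; move: (Q t) (L t) (s t) => q l x; rewrite !expr2 !ReImE ?ReConj ?ImConj /=; ring.
rewrite (oint_lin5 _ _ _ _ _ (bt_cont nc) csb cs2b csQ cs2w) (oint_bt nc) sb s2b -/S -/T.
move=> eR.
have eT : T = - (Om * S).
  have : lr * (T + Om * S) = 0.
    have -> : lr * (T + Om * S) = - 2^-1 * (Bc * 0 + (Bc + Lam) * 0 + (Lam + lr ^+ 2 - Om ^+ 2) * 0 + -2 * lr * T + -2 * lr * Om * S) by field.
    by rewrite eR ?expr2 /=; ring.
  by move/eqP; rewrite mulf_eq0 (gt_eqF lr0) /= => /eqP; lra.
rewrite (@eq_oint _ _ (fun t => (- Bc) * w t + (- (Bc + Lam)) * (s t * w t)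
   + (- Lam + lr ^+ 2 - Om ^+ 2) * (s t ^+ 2 * w t) + (- 2 * Om) * (s t * Q t)
   + (2 * lr * Om) * (s t ^+ 2 * b t))); last first.
  by move=> t; rewrite e2 /wt /bt; move: (Q t) (L t) (s t) => q l x; rewrite !expr2 !ReImE ?ReConj ?ImConj /=; ring.
rewrite (oint_lin5 _ _ _ _ _ (wt_cont nc) csw cs2w csQ cs2b) (oint_wt nc) isw s2b -/S -/T eT.
rewrite ?expr2 /= => eI; split => //.
move/eqP: eI; rewrite -subr_eq0 => /eqP eI.
have : (2 * pi) * (m * m - Bc) = 0 by apply: (etrans _ eI); ring.
by move/eqP; rewrite mulf_eq0 (negPf pi2_neq0) /= => /eqP; lra.
Qed.


Hypothesis ssmall : forall t, `|s t| <= 1 / 64.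
Hypothesis eta_small : eta <= 1 / 200.
Local Notation Y := (mu ^+ 2 / Lam).

Let Lam0 : 0 < Lam.
Proof. by rewrite ltr_pwDl ?sqr_ge0// exprn_gt0. Qed.

Let Lam_neq0 : Lam != 0. Proof. by rewrite gt_eqF. Qed.

Let bernE t : nsq (W t) = mu ^+ 2 + Lam * s t.
Proof. by rewrite bern (proj1 second_moment). Qed.

Lemma ZW_parts t : Re (Z t * W t) * w t + Im (Z t * W t) * b t = 0 /\
  Re (Z t * W t) * b t - Im (Z t * W t) * w t = Q t.
Proof.
have e : Z t * W t * L t = (Q t)%:C.
  by rewrite -tangential_real; have := deriv_logderiv t; move: (L t) (W t) => l v ->; ring.
split; [have := congr1 (@complex.Im R) e|have := congr1 (@complex.Re R) e].
  by rewrite [Im (_ * (_ / _))]ImM => /= ->.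
by rewrite [Re (_ * (_ / _))]ReM => /= ->.
Qed.

Lemma ZW_size t : Re (Z t * W t) ^+ 2 + Im (Z t * W t) ^+ 2 = nsq (Z t) * nsq (W t).
Proof. by rewrite -nsqM. Qed.

(** Z W is nearly imaginary, because its product with Z' / Z is the real number
    Q and Z' / Z is close to i. *)
Lemma slope_bounds t : Re (Z t * W t) ^+ 2 <= Im (Z t * W t) ^+ 2 / 1000 /\
  9 / 10 * nsq (W t) <= Im (Z t * W t) ^+ 2.
Proof.
have [e _] := ZW_parts t.
have hb := bt_near nc t; have := wt_near nc t; rewrite ler_norml => /andP[hw _].
have := ssmall t; rewrite ler_norml => /andP[hs _].
apply: (slope_small e (ZW_size t)).
- by apply: le_trans hb _; have := eta_small; lra.
- by have := eta_small; lra.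
- by have := hs; lra.
- by rewrite /nsq addr_ge0 ?sqr_ge0.
Qed.

(** The maximum principle for the square of G1 = G - lambda Y.  On the curve G1
    = Z W - lambda |W|^2 / |lambda|^2, nearly imaginary since |W|^2 is small
    against |lambda|^2; at infinity its value i mu - lambda Y is nearly
    imaginary too. *)
Lemma sign_small : mu != 0 -> mu ^+ 2 <= Lam / 64 -> forall t, mu * Q t <= 0.
Proof.
move=> m0 mL t.
pose c1 := - (lam * Y%:C).
have Y0 : 0 <= Y by rewrite divr_ge0 ?sqr_ge0// ltW.
have Y1 : Y <= 1 / 64 by rewrite ler_pdivrMr//; lra.
have mE : mu ^+ 2 = Lam * Y by rewrite [RHS]mulrC divfK.
have YI : 0 <= Y <= 1 / 64 by rewrite Y0 Y1.
have [ll lO] := limit_neg m0 mE YI.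
pose q u := nsq (W u).
have q0 u : 0 <= q u by rewrite /q /nsq addr_ge0 ?sqr_ge0.
have qE u : q u = Lam * (Y + s u) by rewrite /q bernE [RHS]mulrDr -mE.
have qL u : q u / Lam = Y + s u by rewrite qE mulrC mulKf.
have G1 u : G (p 1 u) + c1 = Z u * W u - lam * (q u / Lam)%:C.
  rewrite G_bdry qL /c1.
  by apply: eqC; rewrite !ReImE /=; ring.
have de u : (lr * (q u / Lam)) ^+ 2 + (Om * (q u / Lam)) ^+ 2 <= q u / 32.
  have -> : (lr * (q u / Lam)) ^+ 2 + (Om * (q u / Lam)) ^+ 2 = q u * (q u / Lam) by field.
  apply: ler_wpM2l => //; rewrite qL.
  by have := ssmall u; rewrite ler_norml => /andP[_]; lra.
have ReG1 u : Re (G (p 1 u) + c1) = Re (Z u * W u) - lr * (q u / Lam).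
  by rewrite G1 ReB; congr (_ - _); rewrite /=; ring.
have ImG1 u : Im (G (p 1 u) + c1) = Im (Z u * W u) - Om * (q u / Lam).
  by rewrite G1 ImB; congr (_ - _); rewrite /=; ring.
have sqE (z : C) : Re (z * z) = Re z ^+ 2 - Im z ^+ 2 by rewrite ReM !expr2.
have [G' hG] := G_holo.
have hG1 := holoD hG (@holo_cst _ D c1); have hE := holoM hG1 hG1.
have u1 := ulimD G_infty (ulim_cst Z c1); have uE := ulimM u1 u1.
have l0 : Re (('i * mu%:C + c1) * ('i * mu%:C + c1)) < 0.
  rewrite sqE; move: ll; rewrite /c1 !ReImE /=.
  by congr (_ < 0); ring.
have cc r : contC (fun r : R * R => G (p (Num.max 1 r.1) r.2) + c1) r by exact: G_cc.
have cE r : contC (fun r : R * R => (G (p (Num.max 1 r.1) r.2) + c1) * (G (p (Num.max 1 r.1) r.2) + c1)) r.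
  by apply: contCM; exact: cc.
have b0 u : Re ((G (p 1 u) + c1) * (G (p 1 u) + c1)) <= 0.
  rewrite sqE ReG1 ImG1; have [h1 h2] := slope_bounds u.
  exact: re_square_le0 h1 h2 (q0 u) (de u).
have neg := max_principle gc oD inD Dp hE uE l0 cE b0.
(* a square with negative real part has a root with nonzero imaginary part *)
have Im0 r : 1 < r -> Im (G (p r t) + c1) != 0.
  move=> r1; have := neg r t r1; rewrite sqE.
  by apply: contraTneq => ->; rewrite expr0n /= subr0 -leNgt sqr_ge0.
pose h r := mu * Im (G (p (Num.max 1 r) t) + c1).
have ch : continuous h.
  move=> r; apply: cvgM; first exact: cvg_cst.
  have := @contC_comp _ _ _ (fun r : R => (r, t)) _ r _ (cc (r, t)).
  by case; first by apply: continuous_at_pair; [exact: cvg_id|exact: cvg_cst].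
have m2 : 0 < mu ^+ 2 by rewrite exprn_even_gt0.
(* near infinity Im G1 is close to its limit, which has the sign of mu *)
have [S0 S1 hS] : exists2 r, 1 < r & 0 < h r.
  have [|S hS] := u1 (`|mu| / 4); first by rewrite divr_gt0// normr_gt0.
  have mx1 : 1 <= Num.max 1 S by rewrite le_max lexx.
  have mxS : S <= Num.max 1 S by rewrite le_max lexx orbT.
  exists (Num.max 1 S + 1); first by lra.
  have r1 : 1 <= Num.max 1 S + 1 by lra.
  rewrite /h max_r//.
  have /hS : S < Num.max 1 S + 1 by lra.
  move=> /(_ t) /(le_trans (normc_Im _)); rewrite ImB.
  move: (Im (G _ + c1)) => v.
  have -> : Im ('i * mu%:C + c1) = mu - Om * Y by rewrite /c1 !ReImE /=; ring.
  move: (Om * Y) lO => oy lO hv.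
  have a1 : `|v - (mu - oy)| ^+ 2 <= (`|mu| / 4) ^+ 2 by rewrite ler_pXn2r ?nnegrE ?divr_ge0.
  move: a1; rewrite expr_div_n !real_normK ?num_real// => a1.
  have := sqr_ge0 (v + (mu - oy)) => a2.
  have a3 : (mu - v) ^+ 2 <= 2 * (v - (mu - oy)) ^+ 2 + 2 * oy ^+ 2.
    by have := sqr_ge0 ((v - (mu - oy)) - (- oy) - 2 * (- oy)); have := sqr_ge0 (v - (mu - oy) + oy); nra.
  by have := sqr_ge0 v; nra.
(* a change of sign along the ray would give a zero of Im G1 in the fluid *)
have h1 : 0 <= h 1.
  rewrite leNgt; apply/negP => h1.
  have [|r rI hr] := @IVT R h 1 S0 0 (ltW S1) (continuous_subspaceT ch).
    by rewrite min_l ?max_r ?(ltW h1) ?(ltW hS) ?(le_trans (ltW h1) (ltW hS)).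
  have r1 : 1 < r.
    rewrite lt_neqAle; move: rI; rewrite in_itv /= => /andP[-> _]; rewrite andbT.
    by apply/eqP => e; move: hr h1; rewrite -e => ->; rewrite ltxx.
  have := Im0 r r1; move: hr; rewrite /h max_r ?(ltW r1)//.
  by move/eqP; rewrite mulf_eq0 (negPf m0) /= => ->.
move: h1; rewrite /h maxxx ImG1 => h1.
have [e1 e2] := ZW_parts t; have [_ hq] := slope_bounds t.
apply: (neg_product e1 e2 _ hq _ h1); first by have := wt_lo nc t; lra.
by apply: le_trans (de t); rewrite lerDr sqr_ge0.
Qed.

Lemma nsqZ'_gt0 t : 0 < nsq (Z' t).
Proof.
rewrite nsqZ' mulr_gt0 ?(nsqZ_gt0 nc)//.
have := exprn_gt0 2 (lt_le_trans (_ : 0 < 1 / 2) (wt_lo nc t)).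
by have := sqr_ge0 (b t) => h /(_ ltac:(lra)); lra.
Qed.

Lemma oint_Q : oint (fun t => Q t) = - (2 * pi * mu).
Proof. by rewrite mulrC divfK ?opprK// pi2_neq0. Qed.

(** Bernoulli keeps |W|, hence Q, away from 0, so Q has the sign of its mean. *)
Lemma sign_large : Lam / 64 < mu ^+ 2 -> forall t, mu * Q t <= 0.
Proof.
move=> mL.
have m0 : mu != 0.
  by apply: contraTneq mL => ->; rewrite expr0n /= -leNgt divr_ge0// ltW.
have Q0 t : Q t != 0.
  rewrite -sqrf_eq0 Q_sq gt_eqF// mulr_gt0 ?nsqZ'_gt0// bernE.
  have := ssmall t; rewrite ler_norml => /andP[hs _].
  by have := ler_wpM2l (ltW Lam0) hs; lra.
move=> t; rewrite leNgt; apply/negP => mt.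
have ch : continuous (fun u => mu * Q u).
  by move=> u; apply: cvgM; [exact: cvg_cst|exact: Q_cont].
have pos u : 0 <= mu * Q u.
  rewrite leNgt; apply/negP => mu_neg.
  have nz r : mu * Q r != 0 by rewrite mulf_neq0.
  have [tu|ut] := leP t u.
    have [|r _ hr] := @IVT R (fun u => mu * Q u) t u 0 tu (continuous_subspaceT ch).
      by rewrite min_r ?max_l ?(ltW mt) ?(ltW mu_neg) ?(le_trans (ltW mu_neg) (ltW mt)).
    by have := nz r; rewrite hr eqxx.
  have [|r _ hr] := @IVT R (fun u => mu * Q u) u t 0 (ltW ut) (continuous_subspaceT ch).
    by rewrite min_l ?max_r ?(ltW mt) ?(ltW mu_neg) ?(le_trans (ltW mu_neg) (ltW mt)).
  by have := nz r; rewrite hr eqxx.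
have c0 : continuous (fun _ : R => 0 : R) by move=> u; exact: cvg_cst.
have := @le_oint _ (fun=> 0) _ c0 ch (fun u _ => pos u).
rewrite oint_cst mulr0 (ointZ _ Q_cont).
have -> : mu * oint (fun t => Q t) = - (2 * pi * mu ^+ 2).
  by move: (oint (fun t => Q t)) (2 * pi) pi2_neq0 => q P P0; field.
have m2 : 0 < mu ^+ 2 by rewrite exprn_even_gt0.
by rewrite oppr_ge0 leNgt (mulr_gt0 (@pi2_gt0 R) m2).
Qed.

Variables (beta d Ym : R).
Hypothesis beta_bound : 0 < beta <= 1 / 2.
Hypothesis d0 : 0 < d.
Hypothesis Y_le : Y <= Ym.
Hypothesis s_le : forall t, `|s t| <= beta / 64.
Hypothesis d_le : d <= lr ^+ 2 / Lam.
Hypothesis beta_le : beta * (4 + 7 * Ym + 18 * Ym ^+ 2) <= d.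

Let n t := normc (Z' t).

Let n_gt0 t : 0 < n t.
Proof.
apply: normc_gt0; apply: contraTneq (nsqZ'_gt0 t) => ->.
by rewrite /nsq /= expr0n addr0 ltxx.
Qed.

Lemma rigid_boundary : forall t, 0 <= t <= 2 * pi -> s t = 0 /\ Q t = - mu * n t.
Proof.
have w0 t : 0 < w t by have := wt_lo nc t; lra.
have [_ isQ] := second_moment.
have bn t : Q t ^+ 2 = (mu ^+ 2 + Lam * s t) * n t ^+ 2 by rewrite Q_sq bernE /n normc_sq.
have sp t : (1 + s t) * w t ^+ 2 <= n t ^+ 2.
  rewrite /n normc_sq nsqZ' addrC subrK mulrC ler_wpM2r ?(ltW (nsqZ_gt0 nc t))//.
  by rewrite lerDr sqr_ge0.
have cs := s_cont nc; have cw := wt_cont nc.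
have [m0|m0] := eqVneq mu 0.
  exact: (@rigid_mu0 R (fun t => s t) w (fun t => Q t) n mu lr Om
    cs cw w0 n_gt0 isw bn (lt0r_neq0 lr0) m0).
have [mL|mL] := leP (mu ^+ 2) (Lam / 64).
  exact: (@rigid_small R (fun t => s t) w (fun t => Q t) n mu lr Om
    cs cw Q_cont w0 n_gt0 (oint_wt nc) isw oint_Q isQ bn sp ssmall
    (lt0r_neq0 lr0) m0 mL (sign_small m0 mL)).
have sb t : `|s t| <= beta * Y.
  have /andP[/ltW be0 _] := beta_bound.
  apply: le_trans (s_le t) _; apply: ler_wpM2l => //.
  by rewrite ler_pdivlMr//; lra.
exact: (@rigid_close R (fun t => s t) w (fun t => Q t) n mu lr Om
    cs cw Q_cont w0 n_gt0 (oint_wt nc) isw oint_Q isQ bn sp ssmall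
    (lt0r_neq0 lr0) beta d Ym m0 Y_le (sign_large mL) beta_bound d0 sb d_le beta_le).
Qed.

Lemma nsqZ1 t : nsq (Z t) = 1.
Proof.
have [u /andP[u0 u2] e] := reduce_mod_2pi 0 t; rewrite add0r in u2.
have uI : 0 <= u <= 2 * pi by rewrite u0 ltW.
rewrite -(e _ (fun t => nsq (Z t))); last by move=> v; rewrite (nc_per nc).
by have [h _] := rigid_boundary uI; rewrite -[LHS](subrK 1) h add0r.
Qed.

Lemma f_circle t : f (p 1 t) * Z t = 'i * mu%:C - lam.
Proof.
have [u /andP[u0 u2] e] := reduce_mod_2pi 0 t; rewrite add0r in u2.
have uI : 0 <= u <= 2 * pi by rewrite u0 ltW.
rewrite -(e _ (fun t => f (p 1 t) * Z t)); last by move=> v; rewrite /pt (nc_per nc).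
have [s0 Qu] := rigid_boundary uI.
have b0 : b u = 0.
  have := nsq_derive nc u; have -> : (fun r => nsq (Z r)) = fun=> 1 by apply/funext => r; exact: nsqZ1.
  move=> du; have := @derive_val _ _ _ _ _ _ _ du.
  by rewrite derive_cst nsqZ1 mulr1 => /esym/eqP; rewrite mulf_eq0 pnatr_eq0 /= => /eqP.
have Lu : L u = 'i * (w u)%:C.
  have -> : L u = Complex (b u) (w u) by rewrite /bt /wt; case: (L u).
  by rewrite b0; apply: eqC; rewrite /=; ring.
have nw : n u = w u.
  apply/eqP; rewrite -(@eqrXn2 _ 2) ?normc_ge0//; last by have := wt_lo nc u; lra.
  by rewrite /n normc_sq nsqZ' nsqZ1 b0 expr0n add0r mulr1.
have w0 : (w u)%:C != 0 :> C.
  by rewrite eq_complex /= negb_and gt_eqF//; have := wt_lo nc u; lra.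
have := GL_bdry u; rewrite s0 Qu nw Lu toC_p1 => h.
have : (Z u * f (p 1 u) + lam) * ('i * (w u)%:C) = ('i * mu%:C) * ('i * (w u)%:C).
  by rewrite h; apply: eqC; rewrite !ReImE /=; ring.
have i0 : 'i != 0 :> C by rewrite eq_complex /= oner_eq0 andbF.
by move=> /(mulIf (mulf_neq0 i0 w0)) <-; ring.
Qed.

(** With s = 0 and Q = - mu |Z'|, G equals i mu on the circle, that is z f = i
    mu - lambda there. *)
Lemma flow_rigid r t : 1 <= r -> f (p r t) = ('i * mu%:C - lam) / toC (p r t).
Proof. exact: (f_pole gc hf inD f_infty cf (winding_neq0 nc) f_circle). Qed.

End Flow.

(** * The orientation of the boundary *)

Section Inward.
Context {R : realType}.
Local Notation C := R[i].

Lemma is_derive_cos1 (t : R) : is_derive t 1 (@cos R) (- sin t).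
Proof. exact: is_derive_cos. Qed.

Lemma cos_ge_half (x : R) : `|x| <= 1 / 2 -> 1 / 2 <= cos x.
Proof.
move=> hx; have := lipschitz_le (M := 1) is_derive_cos1 _ x 0.
rewrite cos0 subr0 mul1r => h.
have : `|cos x - 1| <= `|x|.
  apply: h => t; rewrite normrN ler_norml; apply/andP; split; [exact: sin_geN1|exact: sin_le1].
by rewrite ler_norml => /andP[h1 _]; lra.
Qed.

Lemma cos_le_far (x : R) : 1 / 2 <= `|x| <= pi -> cos x <= 97 / 100.
Proof.
move=> /andP[x1 x2].
have -> : cos x = cos `|x|.
  by case: (leP 0 x) => [h|h]; [rewrite ger0_norm|rewrite ltr0_norm// cosN].
have pi2 : 1 / 2 <= pi :> R by apply: le_trans x1 x2.
have h : cos `|x| <= cos (1 / 2).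
  rewrite leNgt ltr_cos ?in_itv /= ?x2 ?normr_ge0 ?pi2 -?leNgt//.
  by rewrite divr_ge0.
apply: le_trans h _.
have c0 : 1 / 2 <= cos (1 / 2 : R) by apply: cos_ge_half; rewrite ger0_norm// divr_ge0.
have s0 : 1 / 4 <= sin (1 / 2 : R).
  have i0 : 0 <= 1 / 2 :> R by lra.
  have cs : {within `[0, 1 / 2 : R], continuous (@sin R)}.
    by apply: continuous_subspaceT => z; exact: continuous_sin.
  have [y] := MVT_segment i0 (fun z _ => is_derive_sin z) cs.
  rewrite in_itv /= sin0 !subr0 => /andP[y0 y1] ->.
  have : 1 / 2 <= cos y by apply: cos_ge_half; rewrite ger0_norm.
  by lra.
have := cos2Dsin2 (1 / 2 : R); nra.
Qed.

Variables (eta : R) (Z Z' : R -> C).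
Hypothesis nc : near_circle eta Z Z'.
Local Notation p := (pt 0 Z).

Let dot_ge (x y : R) : `|x - y| <= 1 / 2 -> 2 / 5 <= Re (Z' x * ((Z' y)^*)%C).
Proof.
move=> hxy; have e1 := eta1 nc.
have nd r : normc (dcisC r : C) = 1 by rewrite dcisCE normcM normc_i mul1r normc_cis.
have nJ (z : C) : normc (z^*)%C = normc z by case: z => a b /=; rewrite sqrrN.
pose E := (Z' x - dcisC x) * ((Z' y)^*)%C + dcisC x * ((Z' y - dcisC y)^*)%C.
have -> : Re (Z' x * ((Z' y)^*)%C) = cos (x - y) + Re E.
  by rewrite cosB /E; move: (Z' x) (Z' y) => u v; rewrite !ReImE !ReConj !ImConj !ReImE /=; ring.
have hE : `|Re E| <= 1 / 30.
  apply: le_trans (normc_Re _) _; apply: le_trans (normcD _ _) _; rewrite !normcM !nJ nd mul1r.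
  have hx := nc_near' nc x; have hy := nc_near' nc y.
  have : normc (Z' y) <= 1 + 1 / 100.
    by have := normcD (dcisC y) (Z' y - dcisC y); rewrite addrC subrK nd; lra.
  move=> hb; have : normc (Z' x - dcisC x) * normc (Z' y) <= 1 / 100 * (1 + 1 / 100).
    by apply: ler_pM; rewrite ?normc_ge0//; lra.
  by lra.
by have := cos_ge_half hxy; move: hE; rewrite ler_norml => /andP[]; lra.
Qed.

(** For u near t the tangential coordinate is strictly monotone along the curve,
    while the segment has no tangential component; for u far from t the curve is
    further away than the length of the segment. *)
Lemma normal_segment_free (t u r : R) : 0 < r <= 1 / 8 -> Z u <> Z t + r%:C * ('i * Z' t).
Proof.
move=> /andP[r0 r1] e.
have [u' /andP[u1 u2] hu] := reduce_mod_2pi (t - pi) u.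
have eu : Z u' = Z u by apply: (hu _ Z); exact: (nc_per nc).
rewrite -eu in e; move: u' u1 u2 e {hu eu} => v v1 v2 e.
have [near|far] := leP `|v - t| (1 / 2).
  pose g x := Re (Z x * ((Z' t)^*)%C).
  have dg (x : R) : is_derive x 1 g (Re (Z' x * ((Z' t)^*)%C)).
    have [d _] := derCM (nc_deriv nc x) (derC_cst ((Z' t)^*)%C x).
    by move: d; rewrite mulr0 addr0.
  have gv : g v = g t.
    rewrite /g e !ReM !ReD !ImD ReConj ImConj !ReM !ImM /=; ring.
  have key (x y : R) : x < y -> y - x <= 1 / 2 -> t = x \/ t = y -> g x < g y.
    move=> xy yx txy.
    have cg : {within `[x, y], continuous g}.
      by apply: derivable_within_continuous => z _; have [] := dg z.
    have [z zI hz] := MVT_segment (ltW xy) (fun z _ => dg z) cg.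
    rewrite -subr_gt0 hz mulr_gt0 ?subr_gt0//.
    have := @dot_ge z t; move: zI; rewrite in_itv /= => /andP[z1 z2].
    by rewrite ler_norml => /(_ ltac:(case: txy => ->; apply/andP; split; lra)); lra.
  have vt : v = t.
    move: near; rewrite ler_norml => /andP[n1 n2].
    have [vt|vt|//] := ltgtP v t.
      by have := key v t vt ltac:(lra) (or_intror erefl); rewrite gv ltxx.
    by have := key t v vt ltac:(lra) (or_introl erefl); rewrite gv ltxx.
  move: e; rewrite vt -{1}[Z t]addr0 => /addrI /esym/eqP; rewrite !mulf_eq0.
  have -> : (r%:C == 0 :> C) = false by rewrite eq_complex /= gt_eqF.
  have -> : ('i == 0 :> C) = false by rewrite eq_complex /= oner_eq0 andbF.
  move=> /eqP Z'0; have := @dot_ge t t; rewrite subrr normr0 Z'0 mul0r /= => /(_ ltac:(lra)); lra.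
have c97 : cos (v - t) <= 97 / 100.
  by apply: cos_le_far; rewrite (ltW far) /= ler_norml; apply/andP; split; lra.
(* but |cisC v - cisC t|^2 = 2 - 2 cos (v - t) is at least 6 / 100 *)
have : normc (cisC v - cisC t) <= 3 / 20.
  have -> : cisC v - cisC t = - (Z v - cisC v) + ((Z t - cisC t) + r%:C * ('i * (Z' t - dcisC t)) + r%:C * ('i * dcisC t)).
    by rewrite e; ring.
  have h1 := nc_near nc v; have h2 := nc_near nc t; have h3 := nc_near' nc t; have e1 := eta1 nc.
  apply: le_trans (normcD _ _) _; rewrite normcN.
  have := normcD (Z t - cisC t + r%:C * ('i * (Z' t - dcisC t))) (r%:C * ('i * dcisC t)).
  have := normcD (Z t - cisC t) (r%:C * ('i * (Z' t - dcisC t))).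
  rewrite !normcM normc_real gtr0_norm// normc_i !mul1r.
  have -> : normc (dcisC t) = 1 by rewrite dcisCE normcM normc_i mul1r normc_cis.
  have n30 := normc_ge0 (Z' t - dcisC t).
  move: (normc (Z' t - _)) h3 n30 => n3 h3 n30.
  have : r * n3 <= 1 / 8 * (1 / 100) by apply: ler_pM => //; lra.
  by rewrite mulr1; lra.
move=> h; have : normc (cisC v - cisC t) ^+ 2 <= (3 / 20) ^+ 2 by rewrite ler_pXn2r ?nnegrE ?normc_ge0 ?divr_ge0.
rewrite normc_sq /nsq !ReImE /=; move: c97; rewrite cosB.
have := cos2Dsin2 v; have := cos2Dsin2 t; nra.
Qed.

Variable V : set (R * R).
Hypothesis oV : open V.
Hypothesis fV : forall w, frontier V w <-> exists t, w = p 1 t.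
Hypothesis VE : forall w, V w <-> exists s t, 0 <= s < 1 /\ w = p s t.

(** The segment ends at modulus about 7/8, hence inside, and does not meet the
    frontier on the way. *)
Lemma inward_normal t r : 0 < r <= 1 / 8 -> V (ofC (Z t + r%:C * ('i * Z' t))).
Proof.
move=> /andP[r0 r1].
pose c x := ofC (Z t + x%:C * ('i * Z' t)).
apply: (@segment_in R V c r (1 / 8)) => //; last by rewrite lexx r1.
- move=> x; apply: contC_ofC; apply: contCD; first exact: contC_cst.
  by apply: contCM; [apply: contC_real; exact: cvg_id|exact: contC_cst].
- move=> x /andP[x1 x2] /fV [u].
  move=> /(congr1 (@toC R)); rewrite /c ofCK toC_pt add0r mul1r => /esym.
  by apply: normal_segment_free; rewrite x2 (lt_le_trans r0 x1).
exists (1 / 8); first by rewrite r1 lexx.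
have c1 : normc (toC (c (1 / 8))) < 99 / 100.
  rewrite /c ofCK.
  have -> : Z t + (1 / 8)%:C * ('i * Z' t) = (Z t - cisC t) + ((1 / 8)%:C * ('i * (Z' t - dcisC t)) + (7 / 8)%:C * cisC t).
    by rewrite dcisCE; apply: eqC; rewrite !ReImE /=; field.
  have h2 := nc_near nc t; have h3 := nc_near' nc t; have e1 := eta1 nc.
  apply: le_lt_trans (normcD _ _) _.
  have := normcD ((1 / 8)%:C * ('i * (Z' t - dcisC t))) ((7 / 8)%:C * cisC t).
  rewrite !normcM !normc_real !ger0_norm ?divr_ge0// normc_i mul1r normc_cis mulr1; lra.
apply/VE; have [c0|c0] := eqVneq (toC (c (1 / 8))) 0.
  exists 0, 0; split; first by rewrite lexx ltr01.
  by apply: toC_inj; rewrite c0 toC_pt mul0r addr0.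
have [s [u [s0 e]]] := nc_surj nc c0.
exists s, u; split; last by apply: toC_inj; rewrite e toC_pt add0r.
rewrite (ltW s0) /=; move: c1; rewrite e normcM normc_real gtr0_norm//.
have := nc_lo nc u; have := eta1 nc; nra.
Qed.
End Inward.

(** * Hollow vortices *)

Section Vortex.
Context {R : realType}.
Local Notation C := R[i].

Lemma toC_derC (Zr : R -> R * R) t : derivable Zr t 1 ->
  derC (fun t => toC (Zr t)) t (toC (derive1 Zr t)).
Proof.
move=> /derivable1_diffP dZ.
have h : is_diff t Zr ('d Zr t) by apply: DiffDef.
have e : 'd Zr t 1 = derive1 Zr t by rewrite derive1E deriveE.
split.
  have := is_derive_of_diff (is_diff_comp h (is_diff_fst (Zr t))).
  by rewrite /= e.
have := is_derive_of_diff (is_diff_comp h (is_diff_snd (Zr t))).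
by rewrite /= e.
Qed.

Lemma contC_toC {T : topologicalType} (g : T -> R * R) x : {for x, continuous g} -> contC (fun y => toC (g y)) x.
Proof.
move=> cg; split.
  by apply: (@continuous_comp _ _ _ g (fst : R * R -> R)); [exact: cg|exact: cont_fst].
by apply: (@continuous_comp _ _ _ g (snd : R * R -> R)); [exact: cg|exact: cont_snd].
Qed.

Lemma enormE (v : R * R) : enorm v = normc (toC v).
Proof. by rewrite /enorm /dotp -!expr2. Qed.

Lemma plane_diff (E : normedModType R) (g : R * R -> E) (x h : R * R) : differentiable g x ->
  'd g x h = h.1 *: 'D_e1 g x + h.2 *: 'D_e2 g x.
Proof.
move=> dg; rewrite !deriveE// -!linearZ -linearD; congr ('d g x _).
by case: h => a b; apply: injective_projections; rewrite /= /GRing.scale /=; ring.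
Qed.

Lemma is_diff_fstU (U : R * R -> R * R) x : differentiable U x ->
  is_diff x (fun y => (U y).1) (fun h => h.1 * ('D_e1 U x).1 + h.2 * ('D_e2 U x).1).
Proof.
move=> dU; have h : is_diff x U ('d U x) by apply: DiffDef.
have := is_diff_comp h (is_diff_fst (U x)).
by move=> /is_diff_eqf; apply=> // v; rewrite /= plane_diff.
Qed.

Lemma is_diff_sndU (U : R * R -> R * R) x : differentiable U x ->
  is_diff x (fun y => (U y).2) (fun h => h.1 * ('D_e1 U x).2 + h.2 * ('D_e2 U x).2).
Proof.
move=> dU; have h : is_diff x U ('d U x) by apply: DiffDef.
have := is_diff_comp h (is_diff_snd (U x)).
by move=> /is_diff_eqf; apply=> // v; rewrite /= plane_diff.
Qed.

Lemma partial_of_diff (g dg : R * R -> R) (x v : R * R) : is_diff x g dg -> 'D_v g x = dg v.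
Proof. by move=> h; rewrite deriveE ?diff_val. Qed.

Variables (gamma Omega kappa : R) (V : set (R * R)) (U : R * R -> R * R) (P : R * R -> R).
Hypothesis kappa0 : 0 < kappa.
Hypothesis hv : hollow_vortex gamma Omega kappa V U P.
Variables (eta : R) (Zr : R -> R * R).
Local Notation Z := (fun t => toC (Zr t)).
Local Notation Z' := (fun t => toC (derive1 Zr t)).
Local Notation p := (pt 0 Z).
Local Notation lr := ((2 * kappa)^-1).
Local Notation lam := (Complex lr Omega).
Local Notation Lam := (lr ^+ 2 + Omega ^+ 2).
Hypothesis dZr : forall t, derivable Zr t 1.
Hypothesis cZr' : continuous (derive1 Zr).
Hypothesis pZr : parametrizes Zr (frontier V).
Hypothesis nc : near_circle eta Z Z'.
Let gc := nc_gauge nc.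

Lemma p1Zr t : p 1 t = Zr t.
Proof. by apply: toC_inj; rewrite toC_pt add0r mul1r. Qed.

Lemma frontier_curve x : frontier V x <-> exists t, x = p 1 t.
Proof.
have [per inj im] := pZr; rewrite -im; split.
  by move=> [t _ <-]; exists t; rewrite p1Zr.
move=> [t ->]; rewrite p1Zr; have [u uI h] := reduce_mod_2pi 0 t.
exists u; first by rewrite /= in_itv /=; rewrite add0r in uI.
exact: h per.
Qed.

Lemma core_nonempty : V !=set0.
Proof.
have [c _] : frontier V (p 1 0) by apply/frontier_curve; exists 0.
by have [x [Vx _]] := c setT filterT; exists x.
Qed.

Let oV := core_open hv.
Let bV := core_bounded hv.
Let fV := frontier_curve.
Let V0 := core_nonempty.
Let fluid x : fluid_domain V x <-> exists s t, 1 < s /\ x = p s t.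
Proof. exact: (fluidP nc oV bV fV V0). Qed.

Let oD : open (fluid_domain V).
Proof. exact: fluid_open. Qed.

Let clD x : closure (fluid_domain V) x <-> exists s t, 1 <= s /\ x = p s t.
Proof. exact: (closure_fluidP nc oV bV fV V0). Qed.

Let VE x : V x <-> exists s t, 0 <= s < 1 /\ x = p s t.
Proof. exact: (coreP nc oV bV fV V0). Qed.

Lemma Z'_neq0 t : Z' t != 0.
Proof. by apply: contraTneq (nsqZ'_gt0 nc t) => ->; rewrite /nsq /= expr0n addr0 ltxx. Qed.

(** The circulation and impermeability conditions are available for
    counterclockwise boundary parametrizations, so the given curve has to be
    shown to be one; its inner normal points into V by [inward_normal]. *)
Lemma curve_ccw : ccw_boundary_param Zr V.
Proof.
split; [exact: pZr|exact: dZr|exact: cZr'| |].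
  by move=> t e; have := Z'_neq0 t; rewrite e eq_complex /= eqxx.
move=> t; exists (1 / 8); first by rewrite /= divr_gt0.
move=> r /=; rewrite sub0r normrN => r1 r0.
have := @inward_normal R eta Z Z' nc V oV fV VE t r.
rewrite r0 (ltW (le_lt_trans (ler_norm r) r1)) => /(_ isT).
congr (V _); apply: toC_inj; rewrite ofCK.
by case: (Zr t) (derive1 Zr t) => a b [c d]; apply: eqC; rewrite /= /GRing.scale /=; ring.
Qed.

Let f (x : R * R) : C := Complex (lab_velocity Omega kappa U x).1 (- (lab_velocity Omega kappa U x).2).

Lemma lab_conj x : f x + lam * ((toC x)^*)%C = Complex (U x).1 (- (U x).2).
Proof. by rewrite /f; case: x => a b; apply: eqC; rewrite /= /GRing.scale /=; ring. Qed.

Lemma boundary_velocity t : f (p 1 t) + lam * ((Z t)^*)%C = Complex (U (Zr t)).1 (- (U (Zr t)).2).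
Proof. by rewrite p1Zr lab_conj. Qed.

Lemma boundary_tangent t : Im ((f (p 1 t) + lam * ((Z t)^*)%C) * Z' t) = 0.
Proof.
rewrite boundary_velocity; have := impermeable hv curve_ccw t.
rewrite /unit_normal /unit_tangent /dotp /perp /= /GRing.scale /=.
have n0 : enorm (derive1 Zr t) != 0 by rewrite enormE gt_eqF// normc_gt0// Z'_neq0.
move=> h; apply: (mulfI (invr_neq0 n0)); rewrite mulr0; apply: etrans h; ring.
Qed.

Lemma boundary_circulation :
  oint (fun t => Re ((f (p 1 t) + lam * ((Z t)^*)%C) * Z' t)) = gamma - 2 * Omega * fine (area V).
Proof.
rewrite -(circulation hv curve_ccw); apply: eq_oint => t.
rewrite boundary_velocity /unit_tangent /dotp /= /GRing.scale /=.
have n0 : enorm (derive1 Zr t) != 0 by rewrite enormE gt_eqF// normc_gt0// Z'_neq0.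
by field.
Qed.

Let cU : continuous (fun q : R * R => U (p (Num.max 1 q.1) q.2)).
Proof. exact: (within_scaled nc oV bV fV V0 (velocity_continuous hv)). Qed.

Let cP : continuous (fun q : R * R => P (p (Num.max 1 q.1) q.2)).
Proof. exact: (within_scaled nc oV bV fV V0 (pressure_continuous hv)). Qed.

Let cp : continuous (fun q : R * R => p (Num.max 1 q.1) q.2).
Proof. exact: (within_scaled nc oV bV fV V0 (F := id) (continuous_subspaceT (fun x => cvg_id))). Qed.

Lemma lab_boundary_cont q : contC (fun q : R * R => f (p (Num.max 1 q.1) q.2)) q.
Proof.
have [a1 a2] := contC_toC (@cU q); have [b1 b2] := contC_toC (@cp q).
split.
  apply: (@continuous_at_eq _ _ (fun q : R * R => (U (p (Num.max 1 q.1) q.2)).1 - lr * (p (Num.max 1 q.1) q.2).1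
     + Omega * - (p (Num.max 1 q.1) q.2).2)) => [|y]; last by [].
  apply: cvgD; first (apply: cvgB; first exact: a1).
    by apply: cvgM; [exact: cvg_cst|exact: b1].
  by apply: cvgM; [exact: cvg_cst|apply: cvgN; exact: b2].
apply: (@continuous_at_eq _ _ (fun q : R * R => - ((U (p (Num.max 1 q.1) q.2)).2 - lr * (p (Num.max 1 q.1) q.2).2
     + Omega * (p (Num.max 1 q.1) q.2).1))) => [|y]; last by [].
apply: cvgN; apply: cvgD; first (apply: cvgB; first exact: a2).
  by apply: cvgM; [exact: cvg_cst|exact: b2].
by apply: cvgM; [exact: cvg_cst|exact: b1].
Qed.

Hypothesis vanish : vanishes_at_infinity V (lab_velocity Omega kappa U).

Lemma lab_infty : ulim Z f 0.
Proof.
move=> e e0; have [M hM] := vanish e0; exists (Num.max 1 (2 * M)) => s t.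
rewrite gt_max => /andP[s1 sM]; rewrite subr0.
have s0 : 0 <= s by lra.
have : enorm (lab_velocity Omega kappa U (p s t)) < e.
  apply: hM; first by apply/clD; exists s, t; rewrite (ltW s1).
  rewrite enormE (normc_p _ _ s0); have := gc_lo gc t; nra.
by rewrite enormE /f /= sqrrN => /ltW.
Qed.

Let A x := 'D_e1 U x.
Let B x := 'D_e2 U x.

(** The two first-order equations are the Cauchy-Riemann equations for f, up to
    the constants carried by lambda. *)
Lemma velocity_gradient x : fluid_domain V x ->
  (B x).1 = (A x).2 + 2 * Omega /\ (B x).2 = 2 * lr - (A x).1.
Proof.
move=> Dx; have [dU _ _] := velocity_C1 hv Dx.
have d1 := is_diff_fstU dU; have d2 := is_diff_sndU dU.
have := divergence_eq hv Dx; have := curl_eq hv Dx; rewrite /divergence /curl.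
rewrite (partial_of_diff e1 d1) (partial_of_diff e2 d2) (partial_of_diff e1 d2) (partial_of_diff e2 d1).
have -> : kappa^-1 = 2 * lr by field; rewrite gt_eqF.
rewrite /A /B /=; clear d1 d2 dU; move: lr ('D_e1 U x) ('D_e2 U x) => l [a1 a2] [b1 b2] /= h1 h2.
by split; lra.
Qed.

Let f' (x : R * R) : C := Complex ((A x).1 - lr) (- ((A x).2 + Omega)).

Lemma lab_holo : holo (fluid_domain V) f f'.
Proof.
move=> x Dx; have [dU cA cB] := velocity_C1 hv Dx.
have d1 := is_diff_fstU dU; have d2 := is_diff_sndU dU.
have [g1 g2] := velocity_gradient Dx.
have [l1 l2] := (is_diff_fst x, is_diff_snd x).
have sZ (c : R) (g dg : R * R -> R) : is_diff x g dg -> is_diff x (fun y => c * g y) (fun h => c * dg h).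
  by move=> h; have := is_diffZ c h; apply.
split; last first.
  have [a1 a2] := contC_toC cA.
  by split; [apply: cvgB; [exact: a1|exact: cvg_cst]|apply: cvgN; apply: cvgD; [exact: a2|exact: cvg_cst]].
split.
  have := is_diffD (is_diffB d1 (sZ lr _ _ l1)) (sZ (- Omega) _ _ l2).
  move=> /is_diff_eqf; apply.
    by move=> y; rewrite !fctE /f /= /GRing.scale /=; ring.
  move=> [h1 h2]; rewrite !fctE /f'; move: g1 g2; rewrite /A /B.
  by clear; move: lr ('D_e1 U x) ('D_e2 U x) => l [a1 a2] [b1 b2] /= e1 e2; rewrite ?e1 ?e2; ring.
have := is_diffN (is_diffD (is_diffB d2 (sZ lr _ _ l2)) (sZ Omega _ _ l1)).
move=> /is_diff_eqf; apply.
  by move=> y; rewrite !fctE /f /= /GRing.scale /=; ring.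
move=> [h1 h2]; rewrite !fctE /f'; move: g1 g2; rewrite /A /B.
  by clear; move: lr ('D_e1 U x) ('D_e2 U x) => l [a1 a2] [b1 b2] /= e1 e2; rewrite ?e1 ?e2; ring.
Qed.

Let H (x : R * R) := ((U x).1 ^+ 2 + (U x).2 ^+ 2) / 2 - Lam * (x.1 ^+ 2 + x.2 ^+ 2) / 2 + P x.

(** The Bernoulli function |U|^2 / 2 - |lambda|^2 |x|^2 / 2 + P: the curl
    equation turns the advection term into the gradient of |U|^2 / 2 minus the
    Coriolis term. *)
Lemma bernoulli_diff x : fluid_domain V x -> is_diff x H (fun=> 0).
Proof.
move=> Dx; have [dU _ _] := velocity_C1 hv Dx; have [dP _ _] := pressure_C1 hv Dx.
have d1 := is_diff_fstU dU; have d2 := is_diff_sndU dU.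
have d3 : is_diff x P ('d P x) by apply: DiffDef.
have [g1 g2] := velocity_gradient Dx.
have [l1 l2] := (is_diff_fst x, is_diff_snd x).
have sZ (c : R) (g dg : R * R -> R) : is_diff x g dg -> is_diff x (fun y => c * g y) (fun h => c * dg h).
  by move=> h; have := is_diffZ c h; apply.
have lE : lr ^+ 2 = (4 * kappa ^+ 2)^-1 by field; rewrite gt_eqF.
have := momentum hv Dx; rewrite /advection /grad /perp -/(A x) -/(B x) -lE.
case=> m1 m2.
have := is_diffD (is_diffB (sZ (1 / 2) _ _ (is_diffD (is_diffM d1 d1) (is_diffM d2 d2)))
  (sZ (Lam / 2) _ _ (is_diffD (is_diffM l1 l1) (is_diffM l2 l2)))) d3.
move=> /is_diff_eqf; apply.
  by move=> y; rewrite !fctE /H /=; move: Lam => L; field.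
move=> h; rewrite !fctE /= (plane_diff h dP) /GRing.scale /= -/(A x) -/(B x).
have p1 : 'D_e1 P x = - ((U x).1 * (A x).1 + (U x).2 * (B x).1 - 2 * Omega * (U x).2 - Lam * x.1).
  rewrite -['D_e1 P x]opprK; congr (- _); apply: (etrans (esym m1)); clear.
  by move: Lam (A x) (B x) (U x) => L [a1 a2] [b1 b2] [u1 u2]; rewrite /= /GRing.scale /=; ring.
have p2 : 'D_e2 P x = - ((U x).1 * (A x).2 + (U x).2 * (B x).2 + 2 * Omega * (U x).1 - Lam * x.2).
  rewrite -['D_e2 P x]opprK; congr (- _); apply: (etrans (esym m2)); clear.
  by move: Lam (A x) (B x) (U x) => L [a1 a2] [b1 b2] [u1 u2]; rewrite /= /GRing.scale /=; ring.
move: p1 p2 g1 g2; move: ('D_e1 P x) ('D_e2 P x) lr Lam (A x) (B x) (U x).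
by move=> q1 q2 l L [a1 a2] [b1 b2] [u1 u2] /= -> -> -> ->; field.
Qed.

(** A vanishing gradient makes the Bernoulli function constant along rays and
    along the scaled curves; it is continuous up to the boundary, where P is
    constant. *)
Lemma bernoulli_boundary : exists Bc, forall t,
  nsq (f (p 1 t) + lam * ((Z t)^*)%C) = Bc + Lam * (nsq (Z t) - 1).
Proof.
pose Hc x : C := (H x)%:C.
have dH s t : 1 < s -> cdiff Hc (fun=> 0) (p s t).
  move=> s1; have Dp : fluid_domain V (p s t) by apply/fluid; exists s, t.
  split; first by apply: (is_diff_eqf (bernoulli_diff Dp)) => // h; rewrite mul0r.
  exact: (proj2 (cdiff_cst (0 : C) (p s t))).
have along_ray t : H (p 1 t) = H (p 2 t).
  pose h s := H (p (Num.max 1 s) t).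
  have ch : {for 1, continuous h}.
    have cq : {for (1 : R), continuous (fun s : R => (s, t))}.
      by apply: continuous_at_pair; [exact: cvg_id|exact: cvg_cst].
    have [a1 a2] := contC_toC (@cU (1, t)); have [b1 b2] := contC_toC (@cp (1, t)).
    have c3 := @cP (1, t).
    apply: (@continuous_comp _ _ _ (fun s : R => (s, t)) (fun q : R * R => H (p (Num.max 1 q.1) q.2))) => //.
    have sq (g : R * R -> R) : {for (1, t), continuous g} -> {for (1, t), continuous (fun q => g q ^+ 2)}.
      by move=> cg; apply: (@continuous_at_eq _ _ (fun q => g q * g q)) => [|y //]; apply: cvgM; exact: cg.
    rewrite /H; apply: cvgD; last exact: c3.
    apply: cvgB; apply: cvgM; try exact: cvg_cst.
      by apply: cvgD; [exact: (sq _ a1)|exact: (sq _ a2)].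
    by apply: cvgM; [exact: cvg_cst|apply: cvgD; [exact: (sq _ b1)|exact: (sq _ b2)]].
  have e s : 1 < s < 3 -> H (p s t) = H (p 2 t).
    move=> sI; apply: (@derive0_const _ (fun s => H (p s t)) 1 3) => //; last by apply/andP; split; lra.
    move=> r /andP[r1 _]; have := @cdiff_chain _ Hc (fun=> 0) (fun s => p s t) r _ (dH r t r1) (derC_pt_sg Z 0 r t).
    by rewrite mul0r => -[].
  have := @right_const _ h 1 2 (H (p 2 t)) ltac:(lra) ch; rewrite /h maxxx; apply.
  by move=> y /andP[y1 y2]; rewrite max_r ?(ltW y1)// e// y1; lra.
have along_curve t : H (p 2 t) = H (p 2 0).
  apply: (@derive0_const _ (fun t => H (p 2 t)) (- `|t| - 1) (`|t| + 1)).
  - move=> r _; have := @cdiff_chain _ Hc (fun=> 0) (fun s => p 2 s) r _ (dH 2 r ltac:(lra)) (derC_pt_t (nc_deriv nc) 0 2 r).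
    by rewrite mul0r => -[].
  - by have := ler_norm t; have := ler_norm (- t); rewrite normrN => *; apply/andP; split; lra.
  - by have := normr_ge0 t => *; apply/andP; split; lra.
have [P0 hP] := pressure_constant hv.
exists (2 * (H (p 2 0) - P0) + Lam) => t.
rewrite boundary_velocity.
have := along_ray t; rewrite along_curve => <-.
rewrite /H p1Zr hP; last by rewrite -p1Zr; apply/fV; exists t.
by rewrite /nsq /= sqrrN; move: Lam => L; field.
Qed.


Hypothesis areaV : area V = pi%:E.
Hypothesis eta_small : eta <= 1 / 200.
Variables (beta d Ym : R).
Hypothesis beta_bound : 0 < beta <= 1 / 2.
Hypothesis d0 : 0 < d.
Hypothesis Y_le : (Omega - gamma / (2 * pi)) ^+ 2 / Lam <= Ym.
Hypothesis eta_beta : eta <= beta / 192.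
Hypothesis d_le : d <= lr ^+ 2 / Lam.
Hypothesis beta_le : beta * (4 + 7 * Ym + 18 * Ym ^+ 2) <= d.

Lemma nsqZ_near t : `|nsq (Z t) - 1| <= 3 * eta.
Proof.
have h1 := nc_lo nc t; have h2 := nc_hi nc t; have e0 := eta0 nc; have e1 := eta1 nc.
by rewrite -normc_sq ler_norml; apply/andP; split; nra.
Qed.

(** The enclosed area is the integral of |Z|^2 w / 2, and the integral of w is 2
    pi. *)
Lemma mean_excess : oint (fun t => (nsq (Z t) - 1) * wt Z Z' t) = 0.
Proof.
have cA := nsqZ_cont nc; have cw := wt_cont nc.
have cAw : continuous (fun t => nsq (Z t) * wt Z Z' t).
  by move=> t; apply: cvgM; [exact: cA|exact: cw].
have e1 : (fun t => (nsq (Z t) - 1) * wt Z Z' t) =1 (fun t => nsq (Z t) * wt Z Z' t - wt Z Z' t).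
  by move=> t; rewrite mulrBl mul1r.
rewrite (eq_oint e1) (ointB cAw cw) (oint_wt nc).
have := area_contour nc oV VE; rewrite areaV => -[].
have e2 : (fun t => nsq (Z t) * wt Z Z' t / 2) =1 (fun t => 2^-1 * (nsq (Z t) * wt Z Z' t)).
  by move=> t; rewrite mulrC.
by rewrite (eq_oint e2) (ointZ _ cAw); lra.
Qed.

Lemma boundary_mean :
  - (oint (fun t => Re ((f (p 1 t) + lam * ((Z t)^*)%C) * Z' t))) / (2 * pi) = Omega - gamma / (2 * pi).
Proof.
rewrite boundary_circulation areaV /=.
have -> : 2 * Omega * pi = 2 * pi * Omega by ring.
by move: (2 * pi) (@pi2_neq0 R) => q q0; field.
Qed.

Lemma vortex_rigid : (forall t, nsq (Z t) = 1) /\ forall r t, 1 <= r ->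
  f (p r t) = Complex (- lr) (- (gamma / (2 * pi))) / toC (p r t).
Proof.
have inD r t : 1 < r -> fluid_domain V (p r t) by move=> r1; apply/fluid; exists r, t.
have Dp x : fluid_domain V x -> exists s t, 1 < s /\ x = p s t by move=> /fluid.
have lr0 : 0 < lr by rewrite invr_gt0 mulr_gt0.
have [Bc bern] := bernoulli_boundary.
have s64 t : `|nsq (Z t) - 1| <= 1 / 64 by apply: le_trans (nsqZ_near t) _; have := eta_small; lra.
have sb t : `|nsq (Z t) - 1| <= beta / 64 by apply: le_trans (nsqZ_near t) _; have := eta_beta; lra.
have Yle := Y_le; rewrite -boundary_mean in Yle.
split.
  exact: (nsqZ1 nc oD inD Dp lab_holo lab_infty lab_boundary_cont lr0 boundary_tangent bern
    mean_excess s64 eta_small beta_bound d0 Yle sb d_le beta_le).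
move=> r t r1.
rewrite (flow_rigid nc oD inD Dp lab_holo lab_infty lab_boundary_cont lr0 boundary_tangent bern
    mean_excess s64 eta_small beta_bound d0 Yle sb d_le beta_le t r1) boundary_mean.
by congr (_ / _); apply: eqC; rewrite !ReImE /=; ring.
Qed.

Lemma core_disk : V = unit_disk.
Proof.
have [Z1 _] := vortex_rigid.
have nZ t : normc (Z t) = 1.
  by apply/eqP; rewrite -(@eqrXn2 _ 2) ?normc_ge0// normc_sq Z1 expr1n.
apply/seteqP; split => x.
  move=> /VE [s [t [/andP[s0 s1] ->]]].
  by rewrite /unit_disk /= enormE (normc_p _ _ s0) nZ mulr1.
rewrite /unit_disk /= enormE => x1; apply/VE.
have [x0|x0] := eqVneq (toC x) 0.
  exists 0, 0; split; first by rewrite lexx ltr01.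
  by apply: toC_inj; rewrite x0 toC_pt mul0r addr0.
have [s [t [s0 e]]] := nc_surj nc x0.
exists s, t; split; last by apply: toC_inj; rewrite e toC_pt add0r.
by move: x1; rewrite e normcM nZ mulr1 normc_real gtr0_norm// => ->; rewrite ltW.
Qed.

Lemma velocity_disk x : closure (fluid_domain V) x -> U x = disk_velocity gamma Omega kappa x.
Proof.
have [Z1 hf] := vortex_rigid.
move=> /clD [r [t [r1 xE]]]; have := hf r t r1; rewrite -xE => fx.
have n0 : nsq (toC x) != 0.
  by rewrite gt_eqF// nsq_gt0// xE toC_pt add0r mulf_neq0 ?(nc_neq0 nc)// eq_complex /= gt_eqF//; lra.
have e2 : enorm x ^+ 2 = nsq (toC x) by rewrite enormE normc_sq.
have := lab_conj x; rewrite fx /disk_velocity e2; move: (gamma / (2 * pi)) lr => g l.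
move: n0; case: (U x) => u1 u2; case: x {xE fx e2} => a b; rewrite /nsq /= => n0 [h1 h2].
apply: injective_projections; rewrite /= /GRing.scale /=.
  by rewrite -h1; field.
by apply: oppr_inj; rewrite -h2; field.
Qed.

End Vortex.

(** * Constants and conclusion *)

Section Closeness.
Context {R : realType}.
Local Notation C := R[i].

Lemma sup_norm_ub (A : R -> R * R) t : ((enorm (A t))%:E <= sup_norm A)%E.
Proof. by apply: ereal_sup_ubound; exists t. Qed.

Lemma sup_norm_ge0 (A : R -> R * R) : (0 <= sup_norm A)%E.
Proof. by apply: le_trans (sup_norm_ub A 0); rewrite lee_fin sqrtr_ge0. Qed.

Lemma holder_ge0 alpha (A : R -> R * R) : (0 <= holder_seminorm alpha A)%E.
Proof.
apply: le_trans (_ : (_ <= (enorm (A 0 - A 1) / `|0 - 1| `^ alpha)%:E)%E) _.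
  by rewrite lee_fin divr_ge0 ?sqrtr_ge0// powR_ge0.
by apply: ereal_sup_ubound; exists (0, 1) => //=; rewrite eq_sym oner_eq0.
Qed.

(** The three terms of the norm are nonnegative, so each of them is bounded by
    their sum. *)
Lemma C1alpha_norm_bounds alpha (A : R -> R * R) (e : R) : (C1alpha_norm alpha A <= e%:E)%E ->
  forall t, enorm (A t) <= e /\ enorm (derive1 A t) <= e.
Proof.
have s0 := sup_norm_ge0 A; have s1 := sup_norm_ge0 (derive1 A); have h0 := holder_ge0 alpha (derive1 A).
move=> hN t; split; rewrite -lee_fin; apply: le_trans hN; rewrite /C1alpha_norm.
  apply: le_trans (sup_norm_ub A t) _.
  by rewrite -addeA leeDl// adde_ge0.
apply: le_trans (sup_norm_ub (derive1 A) t) _.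
by rewrite addeAC leeDr// adde_ge0.
Qed.

Lemma is_derive_cis (t : R) : derivable (@cis R) t 1 /\ derive1 (@cis R) t = (- sin t, cos t).
Proof.
have dc := is_diff_of_derive (is_derive_cos t); have ds := is_diff_of_derive (is_derive_sin t).
have d := is_diff_pair dc ds.
have dd : differentiable (@cis R) t by exact: (ex_diff (is_diff_def := d)).
split; first exact/derivable1_diffP.
rewrite derive1E deriveE//.
have -> : 'd (@cis R) t = (fun h => (h * - sin t, h * cos t)) :> (R -> R * R).
  by exact: (diff_val (is_diff_def := d)).
by rewrite !mul1r.
Qed.

Lemma near_circle_of_norm alpha (Zr : R -> R * R) (e : R) : C1alpha_per alpha Zr ->
  (C1alpha_norm alpha (Zr \- @cis R)%R <= e%:E)%E -> e <= 1 / 100 ->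
  near_circle e (fun t => toC (Zr t)) (fun t => toC (derive1 Zr t)).
Proof.
move=> [per dZ cZ' _] hN e1; have bnd := C1alpha_norm_bounds hN.
have e0 : 0 <= e by have [h _] := bnd 0; apply: le_trans h; exact: sqrtr_ge0.
split.
- by rewrite e0.
- by move=> t; apply: toC_derC.
- by move=> t; apply: contC_toC; exact: cZ'.
- by move=> t; rewrite per.
- move=> t; have [h _] := bnd t; move: h; rewrite enormE.
  by congr (normc _ <= _); apply: eqC; rewrite /= .
move=> t; have [_ h] := bnd t; move: h; rewrite enormE; have [dc ec] := is_derive_cis t.
have eD : derive1 (Zr \- @cis R)%R t = derive1 Zr t - derive1 (@cis R) t.
  by rewrite !derive1E (deriveB (dZ t) dc).
rewrite eD ec.
by congr (normc _ <= _); apply: eqC; rewrite /= .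
Qed.
End Closeness.

(** For parameters near (g0, O0, k0) the ratio mu^2 / |lambda|^2 stays below Ym
    and (Re lambda)^2 / |lambda|^2 above d; beta is then chosen for
    [integrand_bound_close]. *)
Lemma parameter_bounds (R : realType) (g0 O0 k0 : R) : 0 < k0 ->
  exists beta d Ym : R, [/\ 0 < beta <= 1 / 2, 0 < d, beta * (4 + 7 * Ym + 18 * Ym ^+ 2) <= d &
  forall g Om k : R, `|g - g0| <= 1 -> `|Om - O0| <= 1 -> `|k - k0| <= k0 / 2 ->
    let lr := (2 * k)^-1 in
    (Om - g / (2 * pi)) ^+ 2 / (lr ^+ 2 + Om ^+ 2) <= Ym /\ d <= lr ^+ 2 / (lr ^+ 2 + Om ^+ 2)].
Proof.
move=> k00.
pose l0 := (3 * k0)^-1; pose l1 := k0^-1; pose M := `|O0| + `|g0| + 2.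
pose d := l0 ^+ 2 / (l1 ^+ 2 + (`|O0| + 1) ^+ 2).
pose Ym := M ^+ 2 / l0 ^+ 2.
have l00 : 0 < l0 by rewrite invr_gt0 mulr_gt0.
have l10 : 0 < l1 by rewrite invr_gt0.
have l02 : 0 < l0 ^+ 2 by rewrite exprn_gt0.
have l12 : 0 < l1 ^+ 2 + (`|O0| + 1) ^+ 2 by rewrite ltr_pwDl ?sqr_ge0// exprn_gt0.
have d0 : 0 < d by rewrite divr_gt0.
have Y0 : 0 <= Ym by rewrite divr_ge0 ?sqr_ge0.
pose q := 4 + 7 * Ym + 18 * Ym ^+ 2.
have q0 : 0 < q by have := sqr_ge0 Ym; rewrite /q; lra.
pose beta := Num.min (1 / 2) (d / q).
have b1 : beta <= 1 / 2 by rewrite ge_min lexx.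
have b2 : beta <= d / q by rewrite ge_min lexx orbT.
have b0 : 0 < beta by rewrite lt_min; apply/andP; split; rewrite divr_gt0.
exists beta, d, Ym; split => //; first by rewrite b0.
  by rewrite -/q -ler_pdivlMr.
move=> g Om k hg hO hk lr.
move: hk; rewrite ler_norml => /andP[k1 k2].
have kp : 0 < k by lra.
have lp : l0 <= lr by rewrite lef_pV2 ?posrE ?mulr_gt0//; lra.
have lp1 : lr <= l1 by rewrite lef_pV2 ?posrE ?mulr_gt0//; lra.
have lr0 : 0 < lr by rewrite invr_gt0 mulr_gt0.
have lsq : l0 ^+ 2 <= lr ^+ 2 by rewrite ler_pXn2r ?nnegrE ?(ltW l00) ?(ltW lr0).
have lsq1 : lr ^+ 2 <= l1 ^+ 2 by rewrite ler_pXn2r ?nnegrE ?(ltW l10) ?(ltW lr0).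
have aO : `|Om| <= `|O0| + 1 by have := ler_normD O0 (Om - O0); rewrite addrC subrK; lra.
have ag : `|g| <= `|g0| + 1 by have := ler_normD g0 (g - g0); rewrite addrC subrK; lra.
have Osq : Om ^+ 2 <= (`|O0| + 1) ^+ 2.
  by rewrite -(@real_normK _ Om) ?num_real// ler_pXn2r ?nnegrE ?addr_ge0.
have L0 : 0 < lr ^+ 2 + Om ^+ 2 by rewrite ltr_pwDl ?sqr_ge0// exprn_gt0.
have pi21 : 1 <= 2 * pi :> R by have := @pi_ge2 R; lra.
have am : `|Om - g / (2 * pi)| <= M.
  apply: le_trans (ler_normB _ _) _; rewrite normrM [`|_^-1|]ger0_norm ?invr_ge0 ?(le_trans ler01)//.
  have : `|g| / (2 * pi) <= `|g| by rewrite ler_pdivrMr ?(lt_le_trans ltr01)// ler_peMr.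
  by rewrite /M; lra.
split.
  have mM : (Om - g / (2 * pi)) ^+ 2 <= M ^+ 2.
    by rewrite -(@real_normK _ (Om - _)) ?num_real// ler_pXn2r ?nnegrE// ?addr_ge0.
  rewrite /Ym ler_pdivrMr// mulrAC ler_pdivlMr//.
  apply: ler_pM; rewrite ?sqr_ge0 ?(ltW l02)//.
  by have := sqr_ge0 Om; lra.
rewrite /d ler_pdivrMr// mulrAC ler_pdivlMr//.
apply: ler_pM; rewrite ?(ltW l02) ?(ltW L0)//.
by lra.
Qed.

Theorem theorem1p2 (R : realType) (m : nat) (hm : (2 <= m)%N)
    (alpha : R) (halpha : 0 < alpha < 1)
    (gamma0 Omega0 kappa0 : R) (hkappa0 : 0 < kappa0) :
  exists2 eps : R, 0 < eps &
    forall (gamma Omega kappa : R) (V : set (R * R))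
           (U : R * R -> R * R) (P : R * R -> R),
      0 < kappa ->
      hollow_vortex gamma Omega kappa V U P ->
      mfold_symmetric m V U ->
      area V = pi%:E ->
      vanishes_at_infinity V (lab_velocity Omega kappa U) ->
      (exists Z : R -> R * R,
        [/\ C1alpha_per alpha Z,
            parametrizes Z (frontier V)
          & (C1alpha_norm alpha (Z \- cis)%R
               + (`|gamma - gamma0| + `|kappa - kappa0| + `|Omega - Omega0|)%R%:E
               < eps%:E)%E]) ->
      V = unit_disk /\
      forall xi, closure (fluid_domain V) xi ->
        U xi = disk_velocity gamma Omega kappa xi.
Proof.
have [beta [d [Ym [bI d0 bd pb]]]] := parameter_bounds gamma0 Omega0 hkappa0.
have /andP[b0 _] := bI.
(* kappa0 / 2 and 1 keep the parameters in the range of [parameter_bounds];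
   1 / 200 and beta / 192 give |s| <= 3 eps <= 1 / 64 and |s| <= beta / 64 *)
exists (Num.min (Num.min (kappa0 / 2) 1) (Num.min (1 / 200) (beta / 192))).
  by rewrite !lt_min ltr01 andbT; apply/and3P; split; rewrite divr_gt0.
set eps := Num.min _ _.
have ek : eps <= kappa0 / 2 by rewrite /eps !ge_min lexx.
have e1 : eps <= 1 by rewrite /eps !ge_min lexx orbT.
have e2 : eps <= 1 / 200 by rewrite /eps !ge_min lexx !orbT.
have eb : eps <= beta / 192 by rewrite /eps !ge_min lexx !orbT.
move=> gamma Omega kappa V U P k0 hv _ aV van [Zr [ZC ZP hN]].
have N0 : (0 <= C1alpha_norm alpha (Zr \- cis)%R)%E.
  by rewrite !adde_ge0 ?sup_norm_ge0 ?holder_ge0.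
have hr : `|gamma - gamma0| + `|kappa - kappa0| + `|Omega - Omega0| < eps.
  by rewrite -lte_fin; apply: le_lt_trans hN; rewrite leeDr.
have hZ : (C1alpha_norm alpha (Zr \- cis)%R <= eps%:E)%E.
  by apply: ltW; apply: le_lt_trans hN; rewrite leeDl// lee_fin !addr_ge0.
have [n1 n2 n3] : [/\ 0 <= `|gamma - gamma0|, 0 <= `|kappa - kappa0| & 0 <= `|Omega - Omega0|] by [].
have [Yle dle] := pb gamma Omega kappa ltac:(lra) ltac:(lra) ltac:(lra).
have nc : near_circle eps (fun t => toC (Zr t)) (fun t => toC (derive1 Zr t)).
  by apply: near_circle_of_norm ZC hZ _; lra.
have [_ dZ cZ' _] := ZC.
split.
  exact: (core_disk k0 hv dZ cZ' ZP nc van aV e2 bI d0 Yle eb dle bd).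
exact: (velocity_disk k0 hv dZ cZ' ZP nc van aV e2 bI d0 Yle eb dle bd).
Qed.
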